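(* Let $n\geq 3$ be an integer. For every prime power $q$: $0$ is an eigenvalue of $\Delta_0^{+}(\mathrm{Fl}_{n,q})$ with multiplicity $1$, and $n-1$ is an eigenvalue with multiplicity $n-2$; moreover, if $n$ is even, $n-2$ is an eigenvalue with multiplicity $\binom{n}{n/2}_q-\binom{n}{n/2-1}_q$. In addition, there exist constants $q_0(n),C(n)>0$ (depending only on $n$) such that the following holds. For $1\leq k\leq \lfloor (n-1)/2\rfloor$ let $\alpha(k)=\min\{k/2,1\}$ and $$\mathcal{J}_{k}=\left\{ \pm 2\cos\left(\frac{j\pi}{n-2k+2}\right) :\, 1\leq j\leq \left\lfloor\frac{n-2k+1}{2}\right\rfloor\right\}.$$ For every $\zeta\in \mathcal{J}_k$ define $$D_{n,k,\zeta}(q)=\left\{\lambda\in \mathbb{R}:\, \left|\lambda-\left( n-2 + \zeta\cdot q^{-\frac{k}{2}}\right)\right|\leq C(n)\cdot q^{-(\frac{k}{2}+\alpha(k))}\right\}.$$ If $n$ is odd, let $\mathcal{D}_{k}=\{D_{n,k,\zeta}(q) :\, \zeta\in\mathcal{J}_k\}$. If $n$ is even, let $$\tilde{D}_{n,k}(q)=\left\{\lambda\in \mathbb{R}:\, \left|\lambda-\left(n-2+\frac{2(n-2k)}{n-2k+2}\cdot q^{-k}\right)\right|\leq C(n)\cdot q^{-(k+1)}\right\},$$ and let $\mathcal{D}_k=\{\tilde{D}_{n,k}(q)\}\cup \{D_{n,k,\zeta}(q) :\, \zeta\in\mathcal{J}_k\}$. Then, for every prime power $q\geq q_0(n)$,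 the intervals in $\bigcup_{k=1}^{\lfloor (n-1)/2 \rfloor}\mathcal{D}_k$ are pairwise disjoint, and for all $1\leq k\leq \lfloor (n-1)/2\rfloor$, every interval in $\mathcal{D}_k$ contains exactly one eigenvalue of $\Delta_0^{+}(\mathrm{Fl}_{n,q})$, with multiplicity $\binom{n}{k}_q-\binom{n}{k-1}_q$.
   Context: A linear subspace of $\mathbb{F}_q^n$ is non-trivial if it is neither $\{0\}$ nor $\mathbb{F}_q^n$. A flag is a family of nested non-trivial subspaces $V_1\subsetneq\cdots\subsetneq V_k$; a complete flag is a flag of length $n-1$. $\mathrm{Fl}_{n,q}$ is the simplicial complex whose vertices are the non-trivial subspaces of $\mathbb{F}_q^n$ and whose simplices are the families of subspaces forming a flag. For a simplex $\sigma$, $w(\sigma)$ is the number of complete flags containing $\sigma$. $C^0(\mathrm{Fl}_{n,q})$ is the space of real functions on the vertices, and $C^1(\mathrm{Fl}_{n,q})$ the space of real skew-symmetric functions on ordered $1$-simplices. The coboundary operator $d_0:C^0\to C^1$ is $(d_0\phi)([U,V])=\phi(V)-\phi(U)$. For $k=0,1$ the space $C^k$ carries the inner product $\langle\phi,\psi\rangle=\sum_{\sigma} w(\sigma)\phi(\sigma)\psi(\sigma)$, summed over $k$-simplices $\sigma$ (each given one fixed order). $d_0^*$ is the adjoint of $d_0$ with respect to these inner products, and $\Delta_0^{+}(\mathrm{Fl}_{n,q})=d_0^*d_0: C^0\to C^0$ (the weighted upper $0$-Laplacian). $\binom{a}{b}_q$ denotes the number of $b$-dimensional subspaces of $\mathbb{F}_q^a$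 ($0$ unless $a\ge b\ge 0$). *)

(* Defs.v *)
From HB Require Import structures.
From mathcomp Require Import all_boot all_order all_algebra.
From mathcomp Require Import boolp classical_sets reals exp trigo.

Set Implicit Arguments.
Unset Strict Implicit.
Unset Printing Implicit Defensive.

Import Order.TTheory GRing.Theory Num.Theory.
(* For the subtype structure of {vspace V}. *)
Import VectorInternalTheory.

Local Open Scope ring_scope.

HB.instance Definition _ (F : finFieldType) (V : vectType F) :=
  [Countable of {vspace V} by <:].
HB.instance Definition _ (F : finFieldType) (V : vectType F) :=
  [Finite of {vspace V} by <:].

(* The field F stands for F_q, so q = #|F|. *)
Definition qbinom (F : finFieldType) (a b : nat) : nat :=
  #|[set U : {vspace 'rV[F]_a} | \dim U == b]|.

Section FlagComplex.

Variables (F : finFieldType) (n : nat).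

Definition vertex :=
  {U : {vspace 'rV[F]_n} | (U != 0%VS) && (U != fullv)}.
HB.instance Definition _ := SubFinite.on vertex.

Definition subvertex (U V : vertex) : bool := (val U <= val V)%VS.

(* A flag is encoded as its set of members. *)
Definition is_flag (s : {set vertex}) : bool :=
  [forall U in s, forall V in s, subvertex U V || subvertex V U].

Definition is_complete_flag (s : {set vertex}) : bool :=
  is_flag s && (#|s| == n.-1).

Definition weight (s : {set vertex}) : nat :=
  #|[set t : {set vertex} | is_complete_flag t && (s \subset t)]|.

Definition is_oedge (e : vertex * vertex) : bool :=
  (e.1 != e.2) && is_flag [set e.1; e.2].

Definition oedge := {e : vertex * vertex | is_oedge e}.
HB.instance Definition _ := SubFinite.on oedge.

Definition src (e : oedge) : vertex := (val e).1.
Definition tgt (e : oedge) : vertex := (val e).2.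

Lemma is_oedge_rev (e : oedge) : is_oedge (tgt e, src e).
Proof. by rewrite /is_oedge /= eq_sym finset.setUC; exact: (valP e). Qed.

Definition rev_oedge (e : oedge) : oedge := Sub (tgt e, src e) (is_oedge_rev e).

Section Positivity.

Variable U : vertex.

Let X := vbasis (val U) ++ vbasis (val U)^C%VS.

Let spanX : <<X>>%VS = fullv.
Proof.
by rewrite span_cat !(span_basis (vbasisP _)) addv_complf.
Qed.

Let dimVn : \dim (fullv : {vspace 'rV[F]_n}) = n.
Proof. by rewrite dimvf /dim /= mul1n. Qed.

Let sizeX : size X = n.
Proof. by rewrite size_cat !size_tuple dimv_compl subnKC ?dimvS ?subvf. Qed.

Let freeX : free X.
Proof. by rewrite /free spanX sizeX dimVn. Qed.

Let dim_take i : (i <= n)%N -> \dim <<take i X>>%VS = i.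
Proof.
move=> lein; have: free (take i X).
  by have := freeX; rewrite -{1}(cat_take_drop i X) => /catl_free.
by move/eqP=> ->; rewrite size_take_min sizeX (minn_idPl _).
Qed.

Let subtake i j : (i <= j)%N -> (<<take i X>> <= <<take j X>>)%VS.
Proof.
move=> leij; apply: sub_span => x.
by rewrite -(take_takel X leij) => /mem_take.
Qed.

Let vtake_subproof (i : 'I_n.-1) :
  (<<take i.+1 X>>%VS != 0%VS) && (<<take i.+1 X>>%VS != fullv).
Proof.
have ltin : (i.+1 < n)%N by rewrite -ltn_predRL.
rewrite -dimv_eq0 dim_take ?(ltnW ltin) //=.
by apply/eqP => /(congr1 (fun V => \dim V)); rewrite dim_take ?(ltnW ltin) // dimVn
   => eqin; rewrite eqin ltnn in ltin.
Qed.

Lemma weight_vertex_gt0 : (0 < weight [set U])%N.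
Proof.
pose vt (i : 'I_n.-1) : vertex := Sub <<take i.+1 X>>%VS (vtake_subproof i).
have ltin (i : 'I_n.-1) : (i.+1 <= n)%N.
  by rewrite ltnW // -ltn_predRL.
apply/card_gt0P; exists [set vt i | i : 'I_n.-1]; rewrite inE.
apply/andP; split; last first.
  rewrite finset.sub1set; apply/imsetP.
  have := valP U; rewrite -dimv_eq0 -lt0n => /andP[dU0 dUf].
  have dUn : (\dim (val U) < n)%N.
    have := dimvS (subvf (val U)); rewrite dimVn leq_eqVlt => /orP[/eqP dU|//].
    by case/negP: dUf; rewrite eqEdim subvf dimVn dU leqnn.
  have lt : ((\dim (val U)).-1 < n.-1)%N by case: (\dim _) dU0 dUn; case: (n).
  exists (Ordinal lt) => //; apply: val_inj => /=.
  rewrite prednK // take_size_cat ?size_tuple //.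
  by rewrite (span_basis (vbasisP _)).
apply/andP; split.
  apply/forall_inP => _ /imsetP[i _ ->].
  apply/forall_inP => _ /imsetP[j _ ->].
  rewrite /subvertex /=.
  by case/orP: (leq_total i j) => le; apply/orP; [left|right]; exact: subtake.
rewrite card_imset ?card_ord // => i j /(congr1 val) /= eqt.
apply: val_inj; apply: succn_inj.
by rewrite -(dim_take (ltin i)) eqt dim_take.
Qed.

End Positivity.

Variable R : realType.

Definition C0 := {ffun vertex -> R^o}.

Definition skew : {pred {ffun oedge -> R^o}} :=
  fun psi => [forall e, psi (rev_oedge e) == - psi e].

Lemma skew_submod_closed : submod_closed skew.
Proof.
split=> [|a f g /forallP sf /forallP sg]; apply/forallP => e.
  by rewrite !ffunE oppr0.
by rewrite !ffunE (eqP (sf e)) (eqP (sg e)) scalerN opprD.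
Qed.

HB.instance Definition _ :=
  GRing.isSubmodClosed.Build R {ffun oedge -> R^o} skew skew_submod_closed.

Definition C1 := {psi : {ffun oedge -> R^o} | psi \in skew}.
HB.instance Definition _ := SubChoice.on C1.
HB.instance Definition _ := [SubChoice_isSubLmodule of C1 by <:].

Definition ip0 (phi psi : C0) : R :=
  \sum_(U : vertex) (weight [set U])%:R * phi U * psi U.

(* Each 1-simplex is summed once, ordered by inclusion. *)
Definition ip1 (phi psi : C1) : R :=
  \sum_(e : oedge | subvertex (src e) (tgt e))
    (weight [set src e; tgt e])%:R * val phi e * val psi e.

Lemma d0_subproof (phi : C0) :
  [ffun e : oedge => phi (tgt e) - phi (src e) : R^o] \in skew.
Proof. by apply/forallP => e; rewrite !ffunE opprB. Qed.

Definition d0 (phi : C0) : C1 := exist (fun psi => psi \in skew) _ (d0_subproof phi).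

Lemma d0E phi e : val (d0 phi) e = phi (tgt e) - phi (src e).
Proof. exact: ffunE. Qed.

Let valC1E a (f g : C1) e : val (a *: f + g) e = a * val f e + val g e.
Proof. by rewrite linearP !ffunE. Qed.

Lemma d0_is_linear : linear d0.
Proof.
move=> a f g; apply: val_inj; apply/ffunP => e.
by rewrite valC1E !d0E !ffunE mulrBr opprD addrACA.
Qed.

HB.instance Definition _ := GRing.isLinear.Build R C0 C1 _ d0 d0_is_linear.

Definition is_adjoint (d : C0 -> C1) (ds : C1 -> C0) : Prop :=
  forall phi psi, ip1 (d phi) psi = ip0 phi (ds psi).

Let delta (U : vertex) : C0 := [ffun V => (V == U)%:R].

Let ip0_delta U (phi : C0) : ip0 (delta U) phi = (weight [set U])%:R * phi U.
Proof.
rewrite /ip0 (bigD1 U) //= big1 ?addr0 => [|V /negPf nVU]; rewrite ffunE.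
  by rewrite eqxx mulr1.
by rewrite nVU mulr0 mul0r.
Qed.

Let weight_neq0 U : (weight [set U])%:R != 0 :> R.
Proof. by rewrite pnatr_eq0 -lt0n weight_vertex_gt0. Qed.

Let ip1_linearl psi : linear (fun phi => ip1 phi psi : R^o).
Proof.
move=> a f g; rewrite /ip1 scaler_sumr -big_split; apply: eq_bigr => e _ /=.
rewrite valC1E mulrDr mulrDl; congr (_ + _).
by rewrite /GRing.scale /= mulrCA !mulrA.
Qed.

Let ip1_linearr phi : linear (fun psi => ip1 phi psi : R^o).
Proof.
move=> a f g; rewrite /ip1 scaler_sumr -big_split; apply: eq_bigr => e _ /=.
by rewrite valC1E mulrDr; congr (_ + _); rewrite /GRing.scale /= mulrCA.
Qed.

Lemma d0_adj_exists : exists ds : C1 -> C0, is_adjoint d0 ds.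
Proof.
exists (fun psi => [ffun U => (weight [set U])%:R^-1 * ip1 (d0 (delta U)) psi]).
move=> phi psi.
pose L := HB.pack_for {linear C1 -> R^o} (fun phi => ip1 phi psi : R^o)
   (GRing.isLinear.Build _ _ _ _ _ (ip1_linearl psi)).
have phiE : phi = \sum_U phi U *: delta U.
  apply/ffunP => V; rewrite sum_ffunE (bigD1 V) //= big1 => [|W /negPf nWV].
    by rewrite !ffunE eqxx addr0 /GRing.scale /= mulr1.
  by rewrite !ffunE eq_sym nWV scaler0.
rewrite -[LHS]/(L _) [in LHS]phiE !linear_sum; apply: eq_bigr => U _.
by rewrite 2!linearZ ffunE mulrAC mulVKf // mulrC.
Qed.

Definition d0_adj : C1 -> C0 := sval (cid d0_adj_exists).

Lemma d0_adjP : is_adjoint d0 d0_adj.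
Proof. exact: svalP (cid d0_adj_exists). Qed.

Lemma d0_adjE psi U :
  d0_adj psi U = (weight [set U])%:R^-1 * ip1 (d0 (delta U)) psi.
Proof. by rewrite d0_adjP ip0_delta mulKf. Qed.

Lemma d0_adj_unique ds : is_adjoint d0 ds -> ds =1 d0_adj.
Proof.
move=> dsP psi; apply/ffunP => U.
by rewrite d0_adjE dsP ip0_delta mulKf.
Qed.

Lemma d0_adj_is_linear : linear d0_adj.
Proof.
move=> a f g; apply/ffunP => U; rewrite !ffunE !d0_adjE ip1_linearr mulrDr.
by rewrite /GRing.scale /= mulrCA.
Qed.

HB.instance Definition _ := GRing.isLinear.Build R C1 C0 _ d0_adj d0_adj_is_linear.

Definition upper_laplacian : 'End(C0) := linfun (d0_adj \o d0).

Lemma upper_laplacianE phi : upper_laplacian phi = d0_adj (d0 phi).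
Proof. by rewrite lfunE. Qed.

(* The operator is self-adjoint, so geometric and algebraic multiplicities
   agree. *)
Definition eigenvalue_mult (lambda : R) (m : nat) : Prop :=
  passmx.leigenvalue upper_laplacian lambda /\
  \dim (passmx.leigenspace upper_laplacian lambda) = m.

End FlagComplex.

Arguments eigenvalue_mult F n {R} lambda m.

Section Intervals.

Variable R : realType.

Local Open Scope classical_set_scope.

Definition alpha (k : nat) : R := Num.min (k%:R / 2) 1.

Definition Jset (n k : nat) : set R :=
  [set zeta | exists j : nat, (1 <= j <= (n - 2 * k + 1)./2)%N /\
    let c := 2 * cos (j%:R * pi / (n - 2 * k + 2)%:R) in
    zeta = c \/ zeta = - c].

Definition Dint (C : R) (n k : nat) (zeta : R) (q : nat) : set R :=
  [set lambda |
    `|lambda - (n%:R - 2 + zeta * q%:R `^ (- (k%:R / 2)))|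
      <= C * q%:R `^ (- (k%:R / 2 + alpha k))].

Definition Dtilde (C : R) (n k : nat) (q : nat) : set R :=
  [set lambda |
    `|lambda - (n%:R - 2
                + 2 * (n%:R - 2 * k%:R) / (n%:R - 2 * k%:R + 2) * q%:R ^- k)|
      <= C * q%:R ^- k.+1].

Definition Dfam (C : R) (n : nat) (q : nat) (k : nat) : set (set R) :=
  [set I | (exists2 zeta, Jset n k zeta & I = Dint C n k zeta q)
           \/ (~~ odd n /\ I = Dtilde C n k q)].

End Intervals.

(* Main.v *)
Require Import Defs.
From HB Require Import structures.
From mathcomp Require Import all_boot all_order all_algebra all_field.
From mathcomp Require Import boolp reals cyclic exp trigo.
From mathcomp Require Import zify ring lra.

(**
  The Laplacian is n - 2 minus an averaging operator: the weight of a flag depends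
  only on the dimensions of its members, so the weighted sum over the neighbours
  of a subspace U is the sum, over all dimensions e different from dim U, of the
  mean over the e-dimensional spaces comparable with U ([upper_laplacian_avg]).

  These means are iterates of the operators [up] and [dn], which sum a function
  over the subspaces covered by, resp. covering, a given one. The commutation
  relation [dn_up] makes the functions on the lattice of subspaces behave like a
  representation of a quantum sl2. They decompose into the layers obtained by
  applying [up] to the primitive functions, those of degree k <= n/2 that are
  killed by [dn] ([sum_layers]); primitive functions of degree k > 0 form a space
  of dimension qbinom n k - qbinom n (k - 1) ([dim_primitive]). Averaging maps the
  span of the layers of a given primitive function to itself, with a matrix that
  depends on k, n and q only ([avg_assemble]). So the eigenvalues n - 2 - mu of
  the Laplacian are given by the eigenvalues mu of these small matrices, with the
  dimensions of the spaces of primitive functions as multiplicities.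

  For k > 0 the matrix has size n - 2k + 1, entries 1 below the diagonal, products of
  the numbers [ratio] in (0, 1) above it, and 0 on it. The partial sums of an
  eigenvector satisfy a recursion of order two; this yields a characteristic
  polynomial [char_shoot] of degree n - 2k + 1 and shows that eigenvectors are
  unique up to scaling. For k = 0 the matrix is the all-ones matrix minus the
  identity, of size n - 1, which accounts for the eigenvalues 0 and n - 1 with
  multiplicities 1 and n - 2. That these multiplicities are exact for all q follows
  from [chain_solution_large] and [chain_solution_eq0]. The eigenvalue n - 2, that
  is mu = 0, occurs for k = n/2, and one has to exclude it for all k < n/2 and all
  q. Modulo a prime divisor of q^(n + 1 - k) - 1 with respect to which q has order
  n + 1 - k all ratios are 1, and the recursion at mu = 0 can be solved; such a
  prime exists by Zsigmondy's theorem ([primitive_divisor_exists]), which is proved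
  by means of a lower bound for cyclotomic polynomials; its exception 2^6 - 1 is
  computed separately ([shoot0_neq0]).

  For large q, put s = q^(-1/2). After the substitution mu = s^k z the recursion is a
  small perturbation of the one of the Chebyshev polynomials, whose roots
  2 cos(j pi / (n - 2k + 2)) are simple; a sign change then produces a root of
  [char_shoot] near each of them ([root_near_cheb]). When n is even one of these
  is 0, and the substitution mu = s^(2k) z locates the corresponding root more
  precisely ([root_near_tilde]). The leading terms a s^b so obtained are pairwise
  distinct, so for large q the intervals are disjoint ([branches_separated]). The
  only delicate coincidence of exponents is between the middle interval of k and
  those of 2k; there the coefficients differ because 2 (n - 2k) / (n - 2k + 2) is
  rational but not an integer, while 2 cos(j pi / N) is an algebraic integer
  ([cheb_root_neq_rat]). Finally, for each k there are as many intervals as the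
  degree of the characteristic polynomial, so each of them contains exactly one
  of its roots, and no root lies elsewhere ([branch_root_exhaust]).
*)

Set Implicit Arguments.
Unset Strict Implicit.
Unset Printing Implicit Defensive.
Import Order.TTheory GRing.Theory Num.Theory.
Import VectorInternalTheory.

Local Open Scope ring_scope.

(** * Subspaces of a finite vector space *)

Section QIntegers.
Local Open Scope nat_scope.

(** The q-integer, which is also the number of lines of a space of dimension g
    over a field with q elements. *)
Definition qnat (q g : nat) : nat := \sum_(i < g) q ^ i.

Lemma qnatE q g : q.-1 * qnat q g = (q ^ g).-1.
Proof. by rewrite /qnat predn_exp. Qed.

Lemma qnat0 q : qnat q 0 = 0. Proof. by rewrite /qnat big_ord0. Qed.

Lemma qnatS q g : qnat q g.+1 = qnat q g + q ^ g.
Proof. by rewrite /qnat big_ord_recr. Qed.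

Lemma qnat_lt q a b : 0 < q -> a < b -> qnat q a < qnat q b.
Proof.
move=> q0 ab; rewrite -(subnK ab) addnC; elim: (b - a.+1) => [|c IH].
  by rewrite addn0 qnatS -[X in (X < _)]addn0 ltn_add2l expn_gt0 q0.
by rewrite addnS qnatS ltn_addr.
Qed.

Lemma qnat_geom (R : numFieldType) q g : 0 < q ->
  ((q%:R - 1) * (qnat q g)%:R = q%:R ^+ g - 1 :> R)%R.
Proof.
move=> q0; move: (qnatE q g); rewrite -!subn1 => /(congr1 (fun m => m%:R%R : R)).
by rewrite natrM !natrB ?expn_gt0 ?q0 // natrX.
Qed.

Lemma qnat_gt0 q g : (0 < g) -> 0 < qnat q g.
Proof. by case: g => // g _; rewrite /qnat big_ord_recl expn0. Qed.

End QIntegers.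

Section Subspaces.
Local Open Scope nat_scope.
Variables (F : finFieldType) (n : nat).
Local Notation V := 'rV[F]_n.
Local Notation T := {vspace V}.
Local Notation q := #|F|.

Lemma dimVn : \dim (fullv : T) = n.
Proof. by rewrite dimvf /dim /= mul1n. Qed.

Lemma dim_leqn (U : T) : \dim U <= n.
Proof. by rewrite -[leqRHS]dimVn dimvS ?subvf. Qed.

Lemma q_gt1 : 1 < q. Proof. exact: finRing_gt1. Qed.

Lemma card_sub (U : T) : #|[set x in U]| = q ^ \dim U.
Proof. by rewrite cardsE card_vspace. Qed.

(** The vectors of U outside W are partitioned by the space that they span together
    with W. The block of X consists of the vectors of X outside W, so all blocks
    have the same size and the count is a quotient of numbers of vectors. *)
Lemma card_covers (W U : T) : (W <= U)%VS ->
  #|[set X : T | [&& (W <= X)%VS, (X <= U)%VS & \dim X == (\dim W).+1]]|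
    = qnat q (\dim U - \dim W).
Proof.
move=> sWU; set P := [set X | _].
set D := [set x in U | x \notin W].
have dimS x : x \notin W -> \dim (W + <[x]>) = (\dim W).+1.
  move=> nWx; have x0 : x != 0%R by apply: contraNneq nWx => ->; exact: mem0v.
  rewrite dimv_disjoint_sum ?dim_vline ?x0 ?addn1 //; apply/eqP.
  rewrite -subv0; apply/subvP => y /memv_capP[yW /vlineP[a ya]].
  rewrite memv0 ya scaler_eq0; case: eqP => //= a0; case/negP: nWx.
  by rewrite -[x]scale1r -(mulVf (introN eqP a0)) -scalerA -ya memvZ.
have cardD X : (W <= X)%VS -> #|[set x in X | x \notin W]| = q ^ \dim X - q ^ \dim W.
  move=> sWX; rewrite -!card_sub -[in RHS](cardsID [set x in W] [set x in X]).
  rewrite (_ : _ :&: _ = [set x in W]); last first.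
    by apply/setP => x; rewrite !inE andb_idl // => /(subvP sWX).
  by rewrite addKn; apply: eq_card => x; rewrite !inE andbC.
have := cardD U sWU; rewrite -/D.
rewrite -sum1_card (partition_big (fun x => (W + <[x]>)%VS) (mem P)) /=; last first.
  move=> x; rewrite !inE => /andP[xU xW]; rewrite addvSl subv_add sWU.
  by rewrite -memvE xU dimS //=.
rewrite (eq_bigr (fun _ => q ^ (\dim W).+1 - q ^ \dim W)); last first.
  move=> X; rewrite inE => /and3P[sWX sXU /eqP dX]; rewrite -dX -cardD //.
  rewrite -sum1_card; apply: eq_bigl => x; rewrite !inE.
  case xW: (x \in W); rewrite ?andbF //=.
  apply/andP/idP => [[xU /eqP<-]|/andP[xX _]].
    by rewrite andbT memvE addvSr.
  split; first by rewrite (subvP sXU).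
  by rewrite eqEdim subv_add sWX -memvE xX /= dimS ?xW // dX.
rewrite sum_nat_const => E.
have h a b : a * b - b = a.-1 * b by rewrite -subn1 mulnBl mul1n.
have Eu : q ^ \dim U = q ^ (\dim U - \dim W) * q ^ \dim W.
  by rewrite -expnD subnK ?dimvS.
move: E; rewrite Eu expnS !h -qnatE [_ * qnat _ _]mulnC -mulnA => /eqP.
by rewrite eqn_pmul2r ?muln_gt0 ?expn_gt0 -?subn1 ?subn_gt0 ?(ltnW q_gt1) ?q_gt1 // => /eqP.
Qed.

(** Orthogonal complement for the standard bilinear form. As it reverses
    inclusions, every count of superspaces follows from a count of subspaces. *)
Definition perp (U : T) : T := mx2vs (kermx (vs2mx U)^T).

Lemma dim_perp U : \dim (perp U) = n - \dim U.
Proof.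
rewrite /dimv /perp mx2vsK mxrank_ker mxrank_tr; congr (_ - _).
by rewrite /dim /= mul1n.
Qed.

Lemma perpS U W : (U <= W)%VS -> (perp W <= perp U)%VS.
Proof.
rewrite /subsetv /perp !mx2vsK => /submxP[D ->].
by rewrite sub_kermx trmx_mul mulmxA mulmx_ker mul0mx.
Qed.

Lemma perpK : involutive perp.
Proof.
move=> U; apply/esym/eqP; rewrite eqEdim !dim_perp subKn ?dim_leqn // leqnn andbT.
rewrite /subsetv {1}/perp mx2vsK sub_kermx -[X in (X *m _)%R]trmxK -trmx_mul.
by rewrite trmx_eq0 -sub_kermx /perp mx2vsK.
Qed.

Lemma perp_sub U W : (perp W <= perp U)%VS = (U <= W)%VS.
Proof. by apply/idP/idP => /perpS; rewrite ?perpK. Qed.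

Lemma card_cocovers (W U : T) : (W <= U)%VS ->
  #|[set X : T | [&& (W <= X)%VS, (X <= U)%VS & (\dim X).+1 == \dim U]]|
    = qnat q (\dim U - \dim W).
Proof.
move=> sWU; have := card_covers (perpS sWU); rewrite !dim_perp.
have [dU dW] := (dim_leqn U, dim_leqn W).
have -> : n - \dim W - (n - \dim U) = \dim U - \dim W by lia.
move=> <-; rewrite -(card_imset _ (inv_inj perpK)); apply: eq_card => X.
rewrite !inE; apply/imsetP/idP => [[Y] | /and3P[sUX sXW /eqP dX]].
  rewrite inE => /and3P[sWY sYU /eqP dY] ->; rewrite !perp_sub sYU sWY dim_perp.
  by have dYn := dim_leqn Y; apply/eqP; lia.
exists (perp X); last by rewrite perpK.
rewrite inE -perp_sub perpK sXW -[X in (_ <= X)%VS]perpK perp_sub sUX dim_perp dX.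
by apply/eqP; have := dim_leqn X; lia.
Qed.

Lemma qbinom_sym k : k <= n -> qbinom F n (n - k) = qbinom F n k.
Proof.
move=> lekn; rewrite /qbinom -(card_imset _ (inv_inj perpK)).
apply: eq_card => X; rewrite !inE; apply/imsetP/eqP => [[Y]|dX].
  by rewrite inE => /eqP dY ->; rewrite dim_perp dY subKn.
by exists (perp X); rewrite ?perpK // inE dim_perp dX.
Qed.

End Subspaces.

(** * Summing over the covers of a subspace *)

Section QFactorials.
Local Open Scope nat_scope.

Definition qfact (q g : nat) : nat := \prod_(i < g) qnat q i.+1.
(** The q-analogue of the falling factorial. *)
Definition qffact (q a g : nat) : nat := \prod_(i < g) qnat q (a - i).

Lemma qfact0 q : qfact q 0 = 1. Proof. by rewrite /qfact big_ord0. Qed.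
Lemma qfactS q g : qfact q g.+1 = qnat q g.+1 * qfact q g.
Proof. by rewrite /qfact big_ord_recr mulnC. Qed.
Lemma qfact_gt0 q g : 0 < qfact q g.
Proof. by rewrite prodn_gt0 // => i; rewrite qnat_gt0. Qed.
Lemma qffact0 q a : qffact q a 0 = 1. Proof. by rewrite /qffact big_ord0. Qed.
Lemma qffactSS q a g : qffact q a.+1 g.+1 = qnat q a.+1 * qffact q a g.
Proof.
by rewrite /qffact big_ord_recl subn0; congr (_ * _); apply: eq_bigr => i _; rewrite subSS.
Qed.
Lemma qffact_fact q a g : g <= a -> qffact q a g * qfact q (a - g) = qfact q a.
Proof.
elim: g a => [|g IH] [|a] // lega; first by rewrite qffact0 mul1n.
by rewrite qffact0 mul1n subn0.
by rewrite qffactSS -mulnA subSS IH // qfactS.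
Qed.

End QFactorials.

Section UpDown.
Local Open Scope nat_scope.
Variables (F : finFieldType) (n : nat) (R : numFieldType).
Local Notation V := 'rV[F]_n.
Local Notation T := {vspace V}.
Local Notation q := #|F|.
Local Notation FV := {ffun T -> R^o}.

Definition covers (W U : T) := (W <= U)%VS && (\dim U == (\dim W).+1).

Local Open Scope ring_scope.

Definition up (f : FV) : FV := [ffun U => \sum_(W | covers W U) f W].
Definition dn (f : FV) : FV := [ffun W => \sum_(U | covers W U) f U].

Lemma up_is_linear : linear up.
Proof.
move=> a f g; apply/ffunP => U; rewrite !ffunE scaler_sumr -big_split.
by apply: eq_bigr => W _; rewrite !ffunE.
Qed.
HB.instance Definition _ := GRing.isLinear.Build R FV FV _ up up_is_linear.
Lemma dn_is_linear : linear dn.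
Proof.
move=> a f g; apply/ffunP => U; rewrite !ffunE scaler_sumr -big_split.
by apply: eq_bigr => W _; rewrite !ffunE.
Qed.
HB.instance Definition _ := GRing.isLinear.Build R FV FV _ dn dn_is_linear.

(** Distinct subspaces have at most one common cover, their sum. With
    [covers_meet] this makes the off-diagonal parts of the two composites of [up]
    and [dn] agree. *)
Lemma covers_join (W X U : T) : X != W ->
  covers W U && covers X U =
  [&& U == (W + X)%VS, \dim X == \dim W & \dim (W + X)%VS == (\dim W).+1].
Proof.
move=> nXW; apply/idP/and3P => [/andP[/andP[sWU /eqP dU] /andP[sXU]]|[/eqP-> /eqP dX dU]].
  rewrite dU eqSS eq_sym => /eqP dX.
  have sWXU : (W + X <= U)%VS by rewrite subv_add sWU.
  have dWX : \dim (W + X)%VS = (\dim W).+1.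
    apply/eqP; rewrite eqn_leq -dU dimvS //= dU ltnNge; apply: contra nXW => le.
    have /eqP WE : W == (W + X)%VS by rewrite eqEdim addvSl.
    by rewrite eqEdim dX leqnn andbT WE addvSr.
  split; rewrite ?dX ?dWX //.
  by rewrite eq_sym eqEdim sWXU dU dWX /=.
by rewrite /covers addvSl addvSr dX dU.
Qed.

Lemma covers_meet (W X Y : T) : X != W ->
  covers Y W && covers Y X =
  [&& Y == (W :&: X)%VS, \dim X == \dim W & \dim (W + X)%VS == (\dim W).+1].
Proof.
move=> nXW; have dim2 := dimv_sum_cap W X.
apply/idP/and3P => [/andP[/andP[sYW /eqP dW] /andP[sYX /eqP dX]]|[/eqP-> /eqP dX /eqP dU]].
  have sYWX : (Y <= W :&: X)%VS by rewrite subv_cap sYW.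
  have le1 := dimvS sYWX.
  have nle : ~~ (\dim W <= \dim (W :&: X))%N.
    apply: contra nXW => le; have /eqP WE : (W :&: X)%VS == W by rewrite eqEdim capvSl.
    by rewrite eq_sym eqEdim dX dW leqnn andbT -WE capvSr.
  split; [|by rewrite dX dW|by apply/eqP; lia].
  by rewrite eqEdim sYWX; lia.
rewrite /covers capvSl capvSr dX; apply/andP; split; apply/eqP; lia.
Qed.

(** Written for an arbitrary condition [b] so as to turn the right-hand sides of
    [covers_join] and [covers_meet] into numbers. *)
Lemma card_delta (Z : T) (b : bool) : #|(fun U : T => (U == Z) && b)| = b.
Proof.
case: b; last by apply: eq_card0 => U; rewrite /in_mem /= andbF.
by apply: etrans (card1 Z); apply: eq_card => U; rewrite !inE ?andbT ?unfold_in ?andbT.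
Qed.

Lemma card_up_covers (W : T) : #|[pred U | covers W U]| = qnat q (n - \dim W).
Proof.
have := card_covers (subvf W); rewrite dimVn => <-.
by apply: eq_card => U; rewrite !inE subvf.
Qed.

Lemma card_down_covers (U : T) : #|[pred W | covers W U]| = qnat q (\dim U).
Proof.
have := card_cocovers (sub0v U); rewrite dimv0 subn0 => <-.
by apply: eq_card => W; rewrite !inE sub0v /covers eq_sym.
Qed.

(** Off the diagonal both composites count the pairs of equal dimension that meet
    in codimension one. On the diagonal they count the covers of W and the
    subspaces covered by W. *)
Lemma dn_up (f : FV) W :
  dn (up f) W = up (dn f) W + ((qnat q (n - \dim W))%:R - (qnat q (\dim W))%:R) * f W.
Proof.
have E1 : dn (up f) W = \sum_X #|[pred U | covers W U && covers X U]|%:R * f X.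
  rewrite ffunE; under eq_bigr do rewrite ffunE.
  rewrite (exchange_big_dep predT) //=; apply: eq_bigr => X _.
  by rewrite sumr_const mulr_natl.
have E2 : up (dn f) W = \sum_X #|[pred Y | covers Y W && covers Y X]|%:R * f X.
  rewrite ffunE; under eq_bigr do rewrite ffunE.
  rewrite (exchange_big_dep predT) //=; apply: eq_bigr => X _.
  by rewrite sumr_const mulr_natl.
rewrite E1 E2 (bigD1 W) //= [in RHS](bigD1 W) //=.
rewrite (eq_bigr (fun X => #|[pred Y | covers Y W && covers Y X]|%:R * f X)); last first.
  move=> X nXW; congr (_%:R * _).
  rewrite (eq_card (fun U => covers_join U nXW)) (eq_card (fun U => covers_meet U nXW)).
  by rewrite !card_delta.
have -> : #|[pred U | covers W U && covers W U]| = qnat q (n - \dim W).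
  by rewrite -card_up_covers; apply: eq_card => U; rewrite !inE andbb.
have -> : #|[pred U | covers U W && covers U W]| = qnat q (\dim W).
  by rewrite -card_down_covers; apply: eq_card => U; rewrite !inE andbb.
by ring.
Qed.

(** An inclusion of codimension g is refined by [g]! maximal chains. *)
Lemma iter_upE g (f : FV) U :
  iter g up f U = (qfact q g)%:R * \sum_(W | (W <= U)%VS && (\dim W + g == \dim U)%N) f W.
Proof.
elim: g U => [|g IH] U /=.
  rewrite qfact0 mul1r (big_pred1 U) // => W /=.
  by rewrite addn0 eqEdim; case sWU: (_ <= _)%VS => //=; rewrite eqn_leq dimvS.
rewrite ffunE (eq_bigr _ (fun W _ => IH W)).
rewrite -big_distrr /= (exchange_big_dep (fun W => (W <= U)%VS && (\dim W + g.+1 == \dim U)%N)) /=; last first.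
  move=> X W /andP[sXU /eqP dU] /andP[sWX /eqP dX].
  by rewrite (subv_trans sWX) //; apply/eqP; lia.
rewrite qfactS mulnC natrM -mulrA; congr (_ * _); rewrite big_distrr /=.
apply: eq_bigr => W /andP[sWU /eqP dU].
rewrite sumr_const mulr_natl; congr (_ *+ _).
have -> : g.+1 = (\dim U - \dim W)%N by lia.
rewrite -card_cocovers //; apply: eq_card => X; rewrite !inE /covers.
apply/andP/and3P => [[/andP[-> /eqP dX] /andP[-> _]]|[-> -> /eqP dX]]; split=> //; lia.
Qed.

Lemma iter_dnE g (f : FV) W :
  iter g dn f W = (qfact q g)%:R * \sum_(U | (W <= U)%VS && (\dim W + g == \dim U)%N) f U.
Proof.
elim: g W => [|g IH] W /=.
  rewrite qfact0 mul1r (big_pred1 W) // => U /=.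
  rewrite addn0 [RHS]eq_sym [RHS]eqEdim; case sWU: (W <= U)%VS => //=.
  by rewrite eqn_leq dimvS.
rewrite ffunE (eq_bigr _ (fun W _ => IH W)).
rewrite -big_distrr /= (exchange_big_dep (fun U => (W <= U)%VS && (\dim W + g.+1 == \dim U)%N)) /=; last first.
  move=> X U /andP[sXU /eqP dU] /andP[sWX /eqP dX].
  by rewrite (subv_trans sXU) //; apply/eqP; lia.
rewrite qfactS mulnC natrM -mulrA; congr (_ * _); rewrite big_distrr /=.
apply: eq_bigr => U /andP[sWU /eqP dU].
rewrite sumr_const mulr_natl; congr (_ *+ _).
have -> : g.+1 = (\dim U - \dim W)%N by lia.
rewrite -card_covers //; apply: eq_card => X; rewrite !inE /covers.
apply/andP/and3P => [[/andP[-> /eqP dX] /andP[-> _]]|[-> -> /eqP dX]]; split=> //; lia.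
Qed.

Let one : FV := [ffun => 1].

(** Iterating [up] on the constant function 1 counts the chains of length g that
    end at U, in two ways. *)
Lemma card_subspaces g (U : T) :
  (qfact q g * #|[set W : T | (W <= U)%VS && (\dim W + g == \dim U)%N]| = qffact q (\dim U) g)%N.
Proof.
have E : iter g up one U = (qffact q (\dim U) g)%:R.
  elim: g U => [|g IH] U /=; first by rewrite ffunE qffact0.
  rewrite ffunE (eq_bigr (fun _ => (qffact q (\dim U).-1 g)%:R)); last first.
    by move=> W /andP[_ /eqP dU]; rewrite IH dU.
  rewrite sumr_const.
  rewrite card_down_covers.
  case: (\dim U) => [|d]; last by rewrite qffactSS natrM mulr_natl.
  by rewrite qnat0 mulr0n /qffact big_ord_recl qnat0 mul0n.
apply/eqP; rewrite -(@eqr_nat R) -E iter_upE natrM; apply/eqP; congr (_ * _).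
rewrite -sumr_const big_set.
by apply: eq_bigr => W; rewrite ffunE.
Qed.

Lemma card_superspaces g (W : T) :
  (qfact q g * #|[set U : T | (W <= U)%VS && (\dim W + g == \dim U)%N]|
     = qffact q (n - \dim W) g)%N.
Proof.
rewrite -(dim_perp W) -card_subspaces; congr (_ * _)%N.
rewrite -(card_imset _ (inv_inj (@perpK F n))); apply: eq_card => X.
rewrite !inE; apply/imsetP/andP => [[Y]|[sX /eqP dX]].
  rewrite inE => /andP[sWY /eqP dY] ->; rewrite perp_sub sWY !dim_perp.
  by split=> //; apply/eqP; have := dim_leqn Y; lia.
exists (perp X); last by rewrite perpK.
rewrite inE -perp_sub perpK sX dim_perp /=; apply/eqP; move: dX; rewrite dim_perp.
by have := dim_leqn X; have := dim_leqn W; lia.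
Qed.

End UpDown.

(** * Flags and their weights *)

Section Flags.
Local Open Scope nat_scope.
Variables (F : finFieldType) (n : nat).
Local Notation T := {vspace 'rV[F]_n}.
Local Notation q := #|F|.
Local Notation vx := (vertex F n).

Definition vdim (U : vx) := \dim (val U).

Lemma vdim_bounds (U : vx) : 0 < vdim U < n.
Proof.
rewrite /vdim; have /andP[U0 Uf] := valP U.
rewrite lt0n dimv_eq0 U0 ltn_neqAle dim_leqn andbT.
by apply: contra Uf => /eqP dU; rewrite eqEdim subvf dU dimVn /=.
Qed.

Lemma proper_vertex (U : T) : 0 < \dim U < n -> exists V : vx, U = val V.
Proof.
move=> /andP[d0 dn_]; have vU : (U != 0%VS) && (U != fullv).
  by rewrite -dimv_eq0 -lt0n d0; apply: contraTneq dn_ => ->; rewrite dimVn ltnn.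
by exists (Sub U vU); rewrite SubK.
Qed.

Definition compat (U V : vx) := subvertex U V || subvertex V U.

Lemma compat_sym U V : compat U V = compat V U.
Proof. by rewrite /compat orbC. Qed.

Lemma compat_refl U : compat U U.
Proof. by rewrite /compat /subvertex subvv. Qed.

Lemma subvertexE U V : compat U V -> vdim U <= vdim V -> subvertex U V.
Proof.
case/orP => // sVU le; suff /eqP -> : U == V by rewrite /subvertex subvv.
by rewrite eq_sym -val_eqE eqEdim; apply/andP.
Qed.

Lemma compat_dim_eq U V : compat U V -> vdim U = vdim V -> U = V.
Proof.
move=> c e; apply: val_inj; apply/eqP; rewrite eqEdim.
by rewrite [X in X && _](subvertexE c) ?e //= -/(vdim V) -e.
Qed.

Lemma flagP (s : {set vx}) : reflect {in s &, forall U V, compat U V} (is_flag s).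
Proof.
apply: (iffP forall_inP) => [h U V Us Vs|h U Us]; first by have /forall_inP := h U Us; apply.
by apply/forall_inP => V; apply: h.
Qed.

Lemma flagS (s t : {set vx}) : s \subset t -> is_flag t -> is_flag s.
Proof.
by move=> /subsetP st /flagP h; apply/flagP => U V /st Ut /st; exact: h.
Qed.

Lemma flagU1 X (s : {set vx}) : is_flag (X |: s) = is_flag s && [forall Y in s, compat X Y].
Proof.
apply/idP/andP => [f|[/flagP f /forall_inP h]].
  split; first exact: flagS (subsetUr _ _) f.
  by apply/forall_inP => Y Ys; move/flagP: f; apply; rewrite !inE ?eqxx ?Ys ?orbT.
apply/flagP => U V; rewrite !inE => /orP[/eqP->|Us] /orP[/eqP->|Vs].
- exact: compat_refl.
- exact: h.
- by rewrite compat_sym h.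
- exact: f.
Qed.

Lemma flag_dim_inj (s : {set vx}) : is_flag s -> {in s &, injective vdim}.
Proof. by move=> /flagP f U V Us Vs; apply: compat_dim_eq; apply: f. Qed.

Definition dims (s : {set vx}) : {set 'I_n} :=
  [set i : 'I_n | [exists X in s, vdim X == i]].

Lemma card_dims (s : {set vx}) : is_flag s -> #|dims s| = #|s|.
Proof.
move=> f; pose h (X : vx) : 'I_n := Ordinal (proj2 (andP (vdim_bounds X))).
rewrite -(@card_in_imset _ _ h s); last first.
  by move=> X Y Xs Ys /(congr1 val) /= e; apply: (flag_dim_inj f).
apply: eq_card => i; rewrite inE; apply/exists_inP/imsetP => -[X Xs].
  by move=> /eqP dX; exists X => //; apply: val_inj.
by move=> ->; exists X.
Qed.

Lemma dims_nonzero (s : {set vx}) (i : 'I_n) : i \in dims s -> 0 < i.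
Proof.
by rewrite inE => /exists_inP[X _ /eqP <-]; case/andP: (vdim_bounds X).
Qed.

Lemma complete_dims (s : {set vx}) :
  is_flag s -> (#|s| == n.-1) = [forall i : 'I_n, (0 < i) ==> (i \in dims s)].
Proof.
move=> f; rewrite -(card_dims f).
have sub : dims s \subset [set i : 'I_n | 0 < i].
  by apply/subsetP => i /dims_nonzero; rewrite inE.
have cardpos : #|[set i : 'I_n | 0 < i]| = n.-1.
  case: n => [|m]; first by apply: eq_card0 => -[].
  rewrite -[RHS](card_ord m) -[RHS](card_imset _ (@lift_inj _ ord0)).
  apply: eq_card => i; rewrite inE; apply/idP/imsetP => [i0|[j _ ->]] //.
  by case: (unliftP ord0 i) i0 => [j ->|-> //] _; exists j.
have /= := subset_leqif_cards sub; rewrite cardpos => -[_ ->].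
apply/eqP/forallP => [E i|h].
  by apply/implyP => i0; rewrite E inE.
apply/eqP; rewrite finset.eqEsubset sub; apply/subsetP => i; rewrite inE.
exact/implyP.
Qed.

(** A complete flag containing [s] has exactly one member of dimension [i]. *)
Lemma weightE (s : {set vx}) (i : 'I_n) : 0 < i ->
  weight s = \sum_(X : vx | vdim X == i) weight (X |: s).
Proof.
move=> i0; rewrite /weight -sum1_card.
under [RHS]eq_bigr do rewrite -sum1_card.
rewrite [RHS](exchange_big_dep (mem [set t : {set vx} | is_complete_flag t && (s \subset t)])) /=; last first.
  move=> X t _; rewrite !inE => /andP[-> ]; exact: subset_trans (subsetUr _ _).
apply: eq_bigr => t; rewrite inE => /andP[ct st].
have /andP[ft] := ct; rewrite complete_dims // => /forallP /(_ i).
rewrite i0 inE => /exists_inP[X Xt dX].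
rewrite (big_pred1 X) // => Y; rewrite /= !inE ct finset.subUset finset.sub1set st andbT /=.
apply/andP/eqP => [[dY Yt]|->]; last by [].
by apply: (flag_dim_inj ft) => //; rewrite (eqP dX) (eqP dY).
Qed.

Lemma weight_not_flag (s : {set vx}) : ~~ is_flag s -> weight s = 0.
Proof.
move=> nf; apply: eq_card0 => t; rewrite inE; apply/negP => /andP[/andP[ft _] st].
by case/negP: nf; apply: flagS ft.
Qed.

(** The dimension of the first member of the flag above [i], or [n] when there is
    none; a maximum of [n - j] gives [n] on the empty range. *)
Definition next_dim (D : {set 'I_n}) (i : 'I_n) : nat :=
  n - \max_(j in D | i < j) (n - j).

(** When [i] is the smallest dimension that does not occur in [s], the new member
    has to lie between the member of dimension [i.-1] and the next larger one, so
    [card_covers] applies. *)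
Lemma flag_extensions (s : {set vx}) (i : 'I_n) : is_flag s -> i \notin dims s -> 0 < i ->
  (forall j : 'I_n, 0 < j < i -> j \in dims s) ->
  #|[set X : vx | (vdim X == i) && is_flag (X |: s)]| = qnat q (next_dim (dims s) i - i.-1).
Proof.
move=> fs nis i0 low.
(* The lower bound W for the new member, and then its upper bound Z. *)
have [W [dW W0 WP]] : exists W : T, [/\ \dim W = i.-1,
      W = 0%VS \/ exists2 Y, Y \in s & W = val Y /\ vdim Y < i &
    forall X : vx, vdim X = i ->
      (W <= val X)%VS = [forall Y in s, (vdim Y < i) ==> subvertex Y X]].
  have [i1|i1] := eqVneq (i : nat) 1.
    exists 0%VS; rewrite dimv0 i1; split=> [//||X dX]; first by left.
    rewrite sub0v.
    apply/esym/forall_inP => Y _; apply/implyP.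
    by have := vdim_bounds Y; lia.
  have lt : i.-1 < n by have := ltn_ord i; lia.
  have : Ordinal lt \in dims s by apply: low => /=; lia.
  rewrite inE => /exists_inP[W Ws /eqP /= dW]; exists (val W); split=> [//||X dX].
    by right; exists W => //; split=> //; lia.
  apply/idP/forall_inP => [sWX Y Ys|h]; last by have /implyP := h W Ws; apply; rewrite dW; lia.
  apply/implyP => Yi; rewrite /subvertex; apply: subv_trans sWX.
  by apply: subvertexE; [apply: (flagP _ fs) | rewrite dW; lia].
have [Z [dZ Z1 ZP]] : exists Z : T, [/\ \dim Z = next_dim (dims s) i,
      Z = fullv \/ exists2 Y, Y \in s & Z = val Y /\ i < vdim Y &
    forall X : vx, vdim X = i ->
      (val X <= Z)%VS = [forall Y in s, (i < vdim Y) ==> subvertex X Y]].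
  have [/existsP[Y0 Y0s]|no] := boolP [exists Y, (Y \in s) && (i < vdim Y)].
    case: (@arg_minnP _ Y0 (fun Y => (Y \in s) && (i < vdim Y)) vdim Y0s) => Z /andP[Zs iZ] Zmin {Y0 Y0s}.
    have dimZ : vdim Z = next_dim (dims s) i.
      have ltZ : vdim Z < n by case/andP: (vdim_bounds Z).
      rewrite /next_dim; set M := \max_(j in _ | _) _.
      suff : M = n - vdim Z by lia.
      apply/eqP; rewrite eqn_leq; apply/andP; split.
        apply/bigmax_leqP => j /andP[]; rewrite inE => /exists_inP[Y Ys /eqP <-] iY.
        by apply: leq_sub2l; apply: Zmin; rewrite Ys.
      apply: (@bigop.bigmax_sup _ (Ordinal ltZ)) => //=; rewrite inE iZ andbT.
      by apply/exists_inP; exists Z => //=.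
    exists (val Z); split=> [//||X dX]; first by right; exists Z.
    apply/idP/forall_inP => [sXZ Y Ys|h]; last by have /implyP := h Z Zs; apply.
    apply/implyP => iY; rewrite /subvertex; apply: (subv_trans sXZ).
    by apply: subvertexE; [apply: (flagP _ fs) | apply: Zmin; rewrite Ys].
  exists fullv; split; [|by left|]; last first.
    move=> X dX; rewrite subvf; apply/esym/forall_inP => Y Ys; apply/implyP => iY.
    by case/negP: no; apply/existsP; exists Y; rewrite Ys.
  rewrite dimVn /next_dim big1 ?subn0 // => j /andP[].
  rewrite inE => /exists_inP[Y Ys /eqP <-] iY.
  by case/negP: no; apply/existsP; exists Y; rewrite Ys.
have key (X : vx) : vdim X = i -> is_flag (X |: s) = (W <= val X <= Z)%VS.
  move=> dX; rewrite flagU1 fs WP // ZP //=; apply/forall_inP/andP.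
    move=> h; split; apply/forall_inP => Y Ys; apply/implyP => lt.
      by apply: subvertexE; rewrite ?dX 1?ltnW // compat_sym h.
    by apply: subvertexE; rewrite ?dX 1?ltnW // h.
  move=> [/forall_inP h1 /forall_inP h2] Y Ys.
  have [lt|lt|e] := ltngtP (vdim Y) i.
  - by have := h1 Y Ys; rewrite lt /compat => /= ->; rewrite orbT.
  - by have := h2 Y Ys; rewrite lt /compat => /= ->.
  - by case/negP: nis; rewrite inE; apply/exists_inP; exists Y => //; rewrite e.
have iZ : i < \dim Z.
  rewrite dZ /next_dim .
  have : \max_(j in dims s | i < j) (n - j) <= (n - i).-1.
    by apply/bigmax_leqP => j /andP[_ ij]; have := ltn_ord i; lia.
  by have := ltn_ord i; lia.
rewrite -dZ -dW.
have sWZ : (W <= Z)%VS.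
  case: W0 Z1 => [->|[Y Ys [-> lt]]] [->|[Y' Ys' [-> lt']]]; rewrite ?sub0v ?subvf //.
  by apply: subvertexE; [apply: (flagP _ fs) | lia].
rewrite -card_covers // -(card_imset _ val_inj); apply: eq_card => X.
rewrite inE dW (prednK i0); apply/imsetP/and3P => [[Y]|[sWX sXZ /eqP dX]].
  rewrite inE => /andP[/eqP dY]; rewrite key // => /andP[h1 h2] ->.
  by split=> //; apply/eqP.
have [Y XY] : exists Y : vx, X = val Y by apply: proper_vertex; rewrite dX i0 ltn_ord.
have dY : vdim Y = i by rewrite /vdim -XY.
by exists Y => //; rewrite inE dY eqxx key // -XY sWX.
Qed.

End Flags.

Section Weights.
Local Open Scope nat_scope.
Variables (F : finFieldType) (n : nat).
Local Notation T := {vspace 'rV[F]_n}.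
Local Notation q := #|F|.
Local Notation vx := (vertex F n).

Lemma dimsU1 X (s : {set vx}) i : (i \in dims (X |: s)) = (vdim X == i) || (i \in dims s).
Proof.
rewrite !inE; apply/exists_inP/orP => [[Y]|[dX|/exists_inP[Y Ys dY]]].
- by rewrite !inE => /orP[/eqP->|Ys] dY; [left|right; apply/exists_inP; exists Y].
- by exists X; rewrite ?inE ?eqxx.
- by exists Y; rewrite // !inE Ys orbT.
Qed.

(** The missing dimensions can be inserted in increasing order, and by
    [flag_extensions] the number of choices at each step depends on the dimensions
    alone. *)
Lemma weight_dims (s s' : {set vx}) :
  is_flag s -> is_flag s' -> dims s = dims s' -> weight s = weight s'.
Proof.
have [m] := ubnP (n - #|dims s|); elim: m s s' => // m IH s s' lem fs fs' e.
have [/forallP full|] := boolP [forall i : 'I_n, (0 < i) ==> (i \in dims s)].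
  suff w1 (u : {set vx}) : is_flag u -> dims u = dims s -> weight u = 1 by rewrite !w1.
  move=> fu eu; have cu : is_complete_flag u.
    by rewrite /is_complete_flag fu complete_dims // eu; apply/forallP.
  rewrite /weight -(finset.cards1 u); apply: eq_card => t; rewrite !inE.
  apply/andP/eqP => [[/andP[_ /eqP ct] ut]|->]; last by rewrite cu.
  apply/esym/eqP; rewrite finset.eqEcard ut ct.
  by case/andP: cu => _ /eqP -> /=; rewrite leqnn.
rewrite negb_forall => /existsP[i0]; rewrite negb_imply => P0.
case: (@arg_minnP _ i0 (fun i => (0 < i) && (i \notin dims s)) (@nat_of_ord n) P0).
move=> i /andP[i_gt0 nis] imin.
have low (j : 'I_n) : 0 < j < i -> j \in dims s.
  by move=> /andP[j0 ji]; apply: contraTT ji => nj; rewrite -leqNgt imin // j0.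
(* All ways of inserting the least missing dimension i lead to the same weight, by
   induction. *)
have flat (u : {set vx}) (fu : is_flag u) (eu : dims u = dims s) X0 :
    vdim X0 = i -> is_flag (X0 |: u) ->
    weight u = qnat q (next_dim (dims s) i - i.-1) * weight (X0 |: u).
  move=> dX0 f0; rewrite (weightE _ i_gt0).
  rewrite (bigID (fun X => is_flag (X |: u))) /= [X in _ + X]big1 ?addn0; last first.
    by move=> X /andP[_]; exact: weight_not_flag.
  rewrite -eu -flag_extensions ?eu // -sum_nat_const big_set.
  apply: eq_bigr => X /andP[/eqP dX fX].
  have eX0 : dims (X0 |: u) = dims (X |: u).
    by apply/setP => j; rewrite !dimsU1 dX dX0.
  apply: IH; rewrite ?eX0 //.
  suff : #|dims s| < #|dims (X |: u)| by have := max_card (dims (X |: u)); rewrite card_ord; lia.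
  apply: proper_card; rewrite fintype.properE -eu; apply/andP; split.
    by apply/subsetP => j; rewrite dimsU1 => ->; rewrite orbT.
  by apply: contra nis => /subsetP /(_ i); rewrite dimsU1 dX eqxx eu; apply.
have ext (u : {set vx}) : is_flag u -> dims u = dims s ->
    exists2 X, vdim X = i & is_flag (X |: u).
  move=> fu eu; have := @flag_extensions _ _ u i fu; rewrite eu => /(_ nis i_gt0 low) card.
  have : 0 < #|[set X : vx | (vdim X == i) && is_flag (X |: u)]|.
    rewrite card qnat_gt0 // subn_gt0 /next_dim.
    have : \max_(j in dims s | i < j) (n - j) <= n - i.
      by apply/bigmax_leqP => j /andP[_ ij]; lia.
    by have := ltn_ord i; lia.
  by case/card_gt0P => X; rewrite inE => /andP[/eqP dX fX]; exists X.
have [X dX fX] := ext s fs erefl.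
have [X' dX' fX'] := ext s' fs' (esym e).
rewrite (flat s fs erefl X) // (flat s' fs' (esym e) X') //; congr (_ * _).
have eX : dims (X |: s) = dims (X' |: s').
  by apply/setP => j; rewrite !dimsU1 dX dX' e.
apply: IH => //.
suff : #|dims s| < #|dims (X |: s)| by have := max_card (dims (X |: s)); rewrite card_ord; lia.
apply: proper_card; rewrite fintype.properE; apply/andP; split.
  by apply/subsetP => j; rewrite dimsU1 => ->; rewrite orbT.
by apply: contra nis => /subsetP /(_ i); rewrite dimsU1 dX eqxx; apply.
Qed.

Lemma flag1 (U : vx) : is_flag [set U].
Proof. by apply/flagP => X Y; rewrite !inE => /eqP-> /eqP->; exact: compat_refl. Qed.

Lemma flag2 (U V : vx) : is_flag [set U; V] = compat U V.
Proof.
rewrite flagU1 flag1; apply/forall_inP/idP => [h|c Y]; first by apply: h; rewrite inE.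
by rewrite inE => /eqP ->.
Qed.

Lemma weight1E (U V : vx) : compat U V ->
  weight [set U] = #|[set W | (vdim W == vdim V) && compat U W]| * weight [set U; V].
Proof.
move=> cUV; have /andP[d0 dn] := vdim_bounds V.
rewrite (@weightE _ _ _ (Ordinal dn)) //= -sum_nat_const big_set.
rewrite (bigID (fun W => compat U W)) /= [X in _ + X]big1 ?addn0; last first.
  by move=> W /andP[_ nc]; rewrite weight_not_flag // finset.setUC flag2.
apply: eq_bigr => W /andP[/eqP dW cUW]; rewrite finset.setUC; apply: weight_dims; rewrite ?flag2 //.
apply/setP => j; rewrite !(dimsU1 U); congr (_ || _).
rewrite !inE; apply/exists_inP/exists_inP => -[X]; rewrite inE => /eqP-> /eqP <-.
  by exists V; rewrite ?inE // dW.
by exists W; rewrite ?inE // dW.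
Qed.

(** By [weightE] each of the [n - 2] dimensions other than that of U contributes
    the weight of U. *)
Lemma sum_weight2 (U : vx) :
  \sum_(V | V != U) weight [set U; V] = (n - 2) * weight [set U].
Proof.
have h (V : vx) : vdim V < n by case/andP: (vdim_bounds V).
rewrite (bigID (fun V => vdim V != vdim U)) /= [X in _ + X]big1 ?addn0; last first.
  move=> V /andP[nVU /negPn /eqP dV]; apply: weight_not_flag; rewrite flag2.
  apply: contra nVU => c; apply/eqP/esym; exact: compat_dim_eq.
pose P (i : 'I_n) := (0 < i) && (i != vdim U :> nat).
rewrite (partition_big (fun V => Ordinal (h V)) P) /=; last first.
  by move=> V /andP[_ dV]; rewrite /P /= dV; case/andP: (vdim_bounds V) => ->.
rewrite (eq_bigr (fun=> weight [set U])); last first.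
  move=> i /andP[i0 iU]; rewrite (weightE [set U] i0); apply: eq_big => V.
    rewrite (_ : (Ordinal (h V) == i) = (vdim V == i)) //.
    apply/idP/idP => [/andP[_ ]//|/eqP dV].
    by rewrite dV iU eqxx !andbT; apply: contraNneq iU => <-; rewrite dV.
  by rewrite finset.setUC.
rewrite sum_nat_const; congr (_ * _).
have /andP[U0 Un] := vdim_bounds U.
have n0 : 0 < n by lia.
rewrite (_ : #|_| = #|~: [set Ordinal n0; Ordinal Un]|); last first.
  by apply: eq_card => i; rewrite !inE -!val_eqE negb_or /= -topredE /= /P lt0n.
by rewrite finset.cardsCs finset.setCK finset.cards2 card_ord -val_eqE /= eq_sym -lt0n U0.
Qed.

End Weights.

(** * The Laplacian as an averaging operator *)

Section Laplacian.
Local Open Scope nat_scope.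
Variables (F : finFieldType) (n : nat) (R : realType).
Local Notation T := {vspace 'rV[F]_n}.
Local Notation q := #|F|.
Local Notation vx := (vertex F n).
Local Open Scope ring_scope.

(** The adjoint is evaluated by testing against the indicator function of U, whose
    coboundary is supported on the edges at U. *)
Lemma upper_laplacian_sum (phi : C0 F n R) U :
  upper_laplacian F n R phi U =
  (weight [set U])%:R^-1 *
    \sum_(V : vx | V != U) (weight [set U; V])%:R * (phi U - phi V).
Proof.
rewrite upper_laplacianE d0_adjE; congr (_ * _).
rewrite /ip1.
pose G (A B : vx) : R := (weight [set A; B])%:R * ((B == U)%:R - (A == U)%:R) * (phi B - phi A).
rewrite (eq_bigr (fun e => G (src e) (tgt e))); last first.
  by move=> e _; rewrite !d0E !ffunE.
have -> : \sum_(e : oedge F n | subvertex (src e) (tgt e)) G (src e) (tgt e)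
        = \sum_(p : vx * vx | is_oedge p && subvertex p.1 p.2) G p.1 p.2.
  rewrite [RHS](reindex_omap (fun e : oedge F n => val e) insub) /=; last first.
    by move=> p /andP[pe _]; rewrite insubT.
  by apply: eq_bigl => e; rewrite valK eqxx andbT (valP e).
rewrite [LHS](eq_bigl (fun p : vx * vx => xpredT p.1 && ((p.1 != p.2) && subvertex p.1 p.2))); last first.
  by move=> [A B]; rewrite /is_oedge /= flag2 /compat; case: (subvertex A B); rewrite ?andbF ?andbT.
rewrite -(pair_big_dep xpredT (fun A B => (A != B) && subvertex A B) G) /=.
rewrite (bigID (fun A => A == U)) /= big_pred1_eq addrC.
under eq_bigr => A nAU.
  rewrite (bigID (fun B => B == U)) /= [X in _ + X]big1 ?addr0; last first.
    by move=> B /andP[_ /negPf nBU]; rewrite /G nBU (negPf nAU) subrr mulr0 mul0r.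
  over.
rewrite (eq_bigr (fun A => if subvertex A U then G A U else 0)); last first.
  move=> A nAU; case: ifP => sAU.
    rewrite (big_pred1 U) // => B /=; case: (eqVneq B U) => [->|]; rewrite ?andbF ?andbT //.
    by rewrite nAU sAU.
  by rewrite big1 // => B /andP[/andP[_ +] /eqP e]; rewrite e sAU.
rewrite [X in _ + X]big_mkcondr /=.
rewrite [X in _ + X](eq_bigl (fun B => B != U)); last by move=> B; rewrite eq_sym.
rewrite -big_split; apply: eq_bigr => V nVU /=.
rewrite /G eqxx (negPf nVU) subr0 sub0r finset.setUC.
have [sVU|nsVU] := boolP (subvertex V U); have [sUV|nsUV] := boolP (subvertex U V).
- case/negP: nVU; apply/eqP/val_inj/eqP; rewrite eqEsubv; exact/andP.
- by rewrite addr0 mulr1.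
- by rewrite add0r mulrN1 mulNr -mulrN opprB.
- by rewrite addr0 weight_not_flag ?mul0r // flag2 /compat negb_or nsUV.
Qed.

(** Extension by zero to all subspaces, where [up] and [dn] are defined. *)
Definition ext (phi : C0 F n R) : {ffun T -> R^o} :=
  [ffun X => if insub X is Some U then phi (U : vx) else 0].

Lemma extE (phi : C0 F n R) (U : vx) : ext phi (val U) = phi U.
Proof. by rewrite ffunE valK. Qed.

Lemma ext0 (phi : C0 F n R) (X : T) : (\dim X == 0)%N || (\dim X == n)%N -> ext phi X = 0.
Proof.
move=> h; rewrite ffunE insubN // negb_and !negbK.
by case/orP: h => [|/eqP dX]; [rewrite dimv_eq0 => -> | rewrite orbC eqEdim subvf dimVn dX leqnn].
Qed.

Lemma sum_ext (phi : C0 F n R) (P : pred T) e : (0 < e < n)%N ->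
  \sum_(V : vx | P (val V) && (vdim V == e)) phi V = \sum_(X : T | P X && (\dim X == e)%N) ext phi X.
Proof.
move=> /andP[e0 en].
rewrite [RHS](reindex_omap (fun V : vx => val V) insub) /=.
  by apply: eq_big => V; rewrite ?extE // valK eqxx andbT.
move=> X /andP[_ /eqP dX]; rewrite insubT //.
rewrite -dimv_eq0 dX -lt0n e0; apply: contraTneq en => fX.
by rewrite -dX fX dimVn ltnn.
Qed.

Lemma mul_cancel (a b c : R) : a != 0 -> a * b * (a^-1 * c) = c * b.
Proof. by move=> a0; field. Qed.

(** All flags made of U and one more space of a given dimension have the same
    weight, so this quotient is the inverse of their number. *)
Lemma weight_ratio (U V : vx) : compat U V ->
  (weight [set U])%:R^-1 * (weight [set U; V])%:R =
  (#|[set W : vx | (vdim W == vdim V) && compat U W]|%:R)^-1 :> R.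
Proof.
move=> c; rewrite (weight1E c) natrM invfM mulfVK // pnatr_eq0 -lt0n.
by have := weight_vertex_gt0 U; rewrite (weight1E c) muln_gt0 => /andP[].
Qed.

Lemma weighted_mean (phi : C0 F n R) (U : vx) e (P : pred T) : (0 < e < n)%N ->
  (forall V : vx, vdim V = e -> compat U V = P (val V)) ->
  (weight [set U])%:R^-1 * (\sum_(V : vx | vdim V == e) (weight [set U; V])%:R * phi V) =
  #|[set X : T | P X && (\dim X == e)]|%:R^-1 * \sum_(X : T | P X && (\dim X == e)) ext phi X.
Proof.
move=> en cE; rewrite -(sum_ext phi P en).
have -> : #|[set X : T | P X && (\dim X == e)]| = #|[set W : vx | (vdim W == e) && compat U W]|.
  rewrite -(card_imset [set W : vx | _] val_inj); apply: eq_card => X; rewrite inE.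
  apply/andP/imsetP => [[PX /eqP dX]|[W]].
    have [W XW] : exists W : vx, X = val W by apply: proper_vertex; rewrite dX.
    have dW : vdim W = e by rewrite /vdim -XW.
    by exists W => //; rewrite inE dW eqxx cE // -XW.
  by rewrite inE => /andP[/eqP dW] + ->; rewrite cE // -/(vdim W) dW eqxx.
rewrite !big_distrr /= [RHS]big_mkcondl; apply: eq_bigr => V /eqP dV.
rewrite -cE //; case: ifPn => [c|nc]; first by rewrite mulrA weight_ratio // dV.
by rewrite (@weight_not_flag _ _ [set U; V]) ?flag2 // mul0r mulr0.
Qed.

(** The plain mean over the e-dimensional subspaces of U is the sum over all of
    them, which [iter_upE] expresses through [up], divided by their number, which
    is given by [card_subspaces]. *)
Lemma avg_low (phi : C0 F n R) (U : vx) e : (e < vdim U)%N ->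
  (weight [set U])%:R^-1 * (\sum_(V : vx | vdim V == e) (weight [set U; V])%:R * phi V) =
  iter (vdim U - e) (@up F n R) (ext phi) (val U) / (qffact q (vdim U) (vdim U - e))%:R.
Proof.
move=> ltd; rewrite iter_upE -/(vdim U).
have [->|e0] := posnP e.
  rewrite subn0 big1 => [|V /eqP dV]; last by have := vdim_bounds V; rewrite dV.
  rewrite big1 ?(mulr0, mul0r) // => W /andP[_ /eqP dW].
  by apply: ext0; apply/orP; left; apply/eqP; lia.
have en : (e < n)%N by have := vdim_bounds U; lia.
rewrite (@weighted_mean _ _ _ (fun X => X <= val U)%VS) ?e0 // => [|V dV]; last first.
  apply/idP/idP => [c|]; last by rewrite /compat /subvertex orbC => ->.
  rewrite compat_sym in c; have le : (vdim V <= vdim U)%N by rewrite dV ltnW.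
  exact: (subvertexE c le).
have eP (X : T) : (X <= val U)%VS && (\dim X + (vdim U - e) == vdim U)%N =
    (X <= val U)%VS && (\dim X == e).
  by congr (_ && _); apply/eqP/eqP; lia.
rewrite (eq_bigl _ _ eP) -(@card_subspaces F n R _ (val U)) natrM invfM.
rewrite mul_cancel ?pnatr_eq0 -?lt0n ?qfact_gt0 //; congr ((_%:R)^-1 * _).
by apply: eq_card => X; rewrite !inE; exact/esym/eP.
Qed.

Lemma avg_high (phi : C0 F n R) (U : vx) e : (vdim U < e <= n)%N ->
  (weight [set U])%:R^-1 * (\sum_(V : vx | vdim V == e) (weight [set U; V])%:R * phi V) =
  iter (e - vdim U) (@dn F n R) (ext phi) (val U) / (qffact q (n - vdim U) (e - vdim U))%:R.
Proof.
move=> /andP[ltd]; rewrite iter_dnE -/(vdim U) leq_eqVlt => /orP[/eqP en|en].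
  rewrite big1 => [|V /eqP dV]; last by have := vdim_bounds V; lia.
  rewrite big1 ?(mulr0, mul0r) // => W /andP[_ /eqP dW].
  by apply: ext0; apply/orP; right; apply/eqP; lia.
have e0 : (0 < e)%N by lia.
rewrite (@weighted_mean _ _ _ (fun X => val U <= X)%VS) ?e0 // => [|V dV]; last first.
  apply/idP/idP => [c|]; last by rewrite /compat /subvertex => ->.
  have le : (vdim U <= vdim V)%N by rewrite dV ltnW.
  exact: (subvertexE c le).
have eP (X : T) : (val U <= X)%VS && (vdim U + (e - vdim U) == \dim X)%N =
    (val U <= X)%VS && (\dim X == e).
  by congr (_ && _); apply/eqP/eqP; lia.
rewrite (eq_bigl _ _ eP) -(@card_superspaces F n R _ (val U)) natrM invfM.
rewrite mul_cancel ?pnatr_eq0 -?lt0n ?qfact_gt0 //; congr ((_%:R)^-1 * _).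
by apply: eq_card => X; rewrite !inE; exact/esym/eP.
Qed.

Lemma sum_by_dim (G : vx -> R) a b :
  \sum_(V : vx | (a <= vdim V < b)%N) G V = \sum_(a <= e < b) \sum_(V : vx | vdim V == e) G V.
Proof.
rewrite (exchange_big_dep xpredT) //= [LHS]big_mkcond /=; apply: eq_bigr => V _.
rewrite -[in LHS](mem_index_iota a b); case: ifP => [h|/negbT h].
  rewrite big_mkcond (bigD1_seq (vdim V)) ?iota_uniq //= eqxx.
  by rewrite big1 ?addr0 // => e /negPf; rewrite eq_sym => ->.
rewrite big_seq_cond big1 // => e /andP[he /eqP eV].
by rewrite eV he in h.
Qed.

(** The Laplacian is [n - 2] minus the operator that adds up, over all other
    dimensions e, the means of phi over the e-dimensional spaces comparable with U.
    Diagonalizing the latter is the subject of what follows. *)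
Lemma upper_laplacian_avg (phi : C0 F n R) (U : vx) :
  upper_laplacian F n R phi U = (n - 2)%:R * phi U -
   (\sum_(0 <= e < vdim U) iter (vdim U - e) (@up F n R) (ext phi) (val U) / (qffact q (vdim U) (vdim U - e))%:R
    + \sum_((vdim U).+1 <= e < n.+1) iter (e - vdim U) (@dn F n R) (ext phi) (val U) / (qffact q (n - vdim U) (e - vdim U))%:R).
Proof.
have w0 (X : vx) : (weight [set X])%:R != 0 :> R.
  by rewrite pnatr_eq0 -lt0n weight_vertex_gt0.
rewrite upper_laplacian_sum.
under eq_bigr do rewrite mulrBr.
rewrite sumrB -mulr_suml -natr_sum sum_weight2 mulrBr natrM [_ * (_ * phi U)]mulrA.
rewrite [_^-1 * (_ * _)]mulrCA mulVf // mulr1; congr (_ - _).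
pose G (V : vx) := (weight [set U; V])%:R * phi V.
have -> : \sum_(V : vx | V != U) G V = \sum_(V | (vdim V < vdim U)%N) G V + \sum_(V | (vdim U < vdim V)%N) G V.
  rewrite (bigID (fun V => (vdim V < vdim U)%N)) /=; congr (_ + _).
    by apply: eq_bigl => V; rewrite andbC andb_idr // => lt; apply: contraTneq lt => ->; rewrite ltnn.
  rewrite (bigID (fun V => (vdim U < vdim V)%N)) /= [X in _ + X]big1 ?addr0.
    apply: eq_bigl => V; case: ltngtP => //; rewrite ?andbF ?andbT //= => lt.
    by apply/eqP => e; rewrite e ltnn in lt.
  move=> V /andP[/andP[nVU l1] l2]; rewrite /G weight_not_flag ?mul0r // flag2.
  by apply: contra nVU => c; apply/eqP/esym/compat_dim_eq => //; lia.
rewrite mulrDr; congr (_ + _).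
  rewrite (eq_bigl (fun V : vx => (0 <= vdim V < vdim U)%N)) // sum_by_dim big_distrr /=.
  by apply: eq_big_nat => e /andP[_ lte]; apply: avg_low.
rewrite (eq_bigl (fun V : vx => ((vdim U).+1 <= vdim V < n.+1)%N)); last first.
  by move=> V; have := vdim_bounds V; lia.
rewrite sum_by_dim big_distrr /=.
by apply: eq_big_nat => e /andP[lte len]; apply: avg_high; rewrite lte -ltnS.
Qed.

End Laplacian.

(** * Primitive functions and the layers that they generate *)

Section Supported.
Variables (I : finType) (R : numFieldType) (P : pred I).
Local Notation FI := {ffun I -> R^o}.

Definition extend0 (f : {ffun {x : I | P x} -> R^o}) : FI :=
  [ffun x => if insub x is Some y then f y else 0].
Lemma extend0_linear : linear extend0.
Proof.
move=> a f g; apply/ffunP => x; rewrite !ffunE.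
by case: insub => [y|]; rewrite ?ffunE // scaler0 addr0.
Qed.
HB.instance Definition _ := GRing.isLinear.Build R _ FI _ extend0 extend0_linear.

Definition supported : {vspace FI} := limg (linfun extend0).

Lemma memv_supported (f : FI) :
  reflect (forall x, ~~ P x -> f x = 0) (f \in supported).
Proof.
apply: (iffP memv_imgP) => [[g _ ->] x nP|h]; first by rewrite lfunE ffunE insubN.
exists [ffun y : {x | P x} => f (val y)]; first exact: memvf.
rewrite lfunE; apply/ffunP => x; rewrite !ffunE.
by case: insubP => [y Px <-|/h //]; rewrite ffunE.
Qed.

Lemma dim_supported : \dim supported = #|[set x | P x]|.
Proof.
rewrite limg_dim_eq ?dimvf /dim /=; first by rewrite muln1 card_sig cardsE.
apply/eqP; rewrite -subv0; apply/subvP => f /memv_capP[_].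
rewrite memv_ker lfunE memv0 => /eqP/ffunP e; apply/eqP/ffunP => y.
by have := e (val y); rewrite !ffunE valK.
Qed.
End Supported.

Section Decomposition.
Variables (F : finFieldType) (n : nat) (R : numFieldType).
Local Notation T := {vspace 'rV[F]_n}.
Local Notation q := #|F|.
Local Notation FV := {ffun T -> R^o}.
Local Notation up := (@up F n R).
Local Notation dn := (@dn F n R).

(** The iterates of [up] as bundled linear maps, so as to have images and kernels. *)
Fixpoint upn (g : nat) : 'End(FV) :=
  if g is g'.+1 then (linfun up \o upn g')%VF else \1%VF.
Lemma upnE g f : upn g f = iter g up f.
Proof. by elim: g => [|g IH] /=; rewrite ?id_lfunE // comp_lfunE lfunE /= IH. Qed.

Fixpoint dnn (g : nat) : 'End(FV) :=
  if g is g'.+1 then (linfun dn \o dnn g')%VF else \1%VF.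
Lemma dnnE g f : dnn g f = iter g dn f.
Proof. by elim: g => [|g IH] /=; rewrite ?id_lfunE // comp_lfunE lfunE /= IH. Qed.

Definition graded (d : nat) : {vspace FV} :=
  supported R (fun X : T => \dim X == d).

Lemma gradedP d (f : FV) : reflect (forall X : T, \dim X != d -> f X = 0) (f \in graded d).
Proof. exact: memv_supported. Qed.

Lemma dim_graded d : \dim (graded d) = qbinom F n d.
Proof. exact: dim_supported. Qed.

Lemma up_graded d (f : FV) : f \in graded d -> up f \in graded d.+1.
Proof.
move=> /gradedP h; apply/gradedP => U dU; rewrite ffunE big1 // => W /andP[_ /eqP dW].
by apply: h; move: dU; rewrite dW eqSS.
Qed.

Lemma dn_graded d (f : FV) : f \in graded d.+1 -> dn f \in graded d.
Proof.
move=> /gradedP h; apply/gradedP => W dW; rewrite ffunE big1 // => U /andP[_ /eqP dU].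
by apply: h; rewrite dU eqSS.
Qed.

Lemma dn_graded0 f : f \in graded 0 -> dn f = 0.
Proof.
move=> /gradedP h; apply/ffunP => W; rewrite !ffunE big1 // => U /andP[_ /eqP dU].
by apply: h; rewrite dU.
Qed.

Lemma iter_up_graded g d f : f \in graded d -> iter g up f \in graded (d + g).
Proof. by move=> h; elim: g => [|g IH]; rewrite ?addn0 // addnS; apply: up_graded. Qed.

(** The analogue of lowest weight vectors, with [up] and [dn] as raising and
    lowering operators. *)
Definition primitive (k : nat) : {vspace FV} := (graded k :&: lker (linfun dn))%VS.

Lemma primitiveP k f : reflect (f \in graded k /\ dn f = 0) (f \in primitive k).
Proof.
apply: (iffP memv_capP); rewrite memv_ker lfunE.
  by move=> [-> /eqP].
by move=> [-> /= ->].
Qed.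

(** The factor by which [dn] undoes the j-th application of [up] to a primitive
    function of degree k, see [dn_iter_up]. *)
Definition dcoef k j : R := (q ^ k * qnat q j * qnat q (n.+1 - 2 * k - j))%:R.

Let qnatR g : (q%:R - 1) * (qnat q g)%:R = q%:R ^+ g - 1 :> R.
Proof. by apply: qnat_geom; exact/ltnW/q_gt1. Qed.

Lemma q1_neq0 : q%:R - 1 != 0 :> R.
Proof. by rewrite subr_eq0 (eqr_nat R _ 1) gtn_eqF ?q_gt1. Qed.

(** The increments match the diagonal term of [dn_up], so that the factors of
    [dn_iter_up] add up to [dcoef]. *)
Lemma dcoefS k j : (j + 2 * k <= n)%N ->
  dcoef k j.+1 = dcoef k j + ((qnat q (n - (k + j)))%:R - (qnat q (k + j))%:R).
Proof.
move=> le; pose a := (n - 2 * k - j)%N.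
rewrite /dcoef (_ : n.+1 - 2 * k - j.+1 = a)%N; last by lia.
rewrite (_ : n.+1 - 2 * k - j = a.+1)%N; last by lia.
rewrite (_ : n - (k + j) = a + k)%N; last by lia.
have n0 := q1_neq0.
apply: (mulfI (mulf_neq0 n0 n0)).
rewrite !natrM natrX.
transitivity (q%:R ^+ k * ((q%:R - 1) * (qnat q j.+1)%:R) * ((q%:R - 1) * (qnat q a)%:R) : R).
  by ring.
transitivity (q%:R ^+ k * ((q%:R - 1) * (qnat q j)%:R) * ((q%:R - 1) * (qnat q a.+1)%:R)
   + (q%:R - 1) * ((q%:R - 1) * (qnat q (a + k))%:R - (q%:R - 1) * (qnat q (k + j))%:R) : R).
  by rewrite !qnatR !exprS !exprD; ring.
by ring.
Qed.

Lemma dcoef_gt0 k j : (0 < j)%N -> (j + 2 * k <= n)%N -> 0 < dcoef k j.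
Proof.
move=> j0 le; rewrite ltr0n !muln_gt0 expn_gt0 (ltnW (q_gt1 F)) !qnat_gt0 //; lia.
Qed.

Let addE (f g : FV) W : (f + g) W = f W + g W. Proof. by rewrite ffunE. Qed.
Let scaleE a (f : FV) W : (a *: f) W = a * f W. Proof. by rewrite ffunE. Qed.

Lemma dn_up_graded d (g : FV) : g \in graded d ->
  dn (up g) = up (dn g) + ((qnat q (n - d))%:R - (qnat q d)%:R) *: g.
Proof.
move=> /gradedP hg; apply/ffunP => W; rewrite dn_up addE scaleE; congr (_ + _).
by have [->//|/hg->] := eqVneq (\dim W) d; rewrite !mulr0.
Qed.

Lemma dn_iter_up k (f : FV) j : f \in primitive k -> (j + 2 * k <= n)%N ->
  dn (iter j.+1 up f) = dcoef k j.+1 *: iter j up f.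
Proof.
move=> /primitiveP[gf df]; elim: j => [|j IH] le.
  rewrite /= (dn_up_graded gf) df linear0 add0r dcoefS // addn0.
  by rewrite /dcoef qnat0 muln0 mul0n add0r.
rewrite [iter j.+2 _ _]iterS (dn_up_graded (iter_up_graded j.+1 gf)) IH; last by lia.
by rewrite linearZ /= -scalerDl -dcoefS.
Qed.

Lemma iter_dn_up k (f : FV) j g : f \in primitive k -> (j + 2 * k <= n)%N -> (g <= j)%N ->
  iter g dn (iter j up f) = (\prod_(i < g) dcoef k (j - i)) *: iter (j - g) up f.
Proof.
move=> pf; elim: g j => [|g IH] j le; first by rewrite big_ord0 scale1r subn0.
case: j le => // j le lt; rewrite iterSr (dn_iter_up pf) //; last by lia.
have -> (a : R) (h : FV) : iter g dn (a *: h) = a *: iter g dn h by rewrite -!dnnE linearZ.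
rewrite (IH j) //; last by lia.
by rewrite scalerA big_ord_recl subn0 subSS.
Qed.

Lemma iter_dn_up_gt k (f : FV) j g : f \in primitive k -> (j + 2 * k <= n)%N -> (j < g)%N ->
  iter g dn (iter j up f) = 0.
Proof.
move=> pf le lt; rewrite -(subnK lt) iterD iterS (iter_dn_up pf) // subnn /=.
have [_ d0] := primitiveP _ _ pf.
by rewrite linearZ /= d0 scaler0 -dnnE linear0.
Qed.

Lemma prod_dcoef_neq0 k j g : (j + 2 * k <= n)%N -> (g <= j)%N ->
  \prod_(i < g) dcoef k (j - i) != 0.
Proof.
move=> le legj; apply/prodf_neq0 => i _; rewrite gt_eqF // dcoef_gt0 //.
  by have := ltn_ord i; lia.
by lia.
Qed.

(** The least unknown degree j is isolated by applying [dn] exactly d - j times: the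
    larger degrees are annihilated, the smaller ones vanish by induction, and the
    component of degree j is recovered up to a nonzero factor. *)
Lemma independence d (f : nat -> FV) : (d <= n)%N ->
  (forall k, (k <= minn d (n - d))%N -> f k \in primitive k) ->
  \sum_(0 <= k < (minn d (n - d)).+1) iter (d - k) up (f k) = 0 ->
  forall k, (k <= minn d (n - d))%N -> f k = 0.
Proof.
move=> ledn fP s0; elim/ltn_ind => j IH lej.
have := congr1 (dnn (d - j)) s0; rewrite linear_sum linear0 /=.
rewrite (bigD1_seq j) ?iota_uniq ?mem_index_iota //= dnnE (iter_dn_up (fP j lej)) ?subnn //; try lia.
rewrite [X in _ + X]big1_seq ?addr0 => [/eqP|k /andP[nkj]].
  by rewrite scaler_eq0 (negPf (prod_dcoef_neq0 _ _)) /=; try lia; move/eqP.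
rewrite mem_index_iota ltnS => /andP[_ lek].
have [ltkj|ltjk|e] := ltngtP k j; last by rewrite e eqxx in nkj.
  by rewrite IH // !(upnE, dnnE) -upnE linear0 -dnnE linear0.
by rewrite dnnE (iter_dn_up_gt (fP k _)) //; lia.
Qed.

Definition layer d k : {vspace FV} := (upn (d - k) @: primitive k)%VS.

Lemma dim_layer d k : (d <= n)%N -> (k <= minn d (n - d))%N ->
  \dim (layer d k) = \dim (primitive k).
Proof.
move=> ledn lek; apply: limg_dim_eq; apply/eqP; rewrite -subv0; apply/subvP => f.
move=> /memv_capP[pf]; rewrite memv_ker upnE memv0 => /eqP e; apply/eqP.
have := congr1 (dnn (d - k)) e; rewrite linear0 dnnE (iter_dn_up pf) // ?subnn /=; try lia.
by move/eqP; rewrite scaler_eq0 (negPf (prod_dcoef_neq0 _ _)) //=; try lia; move/eqP.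
Qed.

Lemma layer_graded d k : (k <= d)%N -> (layer d k <= graded d)%VS.
Proof.
move=> le; apply/subvP => _ /memv_imgP[f /primitiveP[gf _] ->].
by rewrite upnE -[X in graded X](subnKC le) iter_up_graded.
Qed.

Lemma sum_layers_dim d : (d <= n)%N ->
  \dim (\sum_(k < (minn d (n - d)).+1) layer d k) =
  (\sum_(k < (minn d (n - d)).+1) \dim (primitive k))%N.
Proof.
move=> ledn.
have dir : directv (\sum_(k < (minn d (n - d)).+1) layer d k).
  apply/directv_sum_independent => us usP us0 i _.
  pose m := minn d (n - d).
  have /fin_all_exists[f fP] (k : 'I_m.+1) : exists f : FV,
      f \in primitive k /\ us k = iter (d - k) up f.
    by have /memv_imgP[f pf ->] := usP k isT; exists f; rewrite upnE.
  pose f' k := f (inord k).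
  have E k : (k <= m)%N -> f' k \in primitive k /\ us (inord k) = iter (d - k) up (f' k).
    by move=> le; have [] := fP (inord k); rewrite inordK.
  have z : \sum_(0 <= k < m.+1) iter (d - k) up (f' k) = 0.
    rewrite big_mkord -[RHS]us0; apply: eq_bigr => k _.
    by have [_ <-] := E k (ltn_ord k); rewrite inord_val.
  have lei : (i <= m)%N := ltn_ord i.
  have f0 := independence ledn (fun k le => proj1 (E k le)) z lei.
  by rewrite -[i in us i]inord_val (proj2 (E i lei)) f0 -upnE linear0.
rewrite (directvP dir) /=; apply: eq_bigr => k _.
by rewrite dim_layer // -ltnS.
Qed.

Lemma sum_layers_graded d : (d <= n)%N ->
  (\sum_(k < (minn d (n - d)).+1) layer d k <= graded d)%VS.
Proof.
move=> ledn; apply/subv_sumP => k _; apply: layer_graded.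
by have := ltn_ord k; lia.
Qed.

(** Rank-nullity for [dn]. *)
Lemma dim_primitive_ge k : (qbinom F n k.+1 <= \dim (primitive k.+1) + qbinom F n k)%N.
Proof.
rewrite -!dim_graded -(limg_ker_dim (linfun dn) (graded k.+1)) leq_add2l.
apply: dimvS; apply/subvP => _ /memv_imgP[f gf ->]; rewrite lfunE /=.
exact: dn_graded.
Qed.

Lemma dim_primitive0 : \dim (primitive 0) = qbinom F n 0.
Proof.
rewrite -dim_graded; congr (\dim _); apply/eqP; rewrite eqEsubv capvSl.
apply/subvP => f gf; apply/primitiveP; split=> //; exact: dn_graded0.
Qed.

(** The layers are independent inside the functions on j-spaces, which bounds the
    sum from above; [dim_primitive_ge] bounds it from below. *)
Lemma sum_dim_primitive j : (2 * j <= n)%N ->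
  (\sum_(k < j.+1) \dim (primitive k) = qbinom F n j)%N.
Proof.
move=> le; apply/eqP; rewrite eqn_leq; apply/andP; split.
  have m : minn j (n - j) = j by lia.
  have lejn : (j <= n)%N by lia.
  have := sum_layers_dim lejn; rewrite m => <-.
  by have := sum_layers_graded lejn; rewrite m => /dimvS; rewrite dim_graded.
elim: j {le} => [|j IH]; first by rewrite big_ord_recr big_ord0 /= dim_primitive0.
rewrite big_ord_recr /= (leq_trans (dim_primitive_ge j)) // addnC leq_add2r //.
Qed.

Lemma dim_primitive k : (0 < k)%N -> (2 * k <= n)%N ->
  \dim (primitive k) = (qbinom F n k - qbinom F n k.-1)%N.
Proof.
case: k => // k _ le; rewrite /= -!sum_dim_primitive //; last by lia.
by rewrite [in RHS]big_ord_recr /= addKn.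
Qed.

Lemma sum_layers d : (d <= n)%N ->
  (\sum_(k < (minn d (n - d)).+1) layer d k = graded d)%VS.
Proof.
move=> ledn; apply/eqP; rewrite eqEdim sum_layers_graded // sum_layers_dim //.
rewrite sum_dim_primitive; last by lia.
rewrite dim_graded; have [le|lt] := leqP d (n - d); first by rewrite leqnn.
by rewrite qbinom_sym ?leqnn.
Qed.

End Decomposition.

(** * Averaging in primitive coordinates *)

Section Action.
Variables (F : finFieldType) (n : nat) (R : realType).
Local Notation T := {vspace 'rV[F]_n}.
Local Notation q := #|F|.
Local Notation FV := {ffun T -> R^o}.
Local Notation up := (@up F n R).
Local Notation dn := (@dn F n R).
Local Notation prim := (@primitive F n R).
Local Notation gr := (@graded F n R).

Lemma up_dn_adjoint (f g : FV) : \sum_U up f U * g U = \sum_W f W * dn g W.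
Proof.
under eq_bigr do rewrite ffunE mulr_suml.
under [RHS]eq_bigr do rewrite ffunE mulr_sumr.
by rewrite (exchange_big_dep predT).
Qed.

Lemma sum_sq_eq0 (f : FV) : \sum_U f U * f U <= 0 -> f = 0.
Proof.
move=> h; apply/ffunP => U; rewrite ffunE.
have e : \sum_U f U * f U == 0.
  by rewrite eq_le h sumr_ge0 // => V _; rewrite -expr2 sqr_ge0.
move: e; rewrite psumr_eq0 => [/allP/(_ U)|V _]; last by rewrite -expr2 sqr_ge0.
by rewrite mem_index_enum => /(_ isT); rewrite mulf_eq0 orbb => /eqP.
Qed.

(** Above the middle dimension, a function killed by [dn] satisfies
    |up f|^2 = ([n - d] - [d]) |f|^2 with a negative factor. *)
Lemma dn_injective d (f : FV) : (d <= n)%N -> (n < 2 * d)%N -> f \in gr d -> dn f = 0 -> f = 0.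
Proof.
move=> dn_ d2 gf df; have := dn_up_graded gf; rewrite df linear0 add0r => e.
have h : \sum_U up f U * up f U = ((qnat q (n - d))%:R - (qnat q d)%:R) * \sum_U f U * f U.
  rewrite up_dn_adjoint e mulr_sumr; apply: eq_bigr => U _; rewrite ffunE.
  by rewrite mulrCA.
have neg : ((qnat q (n - d))%:R - (qnat q d)%:R : R) < 0.
  by rewrite subr_lt0 ltr_nat qnat_lt ?(ltnW (q_gt1 F)) //; lia.
apply: sum_sq_eq0; rewrite -(nmulr_rge0 _ neg) -h sumr_ge0 // => V _.
by rewrite -expr2 sqr_ge0.
Qed.

(** A primitive function of degree k does not climb above dimension n - k: at the
    first step beyond, [dn] kills it since [dcoef] vanishes, and there [dn] is
    injective. *)
Lemma iter_up_vanish k d (f : FV) : (2 * k <= n)%N -> f \in prim k -> (n - k < d)%N ->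
  iter (d - k) up f = 0.
Proof.
move=> kn pf lt; have -> : (d - k = (d - (n - k).+1) + (n - 2 * k).+1)%N by lia.
rewrite iterD; suff -> : iter (n - 2 * k).+1 up f = 0 by rewrite -upnE linear0.
have /primitiveP[gf _] := pf.
have [k0|k0] := posnP k.
  subst k; rewrite muln0 subn0 in lt *; apply/ffunP => U; rewrite [RHS]ffunE.
  have := iter_up_graded n.+1 gf => /gradedP; apply.
  by have := dim_leqn U; rewrite add0n; lia.
have gk := iter_up_graded (n - 2 * k).+1 gf.
apply: (@dn_injective (n - k).+1); try lia.
  by rewrite (_ : (n - k).+1 = k + (n - 2 * k).+1)%N //; lia.
rewrite (dn_iter_up pf); last by lia.
by rewrite /dcoef (_ : n.+1 - 2 * k - (n - 2 * k).+1 = 0)%N ?qnat0 ?muln0 ?scale0r //; lia.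
Qed.

(** The factor by which taking means from dimension d + 1 down to d acts on the
    layer of degree k, once layers are normalized by [qfact] as in [layer_sum]. *)
Definition step (k d : nat) : R :=
  (q ^ k * qnat q (d.+1 - k) * qnat q (n - k - d))%N%:R / (qnat q d.+1 * qnat q (n - d))%N%:R.

Let qf e : (qfact q e)%:R != 0 :> R.
Proof. by rewrite pnatr_eq0 -lt0n qfact_gt0. Qed.

Lemma prod_step k d e : (2 * k <= n)%N -> (k <= d)%N -> (d <= e)%N -> (e <= n - k)%N -> (d < n)%N ->
  (e < n)%N ->
  (\prod_(i < e - d) dcoef F n R k (e - k - i)) / (qffact q (n - d) (e - d))%:R =
  (qfact q e)%:R / (qfact q d)%:R * \prod_(d <= l < e) step k l.
Proof.
move=> kn kd de ek dn_ en; rewrite -(subnKC de) in ek en *.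
move: (e - d)%N ek en => j {de}; rewrite addKn; elim: j => [|j IH] ek en.
  by rewrite big_ord0 addn0 big_geq // qffact0 mulr1 !divff ?qf // oner_neq0.
have ek' : (d + j <= n - k)%N by lia.
have en' : (d + j < n)%N by lia.
have IH' := IH ek' en'.
rewrite addnS big_nat_recr ?leq_addr //= mulrA.
rewrite big_ord_recl subn0 /=.
rewrite (eq_bigr (fun i : 'I_j => dcoef F n R k (d + j - k - i))); last first.
  by move=> i _; congr (dcoef _ _ _ _ _); rewrite /bump /=; lia.
have -> : qffact q (n - d) j.+1 = (qffact q (n - d) j * qnat q (n - (d + j)))%N.
  by rewrite /qffact big_ord_recr /= subnDA.
rewrite natrM invfM [dcoef _ _ _ _ _ * \prod_(_ < _) _]mulrC mulrACA IH'.
rewrite qfactS natrM /step /dcoef.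
have -> : (n.+1 - 2 * k - ((d + j).+1 - k) = n - k - (d + j))%N by lia.
have n1 : (qnat q (d + j).+1)%:R != 0 :> R by rewrite pnatr_eq0 -lt0n qnat_gt0.
have n2 : (qnat q (n - (d + j)))%:R != 0 :> R by rewrite pnatr_eq0 -lt0n qnat_gt0 // subn_gt0.
by rewrite !natrM; field; rewrite n1 n2 qf.
Qed.

(** The averaging operator of [upper_laplacian_avg]. *)
Definition avg (f : FV) (U : T) : R :=
  \sum_(0 <= e < \dim U) iter (\dim U - e) up f U / (qffact q (\dim U) (\dim U - e))%:R +
  \sum_((\dim U).+1 <= e < n.+1)
     iter (e - \dim U) dn f U / (qffact q (n - \dim U) (e - \dim U))%:R.

Local Notation K := n./2.+1.

Definition in_range k e := [&& (0 < e)%N, (e < n)%N & (k <= e <= n - k)%N].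

(** Primitive coordinates of a function that vanishes on the zero and on the full
    space: [g k e] is the component of degree k in dimension e, and it is required
    to be 0 when there is no such layer. *)
Definition adapted (g : nat -> nat -> FV) : Prop :=
  (forall k e, g k e \in prim k) /\ (forall k e, ~~ in_range k e -> g k e = 0).

(** The normalization by [qfact] makes taking means from lower to higher dimensions
    act trivially on the coordinates, see [low_term]. *)
Definition layer_sum (g : nat -> nat -> FV) (e : nat) : FV :=
  \sum_(k < K) (qfact q e)%:R^-1 *: iter (e - k) up (g k e).

Definition assemble (g : nat -> nat -> FV) : FV := \sum_(e < n.+1) layer_sum g e.

(** The averaging operator in primitive coordinates, see [avg_assemble]. It keeps
    the degree k, so the eigenvalue problem splits. *)
Definition mix (g : nat -> nat -> FV) k d : FV :=
  \sum_(0 <= e < d) g k e + \sum_(d.+1 <= e < n.+1) (\prod_(d <= l < e) step k l) *: g k e.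

Lemma layer_sum_graded g e : adapted g -> layer_sum g e \in gr e.
Proof.
move=> [gp g0]; apply: memv_suml => k _; apply: memvZ.
have [/and3P[_ _ /andP[ke _]]|/g0->] := boolP (in_range k e); last first.
  by rewrite -upnE linear0 mem0v.
have /primitiveP[h _] := gp k e.
by have := iter_up_graded (e - k) h; rewrite subnKC.
Qed.

Lemma assembleE g U : adapted g -> assemble g U = layer_sum g (\dim U) U.
Proof.
move=> ga; rewrite sum_ffunE.
have lt : (\dim U < n.+1)%N by rewrite ltnS dim_leqn.
rewrite (bigD1 (Ordinal lt)) //= big1 ?addr0 // => e ne.
by have /gradedP := layer_sum_graded e ga; apply; apply: contra ne => /eqP dU; apply/eqP/val_inj.
Qed.

Lemma iter_up_local g (f f' : FV) U : (forall W : T, (\dim W + g)%N = \dim U -> f W = f' W) ->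
  iter g up f U = iter g up f' U.
Proof.
by move=> h; rewrite !iter_upE; congr (_ * _); apply: eq_bigr => W /andP[_ /eqP]; exact: h.
Qed.

Lemma iter_dn_local g (f f' : FV) W : (forall U : T, (\dim W + g)%N = \dim U -> f U = f' U) ->
  iter g dn f W = iter g dn f' W.
Proof.
by move=> h; rewrite !iter_dnE; congr (_ * _); apply: eq_bigr => U /andP[_ /eqP]; exact: h.
Qed.

Let scaleE a (f : FV) U : (a *: f) U = a * f U. Proof. by rewrite ffunE. Qed.
Let addE (f f' : FV) U : (f + f') U = f U + f' U. Proof. by rewrite ffunE. Qed.

(** The truncation to [n - k] on the right is automatic by [iter_up_vanish]. *)
Lemma low_term g k e (U : T) : adapted g -> (2 * k <= n)%N -> (e < \dim U)%N ->
  (qfact q e)%:R^-1 * iter (\dim U - e) up (iter (e - k) up (g k e)) U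
     / (qffact q (\dim U) (\dim U - e))%:R =
  if (k <= \dim U <= n - k)%N then (qfact q (\dim U))%:R^-1 * iter (\dim U - k) up (g k e) U else 0.
Proof.
move=> [gp g0] kn ed.
have [/and3P[e0 en /andP[ke ek]]|nr] := boolP (in_range k e); last first.
  by rewrite (g0 _ _ nr) -!upnE !linear0 !ffunE !(mulr0, mul0r) if_same.
rewrite -iterD (_ : \dim U - e + (e - k) = \dim U - k)%N; last by lia.
case: ifP => [_|].
  have := @qffact_fact q (\dim U) (\dim U - e) (leq_subr _ _).
  rewrite subKn ?(ltnW ed) // => <-; rewrite natrM invfM; ring.
rewrite (leq_trans ke (ltnW ed)) /= => /negbT; rewrite -ltnNge => lt.
by rewrite (iter_up_vanish kn (gp k e) lt) ffunE !(mulr0, mul0r).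
Qed.

Lemma high_term g k e (U : T) : adapted g -> (2 * k <= n)%N -> (0 < \dim U)%N ->
  (\dim U < e <= n)%N ->
  (qfact q e)%:R^-1 * iter (e - \dim U) dn (iter (e - k) up (g k e)) U
     / (qffact q (n - \dim U) (e - \dim U))%:R =
  if (k <= \dim U <= n - k)%N then (qfact q (\dim U))%:R^-1 *
    ((\prod_(\dim U <= l < e) step k l) * iter (\dim U - k) up (g k e) U) else 0.
Proof.
move=> [gp g0] kn d0 /andP[de en'].
have [/and3P[e0 en /andP[ke ek]]|nr] := boolP (in_range k e); last first.
  by rewrite (g0 _ _ nr) -!upnE -!dnnE !linear0 !ffunE !(mulr0, mul0r) if_same.
have le : (e - k + 2 * k <= n)%N by lia.
have [kd|dk] := leqP k (\dim U); last first.
  rewrite (iter_dn_up_gt (gp k e) le) ?ffunE ?(mulr0, mul0r) //=; lia.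
rewrite (_ : (_ <= n - k)%N = true) /=; last by lia.
rewrite (iter_dn_up (gp k e) le); last by lia.
rewrite (_ : e - k - (e - \dim U) = \dim U - k)%N; last by lia.
have dn_ : (\dim U < n)%N by lia.
have ps := prod_step kn kd (ltnW de) ek dn_ en.
rewrite scaleE; move: ps; set P := \prod_(_ < _) _; set S := \prod_(_ <= _ < _) _ => ps.
transitivity ((qfact q e)%:R^-1 * (P / (qffact q (n - \dim U) (e - \dim U))%:R) *
  iter (\dim U - k) up (g k e) U); first by ring.
by rewrite ps; field; rewrite !qf.
Qed.

Lemma avg_assemble g (U : T) : adapted g -> (0 < \dim U < n)%N ->
  avg (assemble g) U = (qfact q (\dim U))%:R^-1 *
    \sum_(k < K | (k <= \dim U <= n - k)%N) iter (\dim U - k) up (mix g k (\dim U)) U.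
Proof.
move=> ga /andP[d0 dltn].
have kn (k : 'I_K) : (2 * k <= n)%N by have := ltn_ord k; lia.
pose h k e := iter (\dim U - k) up (g k e) U.
have mixE (k : 'I_K) : iter (\dim U - k) up (mix g k (\dim U)) U =
    \sum_(0 <= e < \dim U) h k e +
    \sum_((\dim U).+1 <= e < n.+1) (\prod_(\dim U <= l < e) step k l) * h k e.
  rewrite /mix -upnE linearD !linear_sum addE !sum_ffunE; congr (_ + _).
    by apply: eq_bigr => e _; rewrite /= upnE.
  by apply: eq_bigr => e _; rewrite /= linearZ /= scaleE upnE.
rewrite (eq_bigr _ (fun k _ => mixE k)) big_split mulrDr /avg; congr (_ + _).
  rewrite exchange_big mulr_sumr /=; apply: eq_big_nat => e /andP[_ ed].
  rewrite (@iter_up_local _ _ (layer_sum g e)); last first.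
    by move=> W dW; rewrite assembleE // (_ : \dim W = e) //; lia.
  rewrite /layer_sum -upnE linear_sum sum_ffunE mulr_suml mulr_sumr [RHS]big_mkcond /=.
  by apply: eq_bigr => k _; rewrite /= linearZ /= scaleE !upnE low_term.
rewrite exchange_big mulr_sumr /=; apply: eq_big_nat => e /andP[ed en].
rewrite (@iter_dn_local _ _ (layer_sum g e)); last first.
  by move=> W dW; rewrite assembleE // (_ : \dim W = e) //; lia.
rewrite /layer_sum -dnnE linear_sum sum_ffunE mulr_suml mulr_sumr [RHS]big_mkcond /=.
by apply: eq_bigr => k _; rewrite /= linearZ /= scaleE !dnnE high_term // ed -ltnS.
Qed.

Lemma assemble_range g (U : T) : adapted g ->
  assemble g U = (qfact q (\dim U))%:R^-1 *
    \sum_(k < K | (k <= \dim U <= n - k)%N) iter (\dim U - k) up (g k (\dim U)) U.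
Proof.
move=> ga; rewrite assembleE // /layer_sum sum_ffunE mulr_sumr [RHS]big_mkcond /=.
apply: eq_bigr => k _; rewrite scaleE; case: ifP => // /negbT nr.
have -> : g k (\dim U) = 0 by apply: (proj2 ga); rewrite /in_range (negPf nr) !andbF.
by rewrite -upnE linear0 ffunE mulr0.
Qed.

Lemma mix_primitive g k d : adapted g -> mix g k d \in prim k.
Proof.
move=> [gp _]; apply: memvD; apply: memv_suml => e _; [exact: gp | exact/memvZ/gp].
Qed.

(** In each dimension the layers span all functions, by [sum_layers]. *)
Lemma decompose (f : FV) :
  (forall U : T, ~~ (0 < \dim U < n)%N -> f U = 0) -> exists2 g, adapted g & f = assemble g.
Proof.
move=> f0.
(* The part of f in dimension e; the functions h and then H choose its primitive
   components. *)
pose fd e : FV := [ffun U => if (\dim U == e)%N then f U else 0].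
have fdg e : fd e \in gr e by apply/gradedP => X /negPf h; rewrite ffunE h.
have ex e : exists h : nat -> FV, (0 < e < n)%N ->
    (forall k, (k <= minn e (n - e))%N -> h k \in prim k) /\
    fd e = \sum_(k < (minn e (n - e)).+1) iter (e - k) up (h k).
  have [/andP[e0 en]|_] := boolP (0 < e < n)%N; last by exists (fun=> 0).
  have := fdg e; rewrite -sum_layers ?(ltnW en) // => /memv_sumP[us usP e'].
  have /fin_all_exists[h hP] (i : 'I_(minn e (n - e)).+1) : exists h : FV,
      h \in prim i /\ us i = iter (e - i) up h.
    by have /memv_imgP[h ph ->] := usP i isT; exists h; rewrite upnE.
  exists (fun i => h (inord i)) => _; split=> [i le|].
    by have [+ _] := hP (inord i); rewrite inordK.
  by rewrite e'; apply: eq_bigr => i _; have [_ ->] := hP i; rewrite inord_val.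
have /choice[H HP] : forall e, exists h : nat -> FV, (0 < e < n)%N ->
    (forall k, (k <= minn e (n - e))%N -> h k \in prim k) /\
    fd e = \sum_(k < (minn e (n - e)).+1) iter (e - k) up (h k) by move=> e; exact: ex.
pose g k e := if in_range k e then (qfact q e)%:R *: H e k else 0.
have ga : adapted g.
  split=> k e; rewrite /g; last by move/negPf->.
  case: ifP => [/and3P[e0 en /andP[ke ek]]|_]; last exact: mem0v.
  apply: memvZ; have [|h _] := HP e; first by rewrite e0.
  by apply: h; lia.
exists g => //; apply/ffunP => U; rewrite assembleE //.
have [dU|/[dup] nU /f0->] := boolP (0 < \dim U < n)%N; last first.
  rewrite /layer_sum sum_ffunE big1 // => k _; rewrite /g ifN ?(-upnE) ?linear0.
    by rewrite -upnE linear0 scaler0 ffunE.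
  by apply: contra nU => /and3P[-> -> _].
have [_ e] := HP _ dU; have -> : f U = fd (\dim U) U by rewrite ffunE eqxx.
rewrite e /layer_sum; set m := minn _ _; case/andP: dU => d0 dn_.
have mK : (m.+1 <= K)%N by rewrite /m; lia.
rewrite (big_ord_widen _ (fun k => iter (\dim U - k) up (H (\dim U) k)) mK) big_mkcond.
congr (fun_of_fin _ U); apply: eq_bigr => k _; rewrite /g.
have -> : (k < m.+1)%N = in_range k (\dim U) by rewrite /in_range d0 dn_ /m; lia.
case: ifP => _; last by rewrite -upnE linear0 scaler0.
by rewrite -!upnE linearZ /= scalerA mulVf // scale1r.
Qed.

(** The primitive coordinates are unique, by [independence]. *)
Lemma eigen_mix g mu : adapted g ->
  (forall U : T, (0 < \dim U < n)%N -> avg (assemble g) U = mu * assemble g U) ->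
  forall k d, in_range k d -> mu *: g k d = mix g k d.
Proof.
move=> ga h k d /and3P[d0 dltn kd].
pose f j := mu *: g j d - mix g j d.
have fp j : f j \in prim j by apply: memvB; [apply: memvZ; case: ga | exact: mix_primitive].
suff : f k = 0 by move/eqP; rewrite subr_eq0 => /eqP.
apply: (@independence F n R d f (ltnW dltn)) => //; last by lia.
apply/ffunP => U; rewrite [RHS]ffunE big_mkord sum_ffunE.
have [dU|dU] := eqVneq (\dim U) d; last first.
  rewrite big1 // => j _; have /primitiveP[h' _] := fp j.
  have := iter_up_graded (d - j) h'; rewrite subnKC; last by have := ltn_ord j; lia.
  by move/gradedP; apply.
have := h U; rewrite dU d0 dltn => /(_ isT).
rewrite avg_assemble ?dU ?d0 // assemble_range // dU mulrCA => /(mulfI (invr_neq0 (qf d))).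
move/eqP; rewrite -subr_eq0 -opprB oppr_eq0 mulr_sumr -sumrB => /eqP e.
rewrite -[RHS]e.
have mK : ((minn d (n - d)).+1 <= K)%N by lia.
rewrite (big_ord_widen _ (fun j => iter (d - j) up (f j) U) mK).
apply: eq_big => [j|j _]; first by lia.
by rewrite /f -!upnE linearB linearZ /= addE scaleE -[- _]scaleN1r scaleE mulN1r.
Qed.

Lemma mix_eigen g mu : adapted g ->
  (forall k d, (k < K)%N -> in_range k d -> mu *: g k d = mix g k d) ->
  forall U : T, (0 < \dim U < n)%N -> avg (assemble g) U = mu * assemble g U.
Proof.
move=> ga h U dU; rewrite avg_assemble // assemble_range // mulrCA; congr (_ * _).
rewrite mulr_sumr; apply: eq_bigr => k kd.
by rewrite -h // ?/in_range ?kd ?andbA ?dU // -upnE linearZ /= scaleE upnE.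
Qed.

End Action.

(** * The scalar system and its characteristic polynomial *)

Section Shooting.
Variables (R : realFieldType) (r : nat -> R).

(** The eigenvalue equation of an m x m matrix with zero diagonal, entries 1 below
    the diagonal, and products of consecutive [r] above it. *)
Definition chain_solution m (mu : R) (y : nat -> R) : Prop :=
  forall i, (i < m)%N ->
    mu * y i = \sum_(0 <= j < i) y j + \sum_(i.+1 <= j < m) (\prod_(i <= l < j) r l) * y j.

(** Pairs of consecutive terms encode a recursion of order two. The terms are the
    partial sums of a solution that starts from [y 0], rescaled to be polynomials
    in mu, see [chain_solution_shoot]. *)
Fixpoint shoot2 i : {poly R} * {poly R} :=
  if i is i'.+1 then
    let: (a, b) := shoot2 i' in
    (b, (2%:P + (1 + (r i')^-1)%:P * 'X) * b - (1 + 'X) ^+ 2 * (r i')^-1%:P * a)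
  else (0, 1).
Definition shoot i : {poly R} := (shoot2 i).1.
(** What is left of the last equation of the system when the partial sums are
    replaced by [shoot]. *)
Definition char_shoot m : {poly R} := 'X * shoot m - (1 + 'X) ^+ 2 * shoot m.-1.

Lemma shoot0 : shoot 0 = 0. Proof. by []. Qed.
Lemma shoot1 : shoot 1 = 1. Proof. by []. Qed.
Lemma shootSS i : shoot i.+2 =
  (2%:P + (1 + (r i)^-1)%:P * 'X) * shoot i.+1 - (1 + 'X) ^+ 2 * (r i)^-1%:P * shoot i.
Proof. by rewrite /shoot /=; case: (shoot2 i). Qed.

Lemma horner_shootSS i mu : (shoot i.+2).[mu] =
  (2 + mu + mu * (r i)^-1) * (shoot i.+1).[mu] - (1 + mu) ^+ 2 * (r i)^-1 * (shoot i).[mu].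
Proof. by rewrite shootSS !hornerE; ring. Qed.

Lemma horner_char_shoot m mu : (char_shoot m.+1).[mu] =
  mu * (shoot m.+1).[mu] - (1 + mu) ^+ 2 * (shoot m).[mu].
Proof. by rewrite /char_shoot !hornerE. Qed.

Lemma size_shoot i : (size (shoot i) <= i)%N.
Proof.
suff h : (size (shoot i) <= i)%N /\ (size (shoot i.+1) <= i.+1)%N by case: h.
elim: i => [|i [IH1 IH2]]; first by rewrite shoot0 shoot1 size_poly0 size_poly1.
split=> //; rewrite shootSS (leq_trans (size_polyD _ _)) // geq_max size_polyN.
apply/andP; split.
  apply: leq_trans (size_polyMleq _ _) _.
  have : (size (2%:P + (1 + (r i)^-1)%:P * 'X : {poly R})%R <= 2)%N.
    rewrite (leq_trans (size_polyD _ _)) // geq_max (leq_trans (size_polyC_leq1 _)) //=.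
    by rewrite (leq_trans (size_polyMleq _ _)) // size_polyX addn2 /= ltnS size_polyC_leq1.
  by lia.
apply: leq_trans (size_polyMleq _ _) _.
have : (size ((1 + 'X) ^+ 2 * (r i)^-1%:P : {poly R})%R <= 3)%N.
  rewrite (leq_trans (size_polyMleq _ _)) // (@leq_trans (3 + 1).-1) //.
  have e : size ((1 + 'X) ^+ 2 : {poly R}) = 3.
    rewrite (_ : 1 + 'X = 'X - (-1)%:P); last by rewrite polyCN opprK addrC.
    by rewrite size_exp_XsubC.
  by rewrite e -!subn1 leq_sub2r ?leq_add2l ?size_polyC_leq1.
move=> h; apply: (@leq_trans (3 + i).-1) => //; rewrite -!subn1 leq_sub2r ?leq_add //.
Qed.

Lemma size_char_shoot m : (size (char_shoot m.+1) <= m.+2)%N.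
Proof.
rewrite /char_shoot (leq_trans (size_polyD _ _)) // geq_max size_polyN.
have [h1 h2] := (size_shoot m.+1, size_shoot m).
apply/andP; split; apply: leq_trans (size_polyMleq _ _) _.
  by rewrite size_polyX; lia.
rewrite (_ : 1 + 'X = 'X - (-1)%:P); last by rewrite polyCN opprK addrC.
by rewrite size_exp_XsubC -subn1 leq_subLR (leq_add (leqnn 3) h2).
Qed.

Variable m : nat.
Hypothesis r_bounds : forall i, (i < m)%N -> 0 < r i < 1.

Let r_neq0 i : (i < m)%N -> r i != 0.
Proof. by move=> /r_bounds /andP[/gt_eqF->]. Qed.

Let rV_neq1 i : (i < m)%N -> (r i)^-1 != 1.
Proof.
by move=> /r_bounds /andP[_ lt]; rewrite invr_eq1 lt_eqF.
Qed.

(** The point -1 is singular for the change of variables between solutions and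
    partial sums, and it is not a root because no ratio equals 1. In particular the
    polynomial is not zero. *)
Lemma char_shoot_N1 : (char_shoot m.+1).[-1] != 0.
Proof.
rewrite horner_char_shoot subrr expr0n mul0r subr0 mulN1r oppr_eq0.
suff h i : (i <= m)%N -> (shoot i.+1).[-1] != 0 by exact: h.
elim: i => [|i IH] le; first by rewrite shoot1 hornerC oner_neq0.
rewrite horner_shootSS subrr expr0n !mul0r subr0 mulf_neq0 ?IH ?(ltnW le) //.
rewrite (_ : 2 + -1 + -1 * (r i)^-1 = 1 - (r i)^-1); last by ring.
by rewrite subr_eq0 eq_sym rV_neq1.
Qed.

Lemma char_shoot_neq0 : char_shoot m.+1 != 0.
Proof. by apply: contraNneq char_shoot_N1 => ->; rewrite horner0. Qed.

(** The difference of two consecutive equations, which no longer contains the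
    products. *)
Definition step_relation mu (y : nat -> R) i :=
  (r i)^-1 * (mu * y i - \sum_(0 <= j < i) y j) = (1 + mu) * y i.+1 - \sum_(0 <= j < i.+1) y j.

(** Subtracting r i times the equation i + 1 from the equation i cancels the sums
    above the diagonal; the last equation has none. *)
Lemma chain_solutionP mu y :
  chain_solution m.+1 mu y <->
  (forall i, (i < m)%N -> step_relation mu y i) /\ mu * y m = \sum_(0 <= j < m) y j.
Proof.
pose Tl i := \sum_(i.+1 <= j < m.+1) (\prod_(i <= l < j) r l) * y j.
have TS i : (i < m)%N -> Tl i = r i * (y i.+1 + Tl i.+1).
  move=> im; rewrite /Tl big_ltn // big_nat1 mulrDr; congr (_ + _).
  rewrite big_distrr /=; apply: eq_big_nat => j /andP[ij jm].
  by rewrite mulrA -big_ltn // ltnW.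
have Tm : Tl m = 0 by rewrite /Tl big_geq.
split=> [h|[hs he] i]; first split.
- move=> i im; rewrite /step_relation.
  have h1 := h i (ltnW im); have h2 := h i.+1 im.
  rewrite -/(Tl i) TS // in h1; rewrite -/(Tl i.+1) in h2.
  by rewrite h1 addrC addrA addNr add0r mulKf ?r_neq0 // mulrDl mul1r h2; ring.
- by rewrite h // -/(Tl m) Tm addr0.
rewrite ltnS => le; rewrite -/(Tl i) -(subKn le).
elim: (m - i)%N (leq_subr i m) => [|d IH] dm; first by rewrite subn0 Tm addr0 he.
have im : (m - d.+1 < m)%N by lia.
have := IH (ltnW dm); rewrite (_ : m - d = (m - d.+1).+1)%N; last by lia.
set i0 := (m - d.+1)%N in im * => h2; rewrite TS //.
have := hs i0 im; rewrite /step_relation => /(congr1 (fun x => r i0 * x)).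
rewrite mulVKf ?r_neq0 // => e.
have -> : mu * y i0 = r i0 * ((1 + mu) * y i0.+1 - \sum_(0 <= j < i0.+1) y j) + \sum_(0 <= j < i0) y j.
  by rewrite -e; ring.
by rewrite mulrDl mul1r h2; ring.
Qed.

Lemma chain_solution_shoot mu y : chain_solution m.+1 mu y ->
  forall i, (i <= m.+1)%N ->
  (1 + mu) ^+ i * \sum_(0 <= j < i) y j = (1 + mu) * y 0%N * (shoot i).[mu].
Proof.
move=> /chain_solutionP[hs he] i.
pose P i := (1 + mu) ^+ i * \sum_(0 <= j < i) y j = (1 + mu) * y 0%N * (shoot i).[mu].
suff h i' : (i' < m.+1)%N -> P i' /\ P i'.+1.
  by case: i => [|i le]; [case: (h 0%N isT) | case: (h i le)].
elim: i' => [|{}i IH] lt.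
  by rewrite /P big_geq // shoot0 horner0 !mulr0 big_nat1 shoot1 hornerC mulr1 expr1.
have [IH1 IH2] := IH (ltnW lt); split=> //; rewrite /P horner_shootSS.
transitivity ((2 + mu + mu / r i) * ((1 + mu) * y 0%N * (shoot i.+1).[mu]) -
  (1 + mu) ^+ 2 / r i * ((1 + mu) * y 0%N * (shoot i).[mu])); last by ring.
rewrite -IH1 -IH2; have := hs i lt; rewrite /step_relation => /esym/(canRL (subrK _)) e.
rewrite big_nat_recr // [X in X = _]/=; set X := \sum_(0 <= j < i.+1) y j in e *.
transitivity ((1 + mu) ^+ i.+1 * ((1 + mu) * X + (1 + mu) * y i.+1)); first by rewrite !exprS; ring.
by rewrite e /X big_nat_recr //= !exprS; ring.
Qed.

(** A solution is determined by its first entry, since the recursion for the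
    partial sums can be solved forward unless mu is -1. At -1 the partial sums
    satisfy a relation that forces all of them to vanish. *)
Lemma chain_solution_eq0 mu y : chain_solution m.+1 mu y ->
  y 0%N = 0 \/ mu = -1 -> forall i, (i < m.+1)%N -> y i = 0.
Proof.
move=> sol h.
suff S0 i : (i <= m.+1)%N -> \sum_(0 <= j < i) y j = 0.
  move=> i lt; have := S0 i.+1 lt; rewrite big_nat_recr //= S0 ?add0r //.
  exact: ltnW.
have [muE|/eqP mu1] := eqVneq mu (-1).
  have /chain_solutionP[hs he] := sol.
  case: i => [|i]; first by rewrite big_geq.
  rewrite ltnS leq_eqVlt => /orP[/eqP->|im].
    by rewrite big_nat_recr //= -he muE; ring.
  have := hs i im; rewrite /step_relation muE subrr mul0r sub0r => e.
  have : (1 - (r i)^-1) * \sum_(0 <= j < i.+1) y j = 0.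
    by apply: (addIr (- \sum_(0 <= j < i.+1) y j)); rewrite -[in RHS]e big_nat_recr //=; ring.
  by move/eqP; rewrite mulf_eq0 subr_eq0 eq_sym (negPf (rV_neq1 im)) => /eqP.
case: h => [y0|/mu1//] le; have := chain_solution_shoot sol le.
rewrite y0 mulr0 mul0r => /eqP; rewrite mulf_eq0 expf_eq0 => /orP[/andP[_]|/eqP//].
by rewrite addrC addr_eq0 => /eqP/mu1.
Qed.

Lemma chain_solution_root mu y : chain_solution m.+1 mu y ->
  y 0%N = 0 \/ root (char_shoot m.+1) mu.
Proof.
move=> sol.
have [muE|mu1] := eqVneq mu (-1).
  by left; apply: (chain_solution_eq0 sol (or_intror muE)).
have e1 := chain_solution_shoot sol (leqnn _).
have e2 := chain_solution_shoot sol (leqnSn _).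
have /chain_solutionP[_ he] := sol.
have : (1 + mu) * y 0%N * (char_shoot m.+1).[mu] = 0.
  rewrite horner_char_shoot.
  transitivity (mu * ((1 + mu) * y 0%N * (shoot m.+1).[mu]) -
     (1 + mu) ^+ 2 * ((1 + mu) * y 0%N * (shoot m).[mu])); first by ring.
  rewrite -e1 -e2 big_nat_recr //=; set X := \sum_(0 <= j < m) y j in he *.
  transitivity ((1 + mu) ^+ m.+1 * (mu * X + mu * y m) - (1 + mu) ^+ 2 * ((1 + mu) ^+ m * X)).
    by ring.
  by rewrite he !exprS; ring.
move/eqP; rewrite -mulrA mulf_eq0 addrC addr_eq0 (negPf mu1) /= mulf_eq0.
by case/orP => [/eqP|]; [left|right].
Qed.

(** The partial sums read off from [shoot] satisfy the recursion, and being a root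
    is the last equation. *)
Lemma root_chain_solution mu : root (char_shoot m.+1) mu ->
  exists2 y, chain_solution m.+1 mu y & y 0%N = 1.
Proof.
move=> rt; have mu1 : 1 + mu != 0.
  apply: contraTneq rt => e; have -> : mu = -1 by apply/eqP; rewrite -addr_eq0 addrC e.
  by rewrite /root char_shoot_N1.
pose S i := (1 + mu) * (1 + mu) ^- i * (shoot i).[mu].
pose y i := S i.+1 - S i.
have SE i : \sum_(0 <= j < i) y j = S i.
  by rewrite telescope_sumr // /S shoot0 horner0 mulr0 subr0.
have S1 : S 1%N = 1 by rewrite /S shoot1 hornerC mulr1 expr1 divff.
exists y; last by rewrite /y S1 /S shoot0 horner0 mulr0 subr0.
apply/chain_solutionP; split=> [i im|].
  rewrite /step_relation !SE /y.
  have -> : S i.+2 = ((2 + mu + mu * (r i)^-1) * S i.+1 - (1 + mu) * (r i)^-1 * S i) / (1 + mu).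
    by rewrite /S horner_shootSS !exprS; field; rewrite mu1 r_neq0 // expf_neq0.
  by field; rewrite mu1 r_neq0.
rewrite SE /y.
suff : mu * S m.+1 = (1 + mu) * S m by move=> e; rewrite mulrBr e; ring.
move: rt; rewrite /root horner_char_shoot subr_eq0 => /eqP e.
transitivity ((1 + mu) * (1 + mu) ^- m.+1 * (mu * (shoot m.+1).[mu])); first by rewrite /S; ring.
by rewrite e /S exprS; field; rewrite mu1 expf_neq0.
Qed.

End Shooting.

(** * Perturbation of recurrences and of simple roots *)

Section Recurrence.
Variable R : realFieldType.

Fixpoint rec2 (a b : nat -> R) i : R * R :=
  if i is i'.+1 then
    let: (x, y) := rec2 a b i' in (y, a i' * y - b i' * x)
  else (0, 1).
Definition recur a b i := (rec2 a b i).1.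

Lemma recur0 a b : recur a b 0 = 0. Proof. by []. Qed.
Lemma recur1 a b : recur a b 1 = 1. Proof. by []. Qed.
Lemma recurSS a b i : recur a b i.+2 = a i * recur a b i.+1 - b i * recur a b i.
Proof. by rewrite /recur /=; case: (rec2 a b i). Qed.

Lemma eq_recur (a b a' b' : nat -> R) m :
  (forall i, (i.+1 < m)%N -> a i = a' i /\ b i = b' i) ->
  forall i, (i <= m)%N -> recur a b i = recur a' b' i.
Proof.
move=> e i lem.
suff h j : (j < m)%N -> recur a b j = recur a' b' j /\ recur a b j.+1 = recur a' b' j.+1.
  by case: i lem => // i /h[].
elim: j => [|j IH] lt; first by rewrite !recur0 !recur1.
have [IH1 IH2] := IH (ltnW lt); split=> //.
by rewrite !recurSS IH1 IH2; have [-> ->] := e j lt.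
Qed.

(** Both terms and their differences grow by a factor of at most 4 M at each step,
    where M bounds the coefficients, so that a constant depending on L and m only is
    enough. *)
Lemma recur_perturb (L : R) m : exists2 K : R, 0 < K &
  forall (a b a' b' : nat -> R) (eps : R), 0 <= eps ->
  (forall i, (i.+1 < m)%N -> [/\ `|a i| <= L, `|b i| <= L, `|a' i| <= L & `|b' i| <= L]) ->
  (forall i, (i.+1 < m)%N -> `|a i - a' i| <= L * eps /\ `|b i - b' i| <= L * eps) ->
  forall i, (i <= m)%N ->
    [/\ `|recur a b i| <= K, `|recur a' b' i| <= K & `|recur a b i - recur a' b' i| <= K * eps].
Proof.
pose M : R := 1 + `|L|; have M1 : 1 <= M by rewrite lerDl.
have M0 : 0 <= M by apply: le_trans M1.
have LM : L <= M by rewrite (le_trans (ler_norm L)) // lerDr.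
pose K i : R := (4 * M) ^+ i.
have M4 : 1 <= 4 * M by lra.
exists (K m) => [|a b a' b' eps e0 hb hd i lem]; first by rewrite exprn_gt0 //; lra.
pose P j := [/\ `|recur a b j| <= K j, `|recur a' b' j| <= K j &
   `|recur a b j - recur a' b' j| <= K j * eps].
have mono j : (j <= m)%N -> P j -> [/\ `|recur a b j| <= K m, `|recur a' b' j| <= K m &
   `|recur a b j - recur a' b' j| <= K m * eps].
  move=> jm [h1 h2 h3]; have le : K j <= K m by rewrite ler_weXn2l.
  by split; apply: le_trans; eauto; apply: ler_wpM2r.
apply: (mono i lem); suff h j : (j < m)%N -> P j /\ P j.+1.
  case: i lem => [|i] lem; last by case: (h i lem).
  by rewrite /P !recur0 subrr normr0 /K expr0 mul1r ler01 e0.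
elim: j => [|j IH] lt.
  rewrite /P !recur0 !recur1 !subrr normr0 normr1 /K expr0 expr1 mul1r ler01 e0.
  by split; split=> //; apply: mulr_ge0 => //; lra.
have [IH1 IH2] := IH (ltnW lt); split=> //; rewrite /P !recurSS.
have {hb} [ha hb ha' hb'] := hb j lt; have {hd} [da db] := hd j lt.
case: IH1 => x1 x2 x3; case: IH2 => y1 y2 y3.
have K0 : 0 <= K j by rewrite exprn_ge0 //; lra.
have KS : K j.+1 = 4 * M * K j by rewrite /K exprS.
have KSS : K j.+2 = 4 * M * K j.+1 by rewrite /K exprS.
have KS0 : 0 <= K j.+1 by rewrite exprn_ge0 //; lra.
have KK : K j <= K j.+1 by rewrite KS ler_peMl.
have hM x y N : `|x| <= L -> `|y| <= N -> N <= K j.+1 -> `|x * y| <= M * K j.+1.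
  move=> hx hy hN; rewrite normrM; apply: ler_pM => //; first exact: le_trans LM.
  exact: le_trans hN.
have hMe x y N : `|x| <= L * eps -> `|y| <= N -> N <= K j.+1 -> `|x * y| <= M * K j.+1 * eps.
  move=> hx hy hN; rewrite normrM mulrAC; apply: ler_pM => //; last exact: le_trans hN.
  by apply: le_trans hx _; apply: ler_wpM2r.
have hMe' x y N : `|x| <= L -> `|y| <= N * eps -> N <= K j.+1 -> `|x * y| <= M * K j.+1 * eps.
  move=> hx hy hN; rewrite normrM -mulrA; apply: ler_pM => //; first exact: le_trans LM.
  by apply: le_trans hy _; apply: ler_wpM2r.
have MK0 : 0 <= M * K j.+1 by apply: mulr_ge0.
split.
- apply: le_trans (ler_normB _ _) _; rewrite KSS.
  have := hM _ _ _ ha y1 (lexx _); have := hM _ _ _ hb x1 KK; lra.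
- apply: le_trans (ler_normB _ _) _; rewrite KSS.
  have := hM _ _ _ ha' y2 (lexx _); have := hM _ _ _ hb' x2 KK; lra.
set X := recur a b j in x1 x3 *; set X' := recur a' b' j in x2 x3 *.
set Y := recur a b j.+1 in y1 y3 *; set Y' := recur a' b' j.+1 in y2 y3 *.
have -> : a j * Y - b j * X - (a' j * Y' - b' j * X') =
   ((a j - a' j) * Y + a' j * (Y - Y')) - ((b j - b' j) * X + b' j * (X - X')) by ring.
have e1 := hMe _ _ _ da y1 (lexx _). have e2 := hMe' _ _ _ ha' y3 (lexx _).
have e3 := hMe _ _ _ db x1 KK. have e4 := hMe' _ _ _ hb' x3 KK.
apply: le_trans (ler_normB _ _) _; rewrite KSS.
have := ler_normD ((a j - a' j) * Y) (a' j * (Y - Y')).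
have := ler_normD ((b j - b' j) * X) (b' j * (X - X')).
have -> : 4 * M * K j.+1 * eps = 4 * (M * K j.+1 * eps) by ring.
by lra.
Qed.

End Recurrence.

Section RootNear.
Variable R : rcfType.

(** A polynomial that is K eps-close to one with a simple root x0 changes sign
    between x0 - C eps and x0 + C eps as soon as C exceeds K over half of the
    slope. *)
Lemma root_near (x0 K : R) (S : {poly R}) : S.[x0] != 0 -> 0 <= K ->
  exists C e0 : R, [/\ 0 < C, 0 < e0 &
  forall (eps : R) (G : {poly R}), 0 < eps -> eps <= e0 ->
    (forall x, `|x - x0| <= 1 -> `|G.[x] - (x - x0) * S.[x]| <= K * eps) ->
    exists2 x, root G x & `|x - x0| <= C * eps].
Proof.
move=> S0 K0.
have [w we] : exists w : {poly R}, S - S.[x0]%:P = w * ('X - x0%:P).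
  by apply/factor_theorem; rewrite /root !hornerE subrr.
have SE x : S.[x] = S.[x0] + (x - x0) * w.[x].
  have := congr1 (fun p : {poly R} => p.[x]) we; rewrite !hornerE /= => e.
  by rewrite mulrC -e; ring.
have [B hB] := poly_disk_bound w (`|x0| + 1).
(* Multiplying by the sign makes the slope positive. *)
pose sg := Num.sg S.[x0]; pose sigma := `|S.[x0]|.
have s0 : 0 < sigma by rewrite normr_gt0.
have sgE : sg * S.[x0] = sigma by rewrite /sigma normrEsg.
have nsg : `|sg| = 1 by rewrite normr_sg S0.
pose B' := 1 + `|B|; have B0 : 0 < B' by rewrite ltr_pwDl.
have BB : B <= B' by rewrite (le_trans (ler_norm _)) // lerDr.
pose delta := Num.min 1 (sigma / (2 * B')).
have d0 : 0 < delta by rewrite lt_min ltr01 divr_gt0 // mulr_gt0.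
have near x : `|x - x0| <= delta -> sigma / 2 <= sg * S.[x].
  rewrite le_min => /andP[x1 xd].
  have hw : `|w.[x]| <= B'.
    apply: le_trans (hB x _) BB; have := ler_normD x0 (x - x0).
    by rewrite [x0 + _]addrC subrK => h; apply: le_trans h _; rewrite lerD2l.
  rewrite SE mulrDr sgE.
  have : `|sg * ((x - x0) * w.[x])| <= sigma / 2.
    rewrite !normrM nsg mul1r; apply: le_trans (ler_pM _ _ xd hw) _ => //.
    by rewrite invfM mulrA mulfVK ?gt_eqF.
  by rewrite ler_norml => /andP[h _]; lra.
pose C := 2 * (K + 1) / sigma.
have C0 : 0 < C by rewrite divr_gt0 // mulr_gt0 //; lra.
exists C, (delta / C); split=> // [|eps G e0 ee hG]; first exact: divr_gt0.
have hd : C * eps <= delta by rewrite mulrC -ler_pdivlMr.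
have h0 : 0 < C * eps by apply: mulr_gt0.
have d1 : delta <= 1 by rewrite ge_min lexx.
have Ch : C * eps * (sigma / 2) = (K + 1) * eps.
  by rewrite /C; field; rewrite gt_eqF.
have key x : `|x - x0| = C * eps -> `|sg * G.[x] - (x - x0) * (sg * S.[x])| <= K * eps /\
    sigma / 2 <= sg * S.[x].
  move=> e; split; last by apply: near; rewrite e.
  have -> : sg * G.[x] - (x - x0) * (sg * S.[x]) = sg * (G.[x] - (x - x0) * S.[x]) by ring.
  by rewrite normrM nsg mul1r; apply: hG; rewrite e (le_trans hd).
pose a := x0 - C * eps; pose b := x0 + C * eps.
have ea : a - x0 = - (C * eps) by rewrite /a; ring.
have eb : b - x0 = C * eps by rewrite /b; ring.
have [ha1 ha2] : _ /\ _ := key a (etrans (congr1 _ ea) (etrans (normrN _) (gtr0_norm h0))).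
have [hb1 hb2] : _ /\ _ := key b (etrans (congr1 _ eb) (gtr0_norm h0)).
have ab : a <= b by rewrite /a /b; lra.
have [|x /andP[ax xb] rx] := @poly_ivt R (sg *: G) a b ab.
  rewrite !hornerZ; apply/andP; split.
    move: ha1; rewrite ea ler_norml => /andP[_].
    have : C * eps * (sigma / 2) <= C * eps * (sg * S.[a]) by rewrite ler_pM2l.
    by rewrite Ch mulNr; lra.
  move: hb1; rewrite eb ler_norml => /andP[+ _].
  have : C * eps * (sigma / 2) <= C * eps * (sg * S.[b]) by rewrite ler_pM2l.
  by rewrite Ch; lra.
exists x; last by rewrite ler_norml; move: ax xb; rewrite /a /b; lra.
move: rx; rewrite /root hornerZ mulf_eq0 => /orP[|//].
by rewrite -normr_eq0 nsg oner_eq0.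
Qed.

End RootNear.

(** * Chebyshev polynomials *)

Section Chebyshev.
Fixpoint cheb2 (A : nzRingType) i : {poly A} * {poly A} :=
  if i is i'.+1 then let: (x, y) := cheb2 A i' in (y, 'X * y - x) else (0, 1).
(** The polynomial U_(i - 1) (X / 2), where U is the Chebyshev polynomial of the
    second kind. It is defined over any ring since its roots are compared over the
    reals, the algebraic numbers and the integers. *)
Definition cheb (A : nzRingType) i : {poly A} := (cheb2 A i).1.

Lemma cheb0 (A : nzRingType) : cheb A 0 = 0. Proof. by []. Qed.
Lemma cheb1 (A : nzRingType) : cheb A 1 = 1. Proof. by []. Qed.
Lemma chebSS (A : nzRingType) i : cheb A i.+2 = 'X * cheb A i.+1 - cheb A i.
Proof. by rewrite /cheb /=; case: (cheb2 A i). Qed.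

Lemma cheb_ind2 (P : nat -> Prop) : P 0%N -> P 1%N ->
  (forall i, P i -> P i.+1 -> P i.+2) -> forall i, P i.
Proof.
move=> P0 P1 PS i; suff : P i /\ P i.+1 by case.
by elim: i => [|i [IH1 IH2]]; split=> //; apply: PS.
Qed.

Lemma map_cheb (A B : nzRingType) (f : {rmorphism A -> B}) i :
  map_poly f (cheb A i) = cheb B i.
Proof.
elim/cheb_ind2: i => [||i IH1 IH2]; rewrite ?cheb0 ?cheb1 ?rmorph0 ?rmorph1 //.
by rewrite !chebSS rmorphB rmorphM /= map_polyX IH1 IH2.
Qed.

Lemma size_lead_cheb i : size (cheb int i.+1) = i.+1 /\ cheb int i.+1 \is monic.
Proof.
suff h : (size (cheb int i) = i) /\ (size (cheb int i.+1) = i.+1 /\ cheb int i.+1 \is monic).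
  by case: h.
elim: i => [|i [IH1 [IH2 IH3]]].
  by rewrite cheb0 cheb1 size_poly0 size_poly1 monic1.
split=> //; rewrite chebSS.
have sX : size ('X * cheb int i.+1) = i.+2.
  by rewrite mulrC size_mulX ?IH2 // monic_neq0.
have lt : (size (- cheb int i)%R < size ('X * cheb int i.+1)%R)%N.
  by rewrite size_polyN IH1 sX.
rewrite size_polyDl // sX; split=> //.
by rewrite monicE lead_coefDl // lead_coefM lead_coefX mul1r -monicE.
Qed.

Variable R : realType.

Lemma horner_cheb i (x : R) : (cheb R i).[x] = recur (fun=> x) (fun=> 1) i.
Proof.
elim/cheb_ind2: i => [||i IH1 IH2]; rewrite ?cheb0 ?cheb1 ?hornerC //.
by rewrite chebSS recurSS !hornerE IH1 IH2; ring.
Qed.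

Lemma sin_cheb i (x : R) : sin x * (cheb R i).[2 * cos x] = sin (i%:R * x).
Proof.
elim/cheb_ind2: i => [||i IH1 IH2]; rewrite ?cheb0 ?cheb1 ?hornerC.
- by rewrite mulr0 mul0r sin0.
- by rewrite mulr1 mul1r.
rewrite chebSS !hornerE mulrBr mulrCA IH1 IH2.
rewrite (_ : i.+2%:R * x = i.+1%:R * x + x); last by rewrite -[i.+2]addn1 natrD; ring.
rewrite (_ : i%:R * x = i.+1%:R * x - x); last by rewrite -[i.+1]addn1 natrD; ring.
by rewrite sinB sinD; ring.
Qed.

Lemma sin_natpi j : sin (j%:R * pi) = 0 :> R.
Proof.
elim: j => [|j IH]; first by rewrite mul0r sin0.
by rewrite -addn1 natrD mulrDl mul1r sinDpi IH oppr0.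
Qed.

Definition cheb_root (N j : nat) : R := 2 * cos (j%:R * pi / N%:R).

Lemma angle_bounds N j : (0 < j < N)%N -> 0 < (j%:R * pi / N%:R : R) < pi.
Proof.
move=> /andP[j0 jN]; have N0 : 0 < N%:R :> R by rewrite ltr0n; lia.
apply/andP; split; last first.
  by rewrite ltr_pdivrMr // mulrC ltr_pM2l ?pi_gt0 // ltr_nat.
by apply: divr_gt0 => //; apply: mulr_gt0; rewrite ?pi_gt0 ?ltr0n.
Qed.

Lemma root_cheb_root N j : (0 < j < N)%N -> root (cheb R N) (cheb_root N j).
Proof.
move=> jN; have ab := angle_bounds jN; have N0 : N%:R != 0 :> R by rewrite pnatr_eq0; lia.
have := sin_cheb N (j%:R * pi / N%:R); rewrite [N%:R * _]mulrC mulfVK // sin_natpi => /eqP.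
by rewrite mulf_eq0 gt_eqF // sin_gt0_pi.
Qed.

Lemma cheb_root_inj N i j : (0 < i < N)%N -> (0 < j < N)%N ->
  cheb_root N i = cheb_root N j -> i = j.
Proof.
move=> iN jN; have N0 : N%:R != 0 :> R by rewrite pnatr_eq0; lia.
have /andP[i0 i1] := angle_bounds iN; have /andP[j0 j1] := angle_bounds jN.
move=> /mulfI e; have {}e := e _.
have /cos_inj : cos (i%:R * pi / N%:R) = cos (j%:R * pi / N%:R) :> R by apply: e; rewrite pnatr_eq0.
rewrite !in_itv /= !ltW // => /(_ isT isT) /(mulIf (invr_neq0 N0)).
by move=> /(mulIf (lt0r_neq0 (pi_gt0 R))) /eqP; rewrite eqr_nat => /eqP.
Qed.

Lemma cheb_root_refl N j : (j <= N)%N -> (0 < N)%N -> cheb_root N (N - j) = - cheb_root N j.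
Proof.
move=> jN N0; have N0' : N%:R != 0 :> R by rewrite pnatr_eq0; lia.
rewrite /cheb_root natrB // mulrBl mulrBl mulrAC mulfV // mul1r.
by rewrite addrC cosDpi cosN mulrN.
Qed.

Lemma cheb_root_neq0 N j : (0 < j < N)%N -> (2 * j != N)%N -> cheb_root N j != 0.
Proof.
move=> jN n2; apply: contra n2 => /eqP e.
have jleN : (j <= N)%N by lia.
have N0 : (0 < N)%N by lia.
have Nj : (0 < N - j < N)%N by lia.
have h := cheb_root_refl jleN N0; rewrite e oppr0 -e in h.
by have := cheb_root_inj Nj jN h; lia.
Qed.

Lemma cheb_root_le2 N j : `|cheb_root N j| <= 2.
Proof.
rewrite normrM ger0_norm // -[leRHS]mulr1 ler_pM2l // ler_norml.
by rewrite cos_geN1 cos_le1.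
Qed.

(** The [N.-1] distinct roots exhaust the degree, so each is simple. *)
Lemma cheb_factor N j : (0 < j < N)%N ->
  exists2 S : {poly R}, cheb R N = ('X - (cheb_root N j)%:P) * S & S.[cheb_root N j] != 0.
Proof.
move=> jN; case: N jN => [|N] jN; first by lia.
pose rs := [seq cheb_root N.+1 i | i <- iota 1 N].
have mi i : i \in iota 1 N -> (0 < i < N.+1)%N by rewrite mem_iota add1n.
have urs : uniq rs.
  rewrite map_inj_in_uniq ?iota_uniq // => i i' /mi hi /mi hi'; exact: cheb_root_inj.
have [sz mon] := size_lead_cheb N.
have chebE : cheb R N.+1 = map_poly intr (cheb int N.+1) by rewrite map_cheb.
have e : cheb R N.+1 = \prod_(z <- rs) ('X - z%:P).
  have := @all_roots_prod_XsubC R (cheb R N.+1) rs; rewrite uniq_rootsE urs.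
  have -> : lead_coef (cheb R N.+1) = 1.
    by rewrite chebE lead_coef_map_eq (monicP mon) ?rmorph1 ?oner_neq0.
  rewrite scale1r; apply=> //.
    by rewrite chebE size_map_poly_id0 ?sz ?(monicP mon) ?rmorph1 ?oner_neq0 // size_map size_iota.
  by apply/allP => z /mapP[i /mi hi ->]; exact: root_cheb_root.
have jrs : cheb_root N.+1 j \in rs by apply: map_f; rewrite mem_iota add1n.
exists (\prod_(z <- rem (cheb_root N.+1 j) rs) ('X - z%:P)).
  by rewrite e (big_rem _ jrs).
by rewrite -/(root _ _) root_prod_XsubC mem_rem_uniqF.
Qed.

End Chebyshev.

Section RationalRoot.
Variable R : realType.

(** A rational root of a monic polynomial with integer coefficients is an integer. *)
Lemma cheb_rat_root N (x : rat) : root (cheb R N.+1) (ratr x) -> x \is a Num.int.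
Proof.
rewrite -(map_cheb (@ratr R)) /root horner_map fmorph_eq0 => /eqP e.
have rC : root (map_poly intr (cheb int N.+1)) (ratr x : algC).
  by rewrite map_cheb -(map_cheb (@ratr algC)) /root horner_map e rmorph0.
have [_ mon] := size_lead_cheb N.
have : (ratr x : algC) \in Aint.
  apply: (@root_monic_Aint (map_poly intr (cheb int N.+1))) => //.
    by rewrite monicE lead_coef_map_eq (monicP mon) ?rmorph1 ?oner_neq0.
  by apply/polyOverP => i; rewrite coef_map /= rpred_int.
move=> /(Cint_rat_Aint (Crat_rat x)) /intrP[z ez].
apply/intrP; exists z; apply: (fmorph_inj (@ratr algC)).
by rewrite /= ez rmorph_int.
Qed.

(** The right-hand side lies strictly between 1 and 2, hence is not an integer. *)
Lemma cheb_root_neq_rat N j M : (0 < j < N)%N -> (2 < M)%N ->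
  cheb_root R N j != 2 * M%:R / M.+2%:R.
Proof.
move=> jN M2; apply/eqP => e.
have := root_cheb_root R jN; case: N jN e => [|N] jN e; first by lia.
have -> : cheb_root R N.+1 j = ratr (2 * M%:R / M.+2%:R).
  by rewrite e rmorphM fmorphV rmorphM /= !rmorph_nat.
move=> /cheb_rat_root /intrP[z ez].
have M0 : M.+2%:R != 0 :> rat by rewrite pnatr_eq0.
have : 2 * M%:R = z%:~R * M.+2%:R :> rat by rewrite -ez mulfVK.
rewrite -!natrM !pmulrn -intrM => /intr_inj ez'.
have [z1 | z2] : (z <= 1 \/ 2 <= z)%R by lia.
  by nia.
by nia.
Qed.
End RationalRoot.

(** * Rescaling the characteristic polynomial *)

Section Asymptotics.
Variable R : realType.

Section Scaling.
Variables (r v : nat -> R) (m : nat).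

(** With t^2 = q^-k the numbers v stay bounded, and at mu = t z the recursion
    tends to the one of [cheb] when t goes to 0. *)
Lemma shoot_scaling (t z : R) :
  (forall i, (i.+1 < m.+1)%N -> t ^+ 2 * (r i)^-1 = v i) -> forall i, (i <= m.+1)%N ->
  (shoot r i).[t * z] * t ^+ i =
  t * recur (fun i => z * v i + 2 * t + t ^+ 2 * z) (fun i => (1 + t * z) ^+ 2 * v i) i.
Proof.
move=> rv; apply: cheb_ind2 => [_|_|i IH1 IH2 lei].
- by rewrite shoot0 recur0 horner0 mul0r mulr0.
- by rewrite shoot1 recur1 hornerC mul1r mulr1.
rewrite horner_shootSS recurSS -(rv i) //.
transitivity (t * (2 + t * z + t * z * (r i)^-1) * ((shoot r i.+1).[t * z] * t ^+ i.+1) -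
  (1 + t * z) ^+ 2 * (r i)^-1 * t ^+ 2 * ((shoot r i).[t * z] * t ^+ i)).
  by rewrite !exprS; ring.
by rewrite (IH1 (ltnW (ltnW lei))) (IH2 (ltnW lei)); ring.
Qed.

Lemma char_shoot_scaling (t z : R) :
  (forall i, (i < m)%N -> t ^+ 2 * (r i)^-1 = v i) ->
  (char_shoot r m.+1).[t * z] * t ^+ m =
  t * recur (fun i => if (i < m)%N then z * v i + 2 * t + t ^+ 2 * z else z)
      (fun i => if (i < m)%N then (1 + t * z) ^+ 2 * v i else (1 + t * z) ^+ 2) m.+2.
Proof.
move=> rv; rewrite horner_char_shoot recurSS ltnn.
have e := @eq_recur R (fun i => if (i < m)%N then z * v i + 2 * t + t ^+ 2 * z else z)
      (fun i => if (i < m)%N then (1 + t * z) ^+ 2 * v i else (1 + t * z) ^+ 2)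
   (fun i => z * v i + 2 * t + t ^+ 2 * z) (fun i => (1 + t * z) ^+ 2 * v i) m.+1.
rewrite !e //; try by move=> i; rewrite ltnS => ->.
rewrite mulrBr ![t * (_ * _)]mulrCA -!shoot_scaling //.
by rewrite [t ^+ m.+1]exprS; ring.
Qed.

(** In the finer scaling T = q^-k the terms of odd and of even index have different
    orders of magnitude; normalizing them leaves a factor T in every other step. *)
Definition alt (T : R) (i : nat) : R := if odd i then T else 1.

(** The exponent [uphalf i] counts the steps that contribute a factor T. *)
Lemma shoot_scaling2 (T z : R) :
  (forall i, (i.+1 < m.+1)%N -> T * (r i)^-1 = v i) -> forall i, (i <= m.+1)%N ->
  (shoot r i).[T * z] * T ^+ uphalf i =
  T * recur (fun i => alt T i * (2 + T * z + z * v i)) (fun i => (1 + T * z) ^+ 2 * v i) i.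
Proof.
move=> rv; apply: cheb_ind2 => [_|_|i IH1 IH2 lei].
- by rewrite shoot0 recur0 horner0 mul0r mulr0.
- by rewrite shoot1 recur1 hornerC mul1r mulr1.
rewrite horner_shootSS recurSS -(rv i) //.
have e : T ^+ uphalf i.+2 = alt T i * T ^+ uphalf i.+1.
  by rewrite /alt !uphalfE /= !(uphalf_half, halfD) /=; case: odd; rewrite ?mul1r ?add0n ?add1n ?exprS.
transitivity (alt T i * (2 + T * z + z * (T * (r i)^-1)) * ((shoot r i.+1).[T * z] * T ^+ uphalf i.+1) -
  (1 + T * z) ^+ 2 * (r i)^-1 * T * ((shoot r i).[T * z] * T ^+ uphalf i)).
  have e' : T ^+ uphalf i.+2 = T * T ^+ uphalf i by rewrite -exprS.
  by rewrite mulrBl {1}e [X in _ - X * _]mulrAC e'; ring.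
by rewrite (IH1 (ltnW (ltnW lei))) (IH2 (ltnW lei)); ring.
Qed.

Lemma char_shoot_scaling2 (T z : R) : T != 0 -> ~~ odd m ->
  (forall i, (i < m)%N -> T * (r i)^-1 = v i) ->
  (char_shoot r m.+1).[T * z] * T ^+ m./2 =
  T * recur (fun i => if (i < m)%N then alt T i * (2 + T * z + z * v i) else z)
      (fun i => if (i < m)%N then (1 + T * z) ^+ 2 * v i else (1 + T * z) ^+ 2) m.+2.
Proof.
move=> T0 om rv; rewrite horner_char_shoot recurSS ltnn.
have e := @eq_recur R (fun i => if (i < m)%N then alt T i * (2 + T * z + z * v i) else z)
      (fun i => if (i < m)%N then (1 + T * z) ^+ 2 * v i else (1 + T * z) ^+ 2)
   (fun i => alt T i * (2 + T * z + z * v i)) (fun i => (1 + T * z) ^+ 2 * v i) m.+1.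
rewrite !e //; try by move=> i; rewrite ltnS => ->.
rewrite mulrBr ![T * (_ * _)]mulrCA -!shoot_scaling2 //.
have -> : uphalf m.+1 = m./2.+1 by rewrite uphalfE.
have -> : uphalf m = m./2 by rewrite uphalf_half (negPf om).
by rewrite [T ^+ _.+1]exprS; ring.
Qed.

(** The limiting recursion at T = 0 and v = 1. *)
Lemma recur_limit2 (z : R) l :
  recur (fun i => alt 0 i * (2 + z)) (fun=> 1) l.*2.+1 = (-1) ^+ l /\
  recur (fun i => alt 0 i * (2 + z)) (fun=> 1) l.*2.+2 = (-1) ^+ l * (l.+1%:R * (2 + z)).
Proof.
elim: l => [|l [IH1 IH2]].
  by rewrite recur1 recurSS recur1 recur0 /alt /= expr0; split=> //; ring.
have e : recur (fun i => alt 0 i * (2 + z)) (fun=> 1) l.+1.*2.+1 = (-1) ^+ l.+1.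
  by rewrite doubleS recurSS IH1 IH2 /alt /= odd_double /= exprS; ring.
split=> //; rewrite [LHS]recurSS e {1}/alt odd_double /= doubleS IH2 exprS.
by rewrite -[l.+2]addn1 natrD; ring.
Qed.

End Scaling.
End Asymptotics.

(** * Roots of the characteristic polynomial for large q *)

Section Ratios.
Variable R : realType.

(** The factors [step] of the degree k, numbered from 0. *)
Definition ratio (q k n i : nat) : R :=
  (q ^ k * qnat q i.+1 * qnat q (n - 2 * k - i))%N%:R /
  (qnat q (k + i).+1 * qnat q (n - k - i))%N%:R.

Variables (q k n : nat).
Hypotheses (q_gt1 : (1 < q)%N) (k_gt0 : (0 < k)%N).
Local Notation x := (q%:R : R).

(** The ratio is q^-k up to two such factors, see [ratioV], and each of them is
    1 + O(1/q). *)
Definition excess (a : nat) : R := (x ^+ k * x ^+ a - 1) / (x ^+ k * (x ^+ a - 1)).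

Let x2 : 2 <= x. Proof. by rewrite (ler_nat R 2). Qed.

Let qnat_real g : (qnat q g)%:R = (x ^+ g - 1) / (x - 1) :> R.
Proof.
rewrite -qnat_geom 1?ltnW // mulrAC mulfV ?mul1r // subr_eq0 (eqr_nat R _ 1).
by rewrite gtn_eqF.
Qed.

Let pow_ge a : (0 < a)%N -> x <= x ^+ a.
Proof. by move=> a0; have hx := x2; rewrite -[leLHS]expr1 ler_weXn2l //; lra. Qed.

Lemma excess_bounds a : (0 < a)%N -> 1 <= excess a <= 1 + 2 / x.
Proof.
move=> a0; have := pow_ge a0; have := pow_ge k_gt0; rewrite /excess.
move: (x ^+ k) (x ^+ a) => Q A hQ hA; have hx := x2.
have x0 : 0 < x by lra. have A1 : 0 < A - 1 by lra. have Q0 : 0 < Q by lra.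
have QA : 0 < Q * (A - 1) by rewrite mulr_gt0.
rewrite ler_pdivlMr // ler_pdivrMr // mul1r; apply/andP; split; first by lra.
have -> : (1 + 2 / x) * (Q * (A - 1)) = Q * (A - 1) + Q * (2 * (A - 1) / x) by ring.
have : 1 <= 2 * (A - 1) / x by rewrite ler_pdivlMr //; lra.
move=> /(ler_wpM2l (ltW Q0)); lra.
Qed.

Lemma ratioV i : (i < n - 2 * k)%N ->
  (ratio q k n i)^-1 = x ^+ k * (excess i.+1 * excess (n - 2 * k - i)).
Proof.
move=> lt; rewrite /ratio !natrM !qnat_real natrX.
rewrite (_ : (k + i).+1 = k + i.+1)%N; last by lia.
rewrite (_ : n - k - i = k + (n - 2 * k - i))%N; last by lia.
have hi : (0 < i.+1)%N by []. have hj : (0 < n - 2 * k - i)%N by lia.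
have := pow_ge hi; have := pow_ge hj; have := pow_ge k_gt0; rewrite /excess !exprD; have hx := x2.
move: (x ^+ k) (x ^+ i.+1) (x ^+ (n - 2 * k - i)) => Q A B hQ hB hA.
have QA : A <= Q * A by rewrite ler_peMl //; lra.
have QB : B <= Q * B by rewrite ler_peMl //; lra.
by field; rewrite !gt_eqF //; lra.
Qed.

Lemma ratio_bounds i : (i < n - 2 * k)%N -> 0 < ratio q k n i < 1.
Proof.
move=> lt; rewrite -[ratio _ _ _ _]invrK ratioV //.
have hj : (0 < n - 2 * k - i)%N by lia.
have /andP[e1 _] := excess_bounds (ltn0Sn i); have /andP[e2 _] := excess_bounds hj.
have Q := pow_ge k_gt0; have hx := x2.
have ee : 1 <= excess i.+1 * excess (n - 2 * k - i) by rewrite -[leLHS]mulr1 ler_pM.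
have h : 1 < x ^+ k * (excess i.+1 * excess (n - 2 * k - i)).
  by apply: (@lt_le_trans _ _ (x ^+ k)); rewrite ?ler_peMr //; lra.
by rewrite invr_gt0 invf_lt1 ?h ?(lt_trans ltr01 h).
Qed.

Lemma ratio_close i : (i < n - 2 * k)%N ->
  1 <= excess i.+1 * excess (n - 2 * k - i) <= 1 + 8 / x.
Proof.
move=> lt; have hj : (0 < n - 2 * k - i)%N by lia.
have /andP[e1 e1'] := excess_bounds (ltn0Sn i); have /andP[e2 e2'] := excess_bounds hj.
have hx := x2; have x0 : 0 < x by lra.
apply/andP; split; first by rewrite -[leLHS]mulr1 ler_pM.
have : excess i.+1 * excess (n - 2 * k - i) <= (1 + 2 / x) * (1 + 2 / x).
  by apply: ler_pM => //; lra.
have : 2 / x <= 1 by rewrite ler_pdivrMr //; lra.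
have : 0 < 2 / x by apply: divr_gt0.
have -> : 8 / x = 4 * (2 / x) by ring.
by move: (2 / x) => y; nra.
Qed.

End Ratios.

Section Existence.
Variable R : realType.

Lemma normM_le (x y a b : R) : `|x| <= a -> `|y| <= b -> `|x * y| <= a * b.
Proof. by move=> hx hy; rewrite normrM ler_pM. Qed.

Lemma sqr_close (c y : R) : 0 <= c <= 1 -> `|y| <= 3 * c ->
  `|(1 + y) ^+ 2| <= 16 /\ `|(1 + y) ^+ 2 - 1| <= 15 * c.
Proof.
rewrite ler_norml => /andP[c0 c1] /andP[y1 y2].
by rewrite !ler_norml; split; apply/andP; split; nra.
Qed.

Lemma sqr_mul_close (c y w : R) : 0 <= c <= 1 -> `|y| <= 3 * c -> 1 <= w <= 1 + 8 * c ->
  `|(1 + y) ^+ 2 * w| <= 144 /\ `|(1 + y) ^+ 2 * w - 1| <= 143 * c.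
Proof.
move=> hc hy /andP[w1 w2]; have [h1 h2] := sqr_close hc hy; move/andP: hc => [c0 c1].
split.
  by rewrite (le_trans (normM_le h1 (_ : `|w| <= 9))) ?ler_norml; lra.
have -> : (1 + y) ^+ 2 * w - 1 = (1 + y) ^+ 2 * (w - 1) + ((1 + y) ^+ 2 - 1) by ring.
apply: le_trans (ler_normD _ _) _.
have : `|(1 + y) ^+ 2 * (w - 1)| <= 16 * (8 * c).
  by apply: normM_le => //; rewrite ler_norml; lra.
lra.
Qed.

Let c200 m : (m <= 200)%N -> m%:R <= 200 :> R.
Proof. by rewrite ler_nat. Qed.

(** At mu = t z with t = s^k, the rescaled polynomial differs from the
    Chebyshev polynomial of index n - 2k + 2 by terms of order t, from the
    recursion, and s^2 = 1/q, from the ratios; this is where the exponent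
    min(k, 2) comes from. Its roots are simple, so [root_near] applies. *)
Lemma root_near_cheb (n k j : nat) : (0 < k)%N -> (2 * k < n)%N -> (0 < j < n - 2 * k + 2)%N ->
  exists C e0 : R, [/\ 0 < C, 0 < e0 &
  forall (q : nat) (s : R), (1 < q)%N -> 0 < s -> s ^+ 2 = q%:R^-1 -> s <= e0 ->
   exists2 mu, root (char_shoot (ratio R q k n) (n - 2 * k).+1) mu &
     `|mu - cheb_root R (n - 2 * k + 2) j * s ^+ k| <= C * s ^+ (k + minn k 2)].
Proof.
move=> k0 kn jN; set M := (n - 2 * k)%N in jN *; set z0 := cheb_root _ _ _.
have [K K0 hK] := recur_perturb (200 : R) M.+2.
have [S Se S0] := cheb_factor R jN.
have [C [e1 [C0 e10 hroot]]] := root_near S0 (ltW K0).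
exists C, (Num.min e1 1); split=> //; first by rewrite lt_min e10 ltr01.
move=> q s q1 s0 sq; rewrite le_min => /andP[se1 s1].
pose t := s ^+ k; pose eps := s ^+ minn k 2.
have t0 : 0 < t by rewrite exprn_gt0.
have eps0 : 0 < eps by rewrite exprn_gt0.
have m12 : (0 < minn k 2)%N by rewrite leq_min k0.
have epss : eps <= s by rewrite -[leRHS]expr1 ler_wiXn2l ?(ltW s0).
have eps1 : eps <= 1 by apply: le_trans s1.
have teps : t <= eps by rewrite ler_wiXn2l ?(ltW s0) // geq_minl.
have s2eps : s ^+ 2 <= eps by rewrite ler_wiXn2l ?(ltW s0) // geq_minr.
pose v i := excess R q k i.+1 * excess R q k (M - i).
have vb i : (i < M)%N -> 1 <= v i <= 1 + 8 * eps.
  move=> iM; have /andP[-> h] := ratio_close R q1 k0 iM.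
  by apply: le_trans h _; rewrite -sq lerD2l ler_wpM2l.
have tQ : t ^+ 2 * q%:R ^+ k = 1.
  by rewrite /t -exprM mulnC exprM sq exprVn mulVf // expf_neq0 // pnatr_eq0 -lt0n ltnW.
have rv i : (i < M)%N -> t ^+ 2 * (ratio R q k n i)^-1 = v i.
  by move=> iM; rewrite ratioV // mulrA tQ mul1r.
pose G : {poly R} := (t ^+ M / t) *: (char_shoot (ratio R q k n) M.+1 \Po (t *: 'X)).
have GE z : G.[z] = recur (fun i => if (i < M)%N then z * v i + 2 * t + t ^+ 2 * z else z)
      (fun i => if (i < M)%N then (1 + t * z) ^+ 2 * v i else (1 + t * z) ^+ 2) M.+2.
  rewrite hornerZ horner_comp hornerZ hornerX mulrAC [t ^+ M * _]mulrC (char_shoot_scaling _ rv).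
  by rewrite mulrAC mulfV ?mul1r ?gt_eqF.
have [|x z1|x rx hx] := hroot eps G eps0; first exact: le_trans se1.
  have -> : (x - z0) * S.[x] = recur (fun=> x) (fun=> 1) M.+2.
    by rewrite -horner_cheb -[M.+2]addn2 Se !hornerE.
  have x3 : `|x| <= 3.
    rewrite -[x](subrK z0) (le_trans (ler_normD _ _)) //.
    have := cheb_root_le2 R (M + 2) j; rewrite -/z0; lra.
  have tx : `|t * x| <= 3 * eps.
    by rewrite mulrC normM_le // ger0_norm // ltW.
  have epsb : 0 <= eps <= 1 by rewrite eps1 ltW.
  have t2x : `|t ^+ 2 * x| <= 3 * eps.
    have : `|t| <= 1 by rewrite (ger0_norm (ltW t0)) (le_trans teps).
    by move=> h; rewrite expr2 -mulrA -[leRHS]mul1r normM_le.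
  have [sq1 sq2] := sqr_close epsb tx.
  have t2 : `|2 * t| = 2 * t by rewrite ger0_norm // mulr_ge0 // ltW.
  (* The last step of the recursion encodes the definition of char_shoot. The
     constant 200 bounds all coefficients, given |x| <= 3, |v| <= 9 and |1 + t x| <= 4. *)
  pose A i := if (i < M)%N then x * v i + 2 * t + t ^+ 2 * x else x.
  pose B i := if (i < M)%N then (1 + t * x) ^+ 2 * v i else (1 + t * x) ^+ 2.
  rewrite GE -/A -/B.
  suff [] : [/\ `|recur A B M.+2| <= K, `|recur (fun=> x) (fun=> 1) M.+2| <= K &
    `|recur A B M.+2 - recur (fun=> x) (fun=> 1) M.+2| <= K * eps] by [].
  apply: hK => //; [exact: ltW | move=> i | move=> i]; rewrite /A /B.
  - move=> _; case: ltnP => iM.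
      have [h1 h2] := sqr_mul_close epsb tx (vb i iM).
      have xv : `|x * v i| <= 3 * 9.
        by apply: normM_le => //; have := vb i iM; rewrite ler_norml; lra.
      rewrite normr1; split.
      - apply: le_trans (ler_normD _ _) _; have := ler_normD (x * v i) (2 * t).
        by rewrite t2; lra.
      - exact: le_trans h1 (@c200 144%N isT).
      - exact: le_trans x3 (@c200 3%N isT).
      - exact: (@c200 1%N isT).
    rewrite normr1; split.
    - exact: le_trans x3 (@c200 3%N isT).
    - exact: le_trans sq1 (@c200 16%N isT).
    - exact: le_trans x3 (@c200 3%N isT).
    - exact: (@c200 1%N isT).
  - move=> _; case: ltnP => iM.
      have [h1 h2] := sqr_mul_close epsb tx (vb i iM); split; last by lra.
      have -> : x * v i + 2 * t + t ^+ 2 * x - x = x * (v i - 1) + 2 * t + t ^+ 2 * x by ring.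
      have xv : `|x * (v i - 1)| <= 3 * (8 * eps).
        by apply: normM_le => //; have := vb i iM; rewrite ler_norml; lra.
      apply: le_trans (ler_normD _ _) _; have := ler_normD (x * (v i - 1)) (2 * t).
      by rewrite t2; lra.
    by rewrite subrr normr0; split; [rewrite mulr_ge0 // ltW | lra].
exists (t * x).
  have c0 : t ^+ M / t != 0 by rewrite mulf_neq0 ?invr_neq0 ?expf_neq0 // gt_eqF.
  by move: rx; rewrite /root hornerZ horner_comp hornerZ hornerX mulf_eq0 (negPf c0).
have -> : t * x - z0 * s ^+ k = t * (x - z0) by rewrite -/t; ring.
rewrite normrM gtr0_norm // exprD mulrCA ler_pM2l //.
Qed.

(** For n even 0 is a root of the Chebyshev polynomial, which only shows that some
    root mu is small. At the finer scale mu = T z with T = s^(2k), the limit is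
    an affine function of z, whose root gives the leading term. *)
Lemma root_near_tilde (n k : nat) : (0 < k)%N -> (2 * k < n)%N -> ~~ odd n ->
  exists C e0 : R, [/\ 0 < C, 0 < e0 &
  forall (q : nat) (s : R), (1 < q)%N -> 0 < s -> s ^+ 2 = q%:R^-1 -> s <= e0 ->
   exists2 mu, root (char_shoot (ratio R q k n) (n - 2 * k).+1) mu &
     `|mu + 2 * (n - 2 * k)%:R / (n - 2 * k).+2%:R * s ^+ (2 * k)| <= C * s ^+ (2 * k + 2)].
Proof.
move=> k0 kn on; set M := (n - 2 * k)%N.
have oM : ~~ odd M by rewrite /M oddB ?(ltnW kn) // oddM /= addbF.
pose l := M./2; have Ml : M = l.*2 by rewrite -[LHS]odd_double_half (negPf oM).
have l0 : (0 < l)%N by lia.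
set kap := 2 * M%:R / M.+2%:R.
have kapE : kap = 2 * l%:R / l.+1%:R.
  rewrite /kap Ml -doubleS -!muln2 !natrM; field.
  by rewrite addrC natr1 pnatr_eq0.
have kap2 : `|kap| <= 2.
  have l1 : 0 < l.+1%:R :> R by rewrite ltr0n.
  rewrite kapE ger0_norm ?divr_ge0 ?mulr_ge0 ?ler0n // ler_pdivrMr //.
  by rewrite ler_pM2l // ler_nat.
have [K K0 hK] := recur_perturb (200 : R) M.+2.
pose S : {poly R} := ((-1) ^+ l * l.+1%:R)%:P.
have S0 : S.[- kap] != 0 by rewrite hornerC mulf_neq0 ?signr_eq0 // pnatr_eq0.
have [C [e1 [C0 e10 hroot]]] := root_near S0 (ltW K0).
exists C, (Num.min e1 1); split=> //; first by rewrite lt_min e10 ltr01.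
move=> q s q1 s0 sq; rewrite le_min => /andP[se1 s1].
pose T := s ^+ (2 * k); pose eps := s ^+ 2.
have T0 : 0 < T by rewrite exprn_gt0.
have eps0 : 0 < eps by rewrite exprn_gt0.
have epss : eps <= s by rewrite -[leRHS]expr1 ler_wiXn2l ?(ltW s0).
have eps1 : eps <= 1 by apply: le_trans s1.
have k2 : (2 <= 2 * k)%N by rewrite -[X in (X <= _)%N]muln1 leq_mul.
have Teps : T <= eps by rewrite ler_wiXn2l ?(ltW s0).
pose v i := excess R q k i.+1 * excess R q k (M - i).
have vb i : (i < M)%N -> 1 <= v i <= 1 + 8 * eps.
  by move=> iM; have := ratio_close R q1 k0 iM; rewrite -sq.
have TQ : T * q%:R ^+ k = 1.
  by rewrite /T exprM sq exprVn mulVf // expf_neq0 // pnatr_eq0 -lt0n ltnW.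
have rv i : (i < M)%N -> T * (ratio R q k n i)^-1 = v i.
  by move=> iM; rewrite ratioV // mulrA TQ mul1r.
pose G : {poly R} := (T ^+ M./2 / T) *: (char_shoot (ratio R q k n) M.+1 \Po (T *: 'X)).
have GE z : G.[z] = recur (fun i => if (i < M)%N then alt T i * (2 + T * z + z * v i) else z)
      (fun i => if (i < M)%N then (1 + T * z) ^+ 2 * v i else (1 + T * z) ^+ 2) M.+2.
  rewrite hornerZ horner_comp hornerZ hornerX mulrAC [T ^+ M./2 * _]mulrC.
  rewrite (char_shoot_scaling2 _ _ oM rv) ?gt_eqF //.
  by rewrite mulrAC mulfV ?mul1r ?gt_eqF.
have [|x z1|x rx hx] := hroot eps G eps0; first exact: le_trans se1.
  have -> : (x - - kap) * S.[x] =
      recur (fun i => if (i < M)%N then alt 0 i * (2 + x) else x) (fun=> 1) M.+2.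
    have e := @eq_recur R (fun i => if (i < M)%N then alt 0 i * (2 + x) else x) (fun=> 1)
      (fun i => alt 0 i * (2 + x)) (fun=> 1) M.+1.
    rewrite recurSS ltnn !e //; try by move=> i; rewrite ltnS => ->.
    rewrite Ml; have [-> _] := recur_limit2 x l.
    have := recur_limit2 x l.-1; rewrite -doubleS prednK // => -[_ ->].
    have -> : (-1) ^+ l = - (-1) ^+ l.-1 :> R by rewrite -[in LHS](prednK l0) exprS mulN1r.
    rewrite hornerC kapE; have -> : (-1) ^+ l = - (-1) ^+ l.-1 :> R.
      by rewrite -[in LHS](prednK l0) exprS mulN1r.
    by field; rewrite addrC natr1 pnatr_eq0.
  have x3 : `|x| <= 3.
    by have := z1; have := ler_normB (x + kap) kap; rewrite opprK addrK; lra.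
  have Tx : `|T * x| <= 3 * eps.
    by rewrite mulrC normM_le // ger0_norm // ltW.
  have epsb : 0 <= eps <= 1 by rewrite eps1 ltW.
  have [sq1 sq2] := sqr_close epsb Tx.
  have a0 i : `|alt 0 i : R| <= 1 by rewrite /alt; case: odd; rewrite ?normr0 ?normr1.
  have aT i : `|alt T i| <= 1.
    by rewrite /alt; case: odd; rewrite ?normr1 // (ger0_norm (ltW T0)) (le_trans Teps).
  have ad i : `|alt T i - alt 0 i| <= eps.
    by rewrite /alt; case: odd; rewrite ?subr0 ?(ger0_norm (ltW T0)) // subrr normr0 ltW.
  pose A i := if (i < M)%N then alt T i * (2 + T * x + x * v i) else x.
  pose B i := if (i < M)%N then (1 + T * x) ^+ 2 * v i else (1 + T * x) ^+ 2.
  pose A' i := if (i < M)%N then alt 0 i * (2 + x) else x.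
  rewrite GE -/A -/B -/A'.
  suff [] : [/\ `|recur A B M.+2| <= K, `|recur A' (fun=> 1) M.+2| <= K &
    `|recur A B M.+2 - recur A' (fun=> 1) M.+2| <= K * eps] by [].
  apply: hK => //; [exact: ltW | move=> i | move=> i]; rewrite /A /B /A'.
  - move=> _; case: ltnP => iM; last first.
      rewrite normr1; split.
      - exact: le_trans x3 (@c200 3%N isT).
      - exact: le_trans sq1 (@c200 16%N isT).
      - exact: le_trans x3 (@c200 3%N isT).
      - exact: (@c200 1%N isT).
    have [h1 h2] := sqr_mul_close epsb Tx (vb i iM).
    have xv : `|x * v i| <= 3 * 9.
      by apply: normM_le => //; have := vb i iM; rewrite ler_norml; lra.
    have b1 : `|2 + T * x + x * v i| <= 200.
      apply: le_trans (ler_normD _ _) _; have := ler_normD 2 (T * x).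
      by rewrite (ger0_norm (ler0n R 2)); lra.
    have b2 : `|2 + x| <= 200.
      by apply: le_trans (ler_normD _ _) _; rewrite (ger0_norm (ler0n R 2)); lra.
    rewrite normr1; split.
    - by rewrite -[leRHS]mul1r normM_le.
    - exact: le_trans h1 (@c200 144%N isT).
    - by rewrite -[leRHS]mul1r normM_le.
    - exact: (@c200 1%N isT).
  - move=> _; case: ltnP => iM; last first.
      by rewrite subrr normr0; split; [rewrite mulr_ge0 // ltW | lra].
    have [h1 h2] := sqr_mul_close epsb Tx (vb i iM); split; last by lra.
    have -> : alt T i * (2 + T * x + x * v i) - alt 0 i * (2 + x) =
      alt T i * (T * x + x * (v i - 1)) + (alt T i - alt 0 i) * (2 + x) by ring.
    have xv : `|x * (v i - 1)| <= 3 * (8 * eps).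
      by apply: normM_le => //; have := vb i iM; rewrite ler_norml; lra.
    have b2 : `|2 + x| <= 5.
      by apply: le_trans (ler_normD _ _) _; rewrite (ger0_norm (ler0n R 2)); lra.
    apply: le_trans (ler_normD _ _) _.
    have := normM_le (ad i) b2.
    have : `|alt T i * (T * x + x * (v i - 1))| <= 1 * (27 * eps).
      apply: normM_le => //; apply: le_trans (ler_normD _ _) _; lra.
    by lra.
exists (T * x).
  have c0 : T ^+ M./2 / T != 0 by rewrite mulf_neq0 ?invr_neq0 ?expf_neq0 // gt_eqF.
  by move: rx; rewrite /root hornerZ horner_comp hornerZ hornerX mulf_eq0 (negPf c0).
have -> : T * x + kap * s ^+ (2 * k) = T * (x - - kap) by rewrite -/T; ring.
by rewrite normrM gtr0_norm // exprD mulrCA ler_pM2l.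
Qed.

End Existence.

(** * Exact non-vanishing criteria *)

Section Exact.
Variables (R : realFieldType) (r : nat -> R) (m : nat).

(** Every row of the matrix but the last has a sum strictly smaller than m, and the
    last has sum m. So an entry of maximal absolute value can only be the last one,
    and then the last equation gives a contradiction. *)
Lemma chain_solution_large mu y :
  (forall i, (i < m)%N -> 0 < r i < 1) ->
  m%:R <= mu -> 0 < mu -> chain_solution r m.+1 mu y ->
  forall i, (i < m.+1)%N -> y i = 0.
Proof.
move=> rb le mu0 sol.
have Pb i j : (i <= j)%N -> (j <= m)%N ->
    0 <= \prod_(i <= l < j) r l <= 1 /\ ((i < j)%N -> \prod_(i <= l < j) r l < 1).
  elim: j => [|j IH] ij jm.
    by rewrite big_geq // ltn0 ler01 lexx.
  case: (leqP i j) => [lij|lt]; last first.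
    have -> : i = j.+1 by apply/eqP; rewrite eqn_leq ij.
    by rewrite big_geq // ltnn ler01 lexx.
  have [/andP[p0 p1] _] := IH lij (ltnW jm); have /andP[r0 r1] := rb j jm.
  rewrite big_nat_recr //=; set p := \prod_(_ <= _ < _) _ in p0 p1 *.
  have h : p * r j < 1 by apply: le_lt_trans r1; rewrite ler_piMl // ltW.
  by split=> //; rewrite (ltW h) mulr_ge0 // ltW.
pose M := \big[Num.max/0]_(i < m.+1) `|y i|.
have yM i : (i < m.+1)%N -> `|y i| <= M.
  by move=> im; rewrite /M; apply: (le_bigmax _ (fun i : 'I_m.+1 => `|y i|) (Ordinal im)).
have M0 : 0 <= M by apply: le_trans (yM 0%N isT); exact: normr_ge0.
have [e|Mn0] := eqVneq M 0.
  by move=> i /yM; rewrite e normr_le0 => /eqP.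
have Mgt0 : 0 < M by rewrite lt_neqAle eq_sym Mn0.
have bound i : (i < m.+1)%N -> mu * `|y i| <=
    \sum_(0 <= j < i) `|y j| + \sum_(i.+1 <= j < m.+1) (\prod_(i <= l < j) r l) * `|y j|.
  move=> im; rewrite -[mu]gtr0_norm // -normrM sol // (le_trans (ler_normD _ _)) // lerD //.
    exact: ler_norm_sum.
  apply: le_trans (ler_norm_sum _ _ _) _; rewrite [leLHS]big_nat_cond [leRHS]big_nat_cond.
  apply: ler_sum => j /andP[/andP[ij jm] _]; rewrite normrM ler_wpM2r // ger0_norm //.
  by have [/andP[]] := Pb i j (ltnW ij) jm.
have strict i : (i < m)%N -> `|y i| < M.
  move=> im; have im' : (i < m.+1)%N by apply: ltnW.
  rewrite lt_neqAle (yM i im') andbT; apply/eqP => e.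
  have := bound i im'; apply/negP; rewrite -ltNge e.
  apply: lt_le_trans (ler_wpM2r M0 le).
  have -> : m%:R * M = \sum_(0 <= j < i) M + \sum_(i.+1 <= j < m.+1) M.
    by rewrite !sumr_const_nat -mulrnDr mulr_natl; congr (_ *+ _); lia.
  apply: ler_ltD.
    rewrite [leLHS]big_nat_cond [leRHS]big_nat_cond.
    apply: ler_sum => j /andP[/andP[_ ji] _]; apply: yM; lia.
  apply: ltr_sum_nat => [|j /andP[ij jm]]; first by [].
  have [/andP[p0 _] /(_ ij) p1] := Pb i j (ltnW ij) jm.
  by apply: le_lt_trans (ler_wpM2l p0 (yM j jm)) _; rewrite gtr_pMl.
suff : `|y m| < M.
  move=> ltm; suff : M < M by rewrite ltxx.
  rewrite {1}/M; apply: bigmax_lt => // i _.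
  have := ltn_ord i; rewrite ltnS leq_eqVlt => /orP[/eqP->//|]; exact: strict.
have := bound m (ltnSn m); rewrite [X in _ + X]big_geq // addr0 => b.
have [m0|mgt0] := posnP m.
  move: b; rewrite {2}m0 big_geq // pmulr_rle0 // => h.
  by apply: le_lt_trans Mgt0.
have : mu * `|y m| < mu * M; last by rewrite ltr_pM2l.
apply: le_lt_trans b _; apply: lt_le_trans (ler_wpM2r M0 le).
have -> : m%:R * M = \sum_(0 <= j < m) M by rewrite sumr_const_nat subn0 mulr_natl.
by apply: ltr_sum_nat => // j /andP[_]; exact: strict.
Qed.

(** If all ratios are 1 modulo p, then the recursion at mu = 0 reads
    S (i + 2) = 2 S (i + 1) - S i modulo p, whence S m = m modulo p. The proof clears
    denominators to stay in the integers. *)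
Lemma shoot_mod_neq0 (num den : nat -> nat) (p : nat) : prime p ->
  (forall i, (i < m)%N -> (r i)^-1 = (num i)%:R / (den i)%:R) ->
  (forall i, (i < m)%N -> ~~ (p %| den i)%N) ->
  (forall i, (i < m)%N -> num i = den i %[mod p]) ->
  ~~ (p %| m)%N -> (shoot r m).[0] != 0.
Proof.
move=> pp rE pden cong pm.
pose D i := (\prod_(0 <= j < i.-1) den j)%N.
have pD i : (i.-1 <= m)%N -> ~~ (p %| D i)%N.
  rewrite /D; elim: (i.-1) => [|j IH] jm; first by rewrite big_geq // dvdn1 neq_ltn prime_gt1 ?orbT.
  by rewrite big_nat_recr //= Euclid_dvdM // negb_or IH ?pden // ltnW.
pose P i (z : int) := (D i)%:R * (shoot r i).[0] = z%:~R /\ (p %| z - (i * D i)%N%:Z)%Z.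
have den0 i : (i < m)%N -> (den i)%:R != 0 :> R.
  by move=> im; rewrite pnatr_eq0; apply: contraNneq (pden i im) => ->; rewrite dvdn0.
have h i : (i < m)%N -> (exists z, P i z) /\ (exists z, P i.+1 z).
  elim: i => [|i IH] im.
    split; [exists 0|exists 1]; rewrite /P /D /= big_geq // ?shoot0 ?shoot1 hornerC.
      by rewrite mulr0 mul0n subr0 dvdz0.
    by rewrite mulr1 muln1 subrr dvdz0.
  have [[a [Pa da]] [b [Pb db]]] := IH (ltnW im); split; first by exists b.
  have ltim : (i < m)%N := ltnW im.
  pose den' := if i is i'.+1 then den i' else 1%N.
  have DS : D i.+1 = (den' * D i)%N.
    rewrite /D /den'; case: (i) => [|i'] /=; first by rewrite big_geq // muln1.
    by rewrite big_nat_recr //= mulnC.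
  have DSS : D i.+2 = (den i * D i.+1)%N by rewrite /D /= big_nat_recr //= mulnC.
  exists (2 * (den i)%:Z * b - (num i)%:Z * den'%:Z * a); split.
    rewrite horner_shootSS rE // !(rmorphB, rmorphM) /= -Pa -Pb DSS DS !natrM.
    by field; exact: den0.
  have e : 2 * (den i)%:Z * b - (num i)%:Z * den'%:Z * a - (i.+2 * D i.+2)%N%:Z =
     2 * (den i)%:Z * (b - (i.+1 * D i.+1)%N%:Z) - (num i)%:Z * den'%:Z * (a - (i * D i)%N%:Z)
     - ((num i)%:Z - (den i)%:Z) * den'%:Z * (i * D i)%N%:Z.
    rewrite DSS DS !PoszM -[i.+2]addn2 -[i.+1]addn1 [(i + 2)%:Z]PoszD [(i + 1)%:Z]PoszD.
    by ring.
  rewrite e rpredB ?rpredB //; [exact: dvdz_mull|exact: dvdz_mull|].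
  apply: dvdz_mulr; apply: dvdz_mulr; rewrite -eqz_mod_dvd.
  by rewrite !modz_nat (cong i ltim).
have [z [Pz dz]] : exists z, P m z.
  case: (m) h pm => [|m'] h pm; first by rewrite dvdn0 in pm.
  by have [_] := h m' (ltnSn _).
apply/eqP => e; move: Pz; rewrite e mulr0 => /esym/eqP; rewrite intr_eq0 => /eqP z0.
move: dz; rewrite z0 sub0r dvdzE abszN !absz_nat Euclid_dvdM // (negPf pm) /=.
by apply/negP; apply: pD; rewrite leq_pred.
Qed.

End Exact.

(** * Primitive prime divisors *)

Section Bound.
Variables (q t : nat).
Hypotheses (q_gt1 : (1 < q)%N) (t_gt1 : (1 < t)%N).
Local Notation Phi := (Cyclotomic t).

Lemma norm_Cyclotomic (a : int) (z : algC) : t.-primitive_root z ->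
  `|Phi.[a]|%:~R = \prod_(k < t | coprime k t) `|a%:~R - z ^+ k| :> algC.
Proof.
move=> prim; rewrite intr_norm -horner_map /= (Cintr_Cyclotomic prim) /cyclotomic.
by rewrite horner_prod normr_prod; apply: eq_bigr => k _; rewrite hornerXsubC.
Qed.

Lemma prod_const_coprime (c : algC) :
  \prod_(k < t | coprime k t) c = c ^+ totient t.
Proof.
rewrite prodr_const; congr (_ ^+ _); rewrite totient_count_coprime big_mkord -sum1_card.
rewrite big_mkcond; apply: eq_bigr => i _; rewrite coprime_sym unfold_in.
by rewrite -[eqn _ _]/(coprime i t); case: coprime.
Qed.

Let norm_root z k : t.-primitive_root z -> `|z ^+ k| = 1 :> algC.
Proof.
move=> prim; rewrite normrX; suff -> : `|z| = 1 by rewrite expr1n.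
have t0 : (0 < t)%N by lia.
by apply/eqP; rewrite -(@pexpr_eq1 _ _ t) // -normrX prim_expr_order // normr1.
Qed.

Lemma Cyclotomic_lower_pow2 : (2 < q)%N -> (2 ^ totient t)%N%:Z <= `|Phi.[q%:Z]|.
Proof.
move=> q2; have [z prim] := C_prim_root_exists (ltnW t_gt1).
rewrite -(ler_int algC) (norm_Cyclotomic _ prim) -pmulrn natrX -prod_const_coprime.
apply: ler_prod => k _; rewrite ler0n /=.
apply: le_trans (lerB_dist _ _); rewrite norm_root // normr_nat lerBrDr.
have -> : 2 + 1 = 3%:R :> algC by ring.
by rewrite ler_nat.
Qed.

(** For |w| = 1 and x = |1 - w|^2 one has |q - w|^2 = (q - 1)^2 + q x >= 1 + 2 x, and
    (1 + 2 x)^3 >= 27 x^2. Taking the product over the primitive roots w bounds the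
    sixth power of the value at q by 27^totient(t) times the fourth power of the
    value at 1, a nonzero integer. *)
Lemma Cyclotomic_lower : (3 ^ totient t)%N%:Z <= Phi.[q%:Z] ^+ 2.
Proof.
have [z prim] := C_prim_root_exists (ltnW t_gt1).
(* The cube avoids the cube roots of the pointwise inequality. *)
suff h : ((3 ^ totient t)%N%:Z) ^+ 3 <= (`|Phi.[q%:Z]| ^+ 2) ^+ 3.
  by rewrite -[Phi.[_] ^+ 2]ger0_norm ?sqr_ge0 // normrX -(@ler_pXn2r _ 3) // nnegrE ?exprn_ge0.
(* A nonzero integer, as 1 is not a primitive t-th root of unity for t > 1. *)
have one : 1 <= `|Phi.[1]|.
  rewrite -gtz0_ge1 normr_gt0 -(intr_eq0 algC) -horner_map /= (Cintr_Cyclotomic prim).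
  rewrite -/(root _ _) root_cyclotomic // /primitive_root_of_unity.
  apply/negP => p1; have := prim_order_dvd p1 1; rewrite expr1n eqxx dvdn1 => /esym.
  by case: eqP => // t1; have := t_gt1; rewrite t1 ltnn.
have one4 : 1 <= `|Phi.[1]| ^+ 4 by rewrite exprn_ege1.
apply: (@le_trans _ _ (((3 ^ totient t)%N%:Z) ^+ 3 * `|Phi.[1]| ^+ 4)).
  by rewrite ler_peMr.
rewrite -(ler_int algC) rmorphM !rmorphXn /= !(norm_Cyclotomic _ prim) -pmulrn natrX -prod_const_coprime.
rewrite -!prodrXl -big_split /=; apply: ler_prod => k _.
rewrite mulr_ge0 ?exprn_ge0 ?normr_ge0 //=; set w := z ^+ k.
have nw : w * w^* = 1 by rewrite -normCK norm_root // expr1n.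
pose x : algC := `|1 - w| ^+ 2.
have x0 : 0 <= x by rewrite exprn_ge0.
have xr : x \is Num.real by rewrite ger0_real.
have xE : x = 2 - (w + w^*).
  by rewrite /x normCK rmorphB rmorph1 mulrBl !mulrBr nw !mul1r !mulr1; ring.
have qE : `|(q%:Z)%:~R - w| ^+ 2 = (q%:R - 1) ^+ 2 + q%:R * x :> algC.
  rewrite normCK -pmulrn rmorphB rmorph_nat xE mulrBl !mulrBr nw; ring.
have e4 : `|1%:~R - w| ^+ 4 = x ^+ 2 by rewrite /x -exprM.
rewrite e4 qE.
have le1 : 1 + 2 * x <= (q%:R - 1) ^+ 2 + q%:R * x.
  apply: lerD; last by rewrite ler_wpM2r // (ler_nat _ 2).
  by rewrite exprn_ege1 // lerBrDr (ler_nat _ 2).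
apply: (@le_trans _ _ ((1 + 2 * x) ^+ 3)); last first.
  by rewrite lerXn2r // nnegrE ?(le_trans _ le1) // addr_ge0 // mulr_ge0.
have -> : 3 ^+ 3 * x ^+ 2 = (1 + 2 * x) ^+ 3 - (x - 1) ^+ 2 * (8 * x + 1) by ring.
rewrite lerBlDr lerDl; apply: mulr_ge0; last by rewrite addr_ge0 ?mulr_ge0.
by rewrite real_exprn_even_ge0 // rpredB ?rpred1.
Qed.
End Bound.

Section Totients.
Local Open Scope nat_scope.

Lemma exp3_gt n : 4 <= n -> (n.+1) ^ 2 < 3 ^ n.
Proof.
elim: n => // n IH; rewrite leq_eqVlt => /orP[/eqP<- //|lt].
by have := IH lt; rewrite !expnS !expn0; nia.
Qed.

Lemma prime_sq_lt_exp_totient t p : 3 < t -> t != 6 -> prime p -> p %| t ->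
  p ^ 2 < 3 ^ totient t.
Proof.
move=> t3 t6 pp pt; have t0 : 0 < t by lia.
have tot1 : 1 < totient t by rewrite totient_gt1; lia.
have tE : t = p ^ logn p t * t`_p^' by rewrite -p_part partnC.
have co : coprime (p ^ logn p t) t`_p^' by rewrite -p_part coprime_partC.
have l0 : 0 < logn p t by rewrite logn_gt0 mem_primes pp t0.
have totE : totient t = p.-1 * p ^ (logn p t).-1 * totient t`_p^'.
  by rewrite {1}tE totient_coprime // totient_pfactor.
have [p2|p3|p5] : [\/ p = 2, p = 3 | 4 < p].
  have := prime_gt1 pp; case: (ltnP 4 p) => [|le] h; first by constructor 3.
  have : p != 4 by apply: contraTneq pp => ->.
  move=> p4; have /orP[/eqP ->|/eqP ->] : (p == 2) || (p == 3) by lia.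
    by constructor 1.
  by constructor 2.
- by rewrite p2; apply: (@leq_trans (3 ^ 2)) => //; rewrite leq_exp2l.
- rewrite p3; apply: (@leq_trans (3 ^ 3)) => //; rewrite leq_exp2l //.
  rewrite totE p3 /=; have m0 : 0 < totient t`_3^' by rewrite totient_gt0 part_gt0.
  rewrite p3 in l0 tE; case: (logn 3 t) l0 tE => // -[|a] _ tE /=.
    rewrite muln1; suff : 1 < totient t`_3^' by lia.
    rewrite totient_gt1; move: tE t3 t6; rewrite expn1.
    by move: (t`_3^') => m; lia.
  by rewrite expnS; have := expn_gt0 3 a; nia.
- apply: (@leq_trans (3 ^ p.-1)).
    by have := @exp3_gt p.-1; rewrite prednK ?prime_gt0 //; apply; lia.
  rewrite leq_exp2l // totE -mulnA leq_pmulr // muln_gt0 expn_gt0 prime_gt0 //=.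
  by rewrite totient_gt0 part_gt0.
Qed.

(** If a and b are distinct and both satisfy the hypotheses made on a, then each is
    smaller than the other; this gives the uniqueness in [primitive_divisor_exists]. *)
Lemma prime_lt_of_order t a b s : prime a -> prime b -> s %| t -> s %| a.-1 ->
  a.-nat (t %/ s) -> b %| t -> b != a -> b < a.
Proof.
move=> pa pb st sa nat_ts bt nba.
have : b %| s * (t %/ s) by rewrite mulnC divnK.
rewrite Euclid_dvdM // => /orP[bs|bts].
  have a1 : 0 < a.-1 by rewrite -ltnS prednK ?prime_gt0 ?prime_gt1.
  by apply: leq_ltn_trans (dvdn_leq a1 (dvdn_trans bs sa)) _; rewrite ltn_predL prime_gt0.
have [ts0 _] := andP nat_ts.
have /(_ b pb bts) := elimT (pnatP _ ts0) nat_ts.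
by rewrite inE (negPf nba).
Qed.

Lemma PoszX a n : ((a ^ n)%N%:Z = a%:Z ^+ n)%R.
Proof. by rewrite -!natz natrX. Qed.

End Totients.

Section PrimitivePrime.
Local Open Scope nat_scope.
Variables (q t : nat).
Hypotheses (q_gt1 : 1 < q) (t_gt3 : 3 < t).
Local Notation N := `|(Cyclotomic t).[q%:Z]%R|%N.

(** X^t - 1 is divisible by the product of the t-th cyclotomic polynomial and X^s - 1. *)
Lemma Cyclotomic_dvd_geom s : 0 < s < t -> s %| t ->
  N %| \sum_(i < t %/ s) (q ^ s) ^ i.
Proof.
move=> /andP[s0 st] sdt; have t0 : 0 < t by lia.
have e1 : ('X^t - 1 : {poly int})%R = (\prod_(d <- divisors t) Cyclotomic d)%R.
  by rewrite prod_Cyclotomic.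
have e2 : ('X^s - 1 : {poly int})%R = (\prod_(d <- divisors t | (d %| s)%N) Cyclotomic d)%R.
  rewrite -prod_Cyclotomic // -[RHS]big_filter; apply/perm_big/uniq_perm.
  - exact: divisors_uniq.
  - by rewrite filter_uniq // divisors_uniq.
  move=> d; rewrite mem_filter -!dvdn_divisors //.
  by case ds: (d %| s) => //=; rewrite (dvdn_trans ds).
have e3 : exists c : {poly int}, ('X^t - 1 = Cyclotomic t * c * ('X^s - 1))%R.
  rewrite e1 e2 (bigID (fun d => d %| s)) /= mulrC (big_rem t) -?dvdn_divisors //=.
  have -> : t %| s = false by apply/negP => /(dvdn_leq s0); lia.
  by eexists; reflexivity.
have [c /(congr1 (fun p : {poly int} => p.[q%:Z]%R))] := e3.
rewrite !hornerE => e.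
set G := \sum_(i < _) _.
have geom : ((q%:Z) ^+ t - 1 = ((q%:Z) ^+ s - 1) * G%:Z)%R.
  rewrite -{1}(divnK sdt) mulnC exprM subrX1; congr (_ * _)%R.
  rewrite /G (big_morph Posz PoszD (erefl _)); apply: eq_bigr => i _.
  by rewrite -!PoszX.
have q1 : ((q%:Z) ^+ s - 1 != 0)%R.
  by rewrite subr_eq0 -PoszX eqz_nat -(expn0 q) eqn_exp2l // -lt0n.
have : (G%:Z = (Cyclotomic t).[q%:Z] * c.[q%:Z])%R.
  by apply: (mulfI q1); rewrite -geom e mulrC.
by move=> /(congr1 absz); rewrite absz_nat abszM => ->; apply: dvdn_mulr.
Qed.

Lemma geom_mod p y m : y = 1 %[mod p] -> \sum_(i < m) y ^ i = m %[mod p].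
Proof.
move=> y1; elim: m => [|m IH]; first by rewrite big_ord0.
by rewrite big_ord_recr /= -addn1 -modnDm IH -modnXm y1 modnXm exp1n modnDm.
Qed.

(** Lifting the exponent: a geometric sum with p terms and ratio 1 modulo p is
    divisible by p only once. *)
Lemma geom_mod_sq p y : prime p -> y = 1 %[mod p] -> (p = 2 -> y = 1 %[mod 4]) ->
  ~~ (p ^ 2 %| \sum_(i < p) y ^ i).
Proof.
move=> pp y1 y2.
have [p2|odd_p] := even_prime pp.
  rewrite p2 !big_ord_recr big_ord0 /= !expnS !expn0 !muln1 /dvdn add0n.
  by rewrite -modnDm y2.
have py : (p%:Z %| (y%:Z - 1)%R)%Z.
  by rewrite -eqz_mod_dvd; apply/eqP; rewrite !modz_nat y1.
have p2E : ((p ^ 2)%N%:Z = p%:Z * p%:Z)%R by rewrite expnS expn1 PoszM.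
(* Modulo p^2 one has y^i = 1 + i (y - 1). *)
have hi i : ((p ^ 2)%N%:Z %| ((y ^ i)%N%:Z - 1 - i%:Z * (y%:Z - 1))%R)%Z.
  elim: i => [|i IH]; first by rewrite expn0 mul0r subrr.
  have -> : ((y ^ i.+1)%N%:Z - 1 - i.+1%:Z * (y%:Z - 1) =
     y%:Z * ((y ^ i)%N%:Z - 1 - i%:Z * (y%:Z - 1)) + i%:Z * ((y%:Z - 1) * (y%:Z - 1)))%R.
    by rewrite expnS PoszM -addn1 PoszD; ring.
  by apply: rpredD; apply: dvdz_mull => //; rewrite p2E dvdz_mul.
have hs m : ((p ^ 2)%N%:Z %| ((\sum_(i < m) y ^ i)%N%:Z - m%:Z - 'C(m, 2)%:Z * (y%:Z - 1))%R)%Z.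
  elim: m => [|m IH]; first by rewrite big_ord0 bin0n mul0r subrr.
  have -> : ((\sum_(i < m.+1) y ^ i)%N%:Z - m.+1%:Z - 'C(m.+1, 2)%:Z * (y%:Z - 1) =
     ((\sum_(i < m) y ^ i)%N%:Z - m%:Z - 'C(m, 2)%:Z * (y%:Z - 1)) +
     ((y ^ m)%N%:Z - 1 - m%:Z * (y%:Z - 1)))%R.
    by rewrite big_ord_recr /= binS bin1 -(addn1 m) !PoszD; ring.
  by rewrite rpredD.
apply/negP => d.
have : ((p ^ 2)%N%:Z %| p%:Z)%Z.
  have e : (p%:Z = (\sum_(i < p) y ^ i)%N%:Z - ((\sum_(i < p) y ^ i)%N%:Z - p%:Z - 'C(p, 2)%:Z * (y%:Z - 1))
    - 'C(p, 2)%:Z * (y%:Z - 1))%R by ring.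
  rewrite e; apply: rpredB; first by apply: rpredB => //; rewrite dvdzE !absz_nat.
  rewrite p2E dvdz_mul // dvdzE !absz_nat prime_dvd_bin //=.
  by have := odd_prime_gt2 odd_p pp; lia.
rewrite dvdzE !absz_nat => /(dvdn_leq (prime_gt0 pp)).
by have := prime_gt1 pp; rewrite expnS expn1; nia.
Qed.

(** A prime with respect to which q has order t. *)
Definition primitive_divisor p :=
  [/\ prime p, p %| (q ^ t).-1 & forall e, 0 < e < t -> ~~ (p %| (q ^ e).-1)].

Let modE p e : (p %| (q ^ e).-1) = (q ^ e == 1 %[mod p]).
Proof. by rewrite -subn1 eqn_mod_dvd // expn_gt0 ltnW. Qed.

Lemma order_exists p : prime p -> p %| (q ^ t).-1 ->
  exists s, [/\ 0 < s, s %| t, s %| p.-1, q ^ s = 1 %[mod p] &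
    forall e, 0 < e -> q ^ e = 1 %[mod p] -> s <= e].
Proof.
move=> pp; rewrite modE => /eqP pt.
have ex : exists e, (0 < e) && (q ^ e == 1 %[mod p]).
  by exists t; rewrite (ltn_trans _ t_gt3) //=; apply/eqP.
case: (ex_minnP ex) => s /andP[s0 /eqP s1] smin.
have sdvd x : q ^ x = 1 %[mod p] -> s %| x.
  move=> x1; apply: contraT; rewrite /dvdn -lt0n => m0.
  have : q ^ (x %% s) = 1 %[mod p].
    have E : (q ^ s) ^ (x %/ s) = 1 %[mod p] by rewrite -modnXm s1 modnXm exp1n.
    rewrite -x1 [in RHS](divn_eq x s) expnD [_ %/ s * s]mulnC expnM.
    by rewrite -[in RHS]modnMml E modnMml mul1n.
  move=> /eqP h; have := smin (x %% s); rewrite m0 h => /(_ isT).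
  by rewrite leqNgt ltn_mod s0.
have co : coprime q p.
  rewrite coprime_sym prime_coprime //; apply/negP => pq.
  have : q ^ t %% p = 0 by apply/eqP; rewrite -/(dvdn _ _) Euclid_dvdX // pq; lia.
  by rewrite pt modn_small ?prime_gt1.
exists s; split=> //; first exact: sdvd.
  by apply: sdvd; rewrite -totient_prime // Euler_exp_totient.
by move=> e e0 e1; apply: smin; rewrite e0; apply/eqP.
Qed.

(** Let s < t be the order of q modulo p. For every prime r dividing t/s, the value
    of the cyclotomic polynomial divides a geometric sum that is r modulo p, so that
    r = p. The last claim is [geom_mod_sq] applied to the same sum. *)
Lemma nonprimitive_prime p : prime p -> p %| N -> ~ primitive_divisor p ->
  exists s, [/\ s %| t, s %| p.-1, p.-nat (t %/ s), p %| t & ~~ (p ^ 2 %| N)].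
Proof.
move=> pp pN np.
have t0 : 0 < t by lia.
have pt : p %| (q ^ t).-1.
  have := @Cyclotomic_dvd_geom 1 _ (dvd1n t); rewrite divn1 expn1 => h.
  apply: dvdn_trans pN _; apply: dvdn_trans (h _) _; first by lia.
  by rewrite predn_exp dvdn_mull.
have [s [s0 sdt sp s1 smin]] := order_exists pp pt.
have slt : s < t.
  rewrite ltn_neqAle (dvdn_leq t0 sdt) andbT; apply/eqP => st; apply: np; split=> //.
  move=> e /andP[e0 et]; rewrite modE; apply/eqP => /(smin _ e0).
  by rewrite st leqNgt et.
have tsE : t = s * (t %/ s) by rewrite mulnC divnK.
have ts0 : 0 < t %/ s by rewrite divn_gt0 // dvdn_leq.
have key r : prime r -> r %| t %/ s ->
    [/\ N %| \sum_(i < r) (q ^ (t %/ r)) ^ i, q ^ (t %/ r) = 1 %[mod p] & r %| t].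
  move=> pr rts; have rt : r %| t by rewrite tsE dvdn_mull.
  have str : s %| t %/ r by rewrite tsE -muln_divA // dvdn_mulr.
  split=> //.
    have := @Cyclotomic_dvd_geom (t %/ r); rewrite divnA // mulKn //; apply.
      by rewrite divn_gt0 ?prime_gt0 // dvdn_leq // ltn_Pdiv // prime_gt1.
    by rewrite dvdn_div.
  by rewrite -(divnK str) mulnC expnM -modnXm s1 modnXm exp1n.
have rp r : prime r -> r %| t %/ s -> r = p.
  move=> pr rts; have [h1 h2 _] := key r pr rts.
  have := dvdn_trans pN h1; rewrite /dvdn geom_mod // -/(dvdn _ _) => pr'.
  by apply/esym/eqP; rewrite -dvdn_prime2.
have ts1 : 1 < t %/ s by rewrite ltn_divRL // mul1n.
have pts : p %| t %/ s.
  by rewrite -(rp _ (pdiv_prime ts1) (pdiv_dvd _)) pdiv_dvd.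
have [h1 h2 h3] := key p pp pts.
exists s; split=> //.
  apply/pnatP => // r pr rts; rewrite inE; apply/eqP; exact: rp.
apply: contra (@geom_mod_sq p _ pp h2 _) => [h|p2]; first exact: dvdn_trans h h1.
(* For p = 2, t is a power of 2 and at least 4, so the ratio of the geometric sum is
   the square of an odd number. *)
have sE : s = 1 by apply/eqP; rewrite -dvdn1; rewrite p2 in sp.
have [a ta] : exists a, t = 2 ^ a.
  have : p.-nat (t %/ s) by apply/pnatP => // r pr rts; rewrite inE; apply/eqP; exact: rp.
  by rewrite sE divn1 p2 => /p_natP[a ->]; exists a.
have qodd : odd q by move: s1; rewrite sE p2 expn1 !modn2; case: odd.
case: a ta => [|[|a]] ta; try by have := t_gt3; rewrite ta.
rewrite p2 ta !expnS mulKn // expnM -modnXm.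
have : q ^ 2 = 1 %[mod 4].
  rewrite -modnXm; have := ltn_pmod q (isT : 0 < 4).
  have : odd (q %% 4) by rewrite odd_mod.
  by case: (q %% 4) => [|[|[|[|]]]].
by move=> ->; rewrite modnXm exp1n.
Qed.

(** Zsigmondy's theorem. If no prime divisor of the cyclotomic value is primitive,
    then there is only one, it divides the value once and it divides t; but the
    value exceeds every prime divisor of t. *)
Lemma primitive_divisor_exists : (t = 6 -> q <> 2) -> exists p, primitive_divisor p.
Proof.
move=> ex; have t1 : 1 < t by lia.
case: (pselect (exists p, primitive_divisor p)) => // no.
have np p : ~ primitive_divisor p by move=> h; apply: no; exists p.
have low : 3 ^ totient t <= N ^ 2.
  have := Cyclotomic_lower q_gt1 t1; rewrite -abszX -lez_nat gez0_abs //.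
  exact: sqr_ge0.
have N1 : 1 < N.
  have : 3 ^ 1 <= 3 ^ totient t by rewrite leq_exp2l // totient_gt0; lia.
  by move=> h; have := leq_trans h low; case: N => [|[|]].
pose p := pdiv N; have pp : prime p := pdiv_prime N1.
have pN : p %| N := pdiv_dvd N.
have [s [sdt sp pts pt psq]] := nonprimitive_prime pp pN (np p).
have only r : prime r -> r %| N -> r = p.
  move=> pr rN; have [s' [sdt' sp' pts' pt' _]] := nonprimitive_prime pr rN (np r).
  apply/eqP; apply: contraT => nrp.
  have l1 := prime_lt_of_order pp pr sdt sp pts pt' nrp.
  have := prime_lt_of_order pr pp sdt' sp' pts' pt; rewrite eq_sym nrp => /(_ isT) l2.
  by have := ltn_trans l1 l2; rewrite ltnn.
have NE : N = p.
  have pnN : p.-nat N.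
    by apply/pnatP => [|r pr rN]; [rewrite ltnW | rewrite inE (only r)].
  have [a Na] := p_natP pnN; move: psq N1; rewrite Na.
  case: a {Na} => [|[|a]] //.
  by rewrite dvdn_exp2l.
(* For t = 6 the bound of Cyclotomic_lower is too weak, but q > 2. *)
have [t6|t6] := eqVneq t 6; last first.
  by have := prime_sq_lt_exp_totient t_gt3 t6 pp pt; rewrite ltnNge -NE low.
have q2 : 2 < q by move: (ex t6) q_gt1; clear; lia.
have := Cyclotomic_lower_pow2 q_gt1 t1 q2; rewrite -abszE lez_nat NE t6 => h.
have : p <= 3.
  have := pt; rewrite t6 (_ : 6 = 2 * 3) // Euclid_dvdM // !dvdn_prime2 //.
  by case/orP => /eqP->.
by move=> /(leq_trans h).
Qed.
End PrimitivePrime.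

(** * Zero is not a root *)

Section NonZero.
Variables (R : realType) (q n k : nat).
Hypotheses (q_gt1 : (1 < q)%N) (k_gt0 : (0 < k)%N) (kn : (2 * k < n)%N) (even_n : ~~ odd n).

(** The order t of q modulo p divides p - 1. *)
Lemma primitive_divisor_gt t p : (1 < t)%N -> primitive_divisor q t p -> (t < p)%N.
Proof.
move=> t1 [pp pt np]; have p1 := prime_gt1 pp.
have q0 : (0 < q)%N by lia.
have co : coprime q p.
  rewrite coprime_sym prime_coprime //; apply/negP => pq.
  have : (p %| (q ^ t).-1 + 1)%N.
    by rewrite addn1 prednK ?expn_gt0 ?q0 // Euclid_dvdX // pq ltnW.
  by rewrite dvdn_addr // dvdn1 => /eqP p1'; rewrite p1' in p1.
rewrite ltnNge; apply/negP => le.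
have : ~~ (p %| (q ^ p.-1).-1)%N by apply: np; lia.
by rewrite -subn1 -eqn_mod_dvd ?expn_gt0 ?q0 // -totient_prime // Euler_exp_totient // eqxx.
Qed.
(** The numerator minus the denominator of the i-th inverse ratio is
    (q^k - 1)(q^(n + 1 - k) - 1), so all ratios are 1 modulo a primitive prime divisor
    p of q^(n + 1 - k) - 1. As p is larger than n - 2k, [shoot_mod_neq0] applies. The
    two cases in which there is no such p are computed. *)
Lemma shoot0_neq0 : (shoot (ratio R q k n) (n - 2 * k)).[0] != 0.
Proof.
have q0 : (0 < q)%N by lia.
have t3 : (3 < n.+1 - k)%N by move: even_n; lia.
(* The exceptional pairs are (n, k) = (6, 1) and (8, 3). *)
have [[t6 q2]|ex] : (n.+1 - k = 6 /\ q = 2)%N \/ (n.+1 - k = 6 -> q <> 2)%N by lia.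
  have qn2 a : qnat 2 a = (2 ^ a).-1 by rewrite -qnatE mul1n.
  have [[n6 k1]|[n8 k3]] : (n = 6 /\ k = 1)%N \/ (n = 8 /\ k = 3)%N by move: even_n; lia.
    have e i : (0 < i < 3)%N -> (ratio R 2 1 6 i)^-1 = 5 / 2.
      case: i => [|[|[|]]] // _; rewrite /ratio !qn2 invf_div -[(_ * _)%N]/105%N -[(_ * _)%N]/42%N;
      by field.
    rewrite n6 k1 q2 !horner_shootSS shoot0 shoot1 !hornerC (e 1%N) // (e 2%N) //.
    rewrite !(mul0r, mulr0, addr0, subr0, expr1n, mul1r, mulr1).
    by rewrite (_ : _ - _ = - 2); [rewrite oppr_eq0 pnatr_eq0 | field].
  rewrite n8 k3 q2 horner_shootSS shoot0 shoot1 !hornerC.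
  by rewrite !(mul0r, mulr0, addr0, subr0, expr1n, mul1r, mulr1) pnatr_eq0.
have [p pd] := primitive_divisor_exists q_gt1 t3 ex.
have tp := primitive_divisor_gt (ltnW (ltnW t3)) pd.
have [pp pt np] := pd.
have pq : ~~ (p %| q)%N.
  apply/negP => pq; have : (p %| (q ^ (n.+1 - k)).-1 + 1)%N.
    by rewrite addn1 prednK ?expn_gt0 ?q0 // Euclid_dvdX // pq; lia.
  by rewrite dvdn_addr // dvdn1 => /eqP p1; rewrite p1 in pp.
pose num i := ((q ^ (k + i).+1).-1 * (q ^ (n - k - i)).-1)%N.
pose den i := (q ^ k * ((q ^ i.+1).-1 * (q ^ (n - 2 * k - i)).-1))%N.
apply: (@shoot_mod_neq0 R _ _ num den p) => // [i im|i im|i im|].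
- have n1 : (q.-1)%:R != 0 :> R by rewrite pnatr_eq0 -lt0n; lia.
  have qg g : (0 < g)%N -> (qnat q g)%:R != 0 :> R by move=> g0; rewrite pnatr_eq0 -lt0n qnat_gt0.
  rewrite /ratio /num /den -!qnatE invf_div !natrM natrX.
  by field; rewrite n1 !qg ?expf_neq0 ?pnatr_eq0 -?lt0n //; lia.
- rewrite !Euclid_dvdM // !negb_or Euclid_dvdX // (negPf pq) /=.
  by rewrite !np //; lia.
- have PozP e : ((q ^ e).-1%:Z = q%:Z ^+ e - 1).
    by rewrite predn_int ?expn_gt0 ?q0 // PoszX.
  have : ((num i)%:Z == (den i)%:Z %[mod p%:Z])%Z.
    rewrite eqz_mod_dvd.
    have -> : (num i)%:Z - (den i)%:Z = (q%:Z ^+ k - 1) * (q ^ (n.+1 - k)).-1%:Z.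
      rewrite /num /den !PoszM PoszX !PozP.
      rewrite (_ : n.+1 - k = k + (n - 2 * k - i) + i.+1)%N; last by lia.
      rewrite (_ : n - k - i = k + (n - 2 * k - i))%N; last by lia.
      by rewrite -addnS !exprD; ring.
    by apply: dvdz_mull; rewrite dvdzE !absz_nat.
  by rewrite !modz_nat eqz_nat => /eqP.
- by rewrite gtnNdvd //; lia.
Qed.

Lemma char_shoot0_neq0 : ~~ root (char_shoot (ratio R q k n) (n - 2 * k).+1) 0.
Proof.
by rewrite /root horner_char_shoot mul0r sub0r addr0 expr1n mul1r oppr_eq0 shoot0_neq0.
Qed.
End NonZero.

(** * Growth of the Gaussian binomials *)

Section Increasing.
Variables (F : finFieldType) (n : nat).
Local Notation q := #|F|.

(** Both sides count the pairs of a k-space and a cover of it. *)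
Lemma qbinom_recurrence k :
  (qbinom F n k.+1 * qnat q k.+1 = qbinom F n k * qnat q (n - k))%N.
Proof.
rewrite /qbinom -!sum_nat_const !big_set.
transitivity (\sum_(U : {vspace 'rV[F]_n} | \dim U == k.+1) \sum_(W | covers W U) 1)%N.
  by apply: eq_bigr => U /eqP dU; rewrite sum1_card -dU -card_down_covers.
rewrite (exchange_big_dep (fun W : {vspace 'rV[F]_n} => \dim W == k)) /=; last first.
  by move=> U W /eqP dU /andP[_]; rewrite dU eqSS eq_sym.
apply: eq_bigr => W /eqP dW; rewrite -{2}dW -card_up_covers -sum1_card.
by apply: eq_bigl => U; rewrite !inE /covers dW andbC -andbA andbb.
Qed.

Lemma qbinom_gt0 k : (k <= n)%N -> (0 < qbinom F n k)%N.
Proof.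
elim: k => [|k IH] kn.
  by apply/card_gt0P; exists 0%VS; rewrite inE dimv0.
have : (0 < qbinom F n k.+1 * qnat q k.+1)%N.
  by rewrite qbinom_recurrence muln_gt0 IH ?(ltnW kn) // qnat_gt0 // subn_gt0.
by rewrite muln_gt0 => /andP[].
Qed.

Lemma qbinom_lt k : (0 < k)%N -> (2 * k <= n)%N -> (qbinom F n k.-1 < qbinom F n k)%N.
Proof.
case: k => // k _ kn /=; have := qbinom_recurrence k => e.
have lt : (qnat q k.+1 < qnat q (n - k))%N by rewrite qnat_lt ?(ltnW (q_gt1 F)) //; lia.
have b0 : (0 < qbinom F n k)%N by apply: qbinom_gt0; lia.
rewrite -(@ltn_pmul2r (qnat q k.+1)) ?qnat_gt0 // e ltn_pmul2l //.
Qed.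

Lemma qbinom0 : qbinom F n 0 = 1%N.
Proof.
rewrite /qbinom (_ : [set _ | _] = [set 0%VS]) ?cards1 //.
by apply/setP => U; rewrite !inE dimv_eq0.
Qed.
End Increasing.

(** * Eigenspaces in primitive coordinates *)

Section Eigen.
Variables (F : finFieldType) (n : nat) (R : realType).
Hypothesis n_gt2 : (2 < n)%N.
Local Notation T := {vspace 'rV[F]_n}.
Local Notation q := #|F|.
Local Notation FV := {ffun T -> R^o}.
Local Notation up := (@up F n R).
Local Notation prim := (@primitive F n R).
Local Notation K := n./2.+1.
Local Notation eigsp lambda := (passmx.leigenspace (upper_laplacian F n R) lambda).
Local Notation in_range := (in_range n).
Local Notation mix := (@mix F n R).

Definition restrict (f : FV) : C0 F n R := [ffun V => f (val V)].
Lemma restrict_linear : linear restrict.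
Proof. by move=> a f g; apply/ffunP => V; rewrite !ffunE. Qed.
HB.instance Definition _ := GRing.isLinear.Build R FV (C0 F n R) _ restrict restrict_linear.

Lemma ext_restrict (f : FV) :
  (forall U : T, ~~ (0 < \dim U < n)%N -> f U = 0) -> ext (restrict f) = f.
Proof.
move=> f0; apply/ffunP => U; have [dU|nU] := boolP (0 < \dim U < n)%N; last first.
  rewrite f0 // ext0 //; have := dim_leqn U; lia.
by have [V ->] := proper_vertex dU; rewrite extE ffunE.
Qed.

Lemma ext_outside (phi : C0 F n R) (U : T) : ~~ (0 < \dim U < n)%N -> ext phi U = 0.
Proof. by move=> h; apply: ext0; have := dim_leqn U; lia. Qed.

Lemma eigenspaceP lambda (phi : C0 F n R) :
  reflect (forall U : T, (0 < \dim U < n)%N ->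
    avg (ext phi) U = (n%:R - 2 - lambda) * ext phi U) (phi \in eigsp lambda).
Proof.
have n2 : (n - 2)%:R = n%:R - 2 :> R by rewrite natrB // ltnW.
have -> : (phi \in eigsp lambda) = (upper_laplacian F n R phi == lambda *: phi).
  rewrite /passmx.leigenspace memv_ker add_lfunE opp_lfunE scale_lfunE id_lfunE.
  by rewrite subr_eq0.
have lapE (V : vertex F n) : upper_laplacian F n R phi V =
    (n%:R - 2) * phi V - avg (ext phi) (val V).
  by rewrite upper_laplacian_avg n2.
apply: (iffP eqP) => [e U dU|h].
  have [V ->] := proper_vertex dU.
  move/ffunP/(_ V): e; rewrite lapE extE ffunE => e.
  by rewrite mulrBl -[lambda * _]/(lambda *: (phi V : R^o)) -e; ring.
apply/ffunP => V; rewrite lapE h ?vdim_bounds // extE ffunE.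
by rewrite -[_ *: _]/(_ * _); ring.
Qed.

Lemma eigen_componentsP lambda (phi : C0 F n R) :
  phi \in eigsp lambda <->
  exists g, [/\ adapted g, ext phi = assemble g &
    forall k d, (k < K)%N -> in_range k d -> (n%:R - 2 - lambda) *: g k d = mix g k d].
Proof.
split=> [/eigenspaceP h|[g [ga e h]]].
  have [g ga e] := decompose (@ext_outside phi); exists g; split=> // k d kK.
  by apply: eigen_mix => // U dU; rewrite -e h.
by apply/eigenspaceP => U dU; rewrite e; apply: mix_eigen.
Qed.

Lemma assemble_outside (g : nat -> nat -> FV) (U : T) : adapted g ->
  ~~ (0 < \dim U < n)%N -> assemble g U = 0.
Proof.
move=> ga nU; rewrite assemble_range // big1 ?mulr0 // => k _.
have -> : g k (\dim U) = 0.
  by apply: (proj2 ga); apply: contra nU => /and3P[-> -> _].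
by rewrite -upnE linear0 ffunE.
Qed.

(** The coordinates concentrated in degree k0 that are proportional to [f], with
    factors [sigma]. *)
Definition profile (k0 : nat) (sigma : nat -> R) (f : FV) (k d : nat) : FV :=
  if (k == k0) && in_range k d then sigma d *: f else 0.

Lemma profile_adapted k0 sigma f : f \in prim k0 -> adapted (profile k0 sigma f).
Proof.
move=> fp; split=> k d; rewrite /profile; last by move/negPf->; rewrite andbF.
by case: ifP => [/andP[/eqP -> _]|_]; [exact: memvZ | exact: mem0v].
Qed.

(** When only the degree k0 contributes, and the solutions of its scalar system are
    the multiples of sigma, the eigenspace is a copy of the primitive functions of
    degree k0. *)
Lemma dim_eigenspace lambda k0 d0 (sigma : nat -> R) : (k0 < K)%N ->
  in_range k0 d0 -> sigma d0 = 1 ->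
  (forall d, in_range k0 d ->
     (n%:R - 2 - lambda) * sigma d =
     \sum_(0 <= e < d | in_range k0 e) sigma e +
     \sum_(d.+1 <= e < n.+1 | in_range k0 e) (\prod_(d <= l < e) step F n R k0 l) * sigma e) ->
  (forall g : nat -> nat -> FV, adapted g ->
    (forall k d, (k < K)%N -> in_range k d -> (n%:R - 2 - lambda) *: g k d = mix g k d) ->
    (forall k d, (k < K)%N -> k != k0 -> g k d = 0) /\
    (forall d, in_range k0 d -> g k0 d = sigma d *: g k0 d0)) ->
  \dim (eigsp lambda) = \dim (prim k0).
Proof.
move=> k0K rd0 s1 sys uniq.
have kn : (2 * k0 <= n)%N by lia.
(* The assembled profile of f, written so as to be visibly linear in f. *)
pose Psi (f : FV) : FV := \sum_(e < n.+1 | in_range k0 e) (sigma e / (qfact q e)%:R) *: upn F n R (e - k0) f.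
have PsiE f : Psi f = assemble (profile k0 sigma f).
  rewrite /Psi /assemble big_mkcond; apply: eq_bigr => e _ /=.
  rewrite /layer_sum (bigD1 (Ordinal k0K)) //= big1 ?addr0 => [|k nk]; last first.
    have nk' : (k : nat) != k0 by apply: contra nk => /eqP e'; apply/eqP/val_inj.
    by rewrite /profile (negPf nk') /= -upnE linear0 scaler0.
  rewrite /profile eqxx /=; case: ifP => _; last by rewrite -upnE linear0 scaler0.
  by rewrite -upnE linearZ /= scalerA mulrC.
have Psi_lin : linear Psi.
  move=> a f g; rewrite /Psi scaler_sumr -big_split; apply: eq_bigr => e _ /=.
  by rewrite linearP scalerDr !scalerA mulrC.
pose PsiL := HB.pack_for {linear FV -> FV} Psi (GRing.isLinear.Build R FV FV _ Psi Psi_lin).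
pose L : 'Hom(FV, C0 F n R) := linfun (restrict \o PsiL).
have LE f : L f = restrict (Psi f) by rewrite lfunE.
have extL f : f \in prim k0 -> ext (L f) = assemble (profile k0 sigma f).
  move=> fp; rewrite LE PsiE ext_restrict // => U.
  exact/assemble_outside/profile_adapted.
have -> : eigsp lambda = (L @: prim k0)%VS.
  apply/vspaceP => phi; apply/idP/memv_imgP => [/eigen_componentsP[g [ga e h]]|[f fp ->]].
    have [g0 gs] := uniq g ga h; exists (g k0 d0); first exact: (proj1 ga).
    rewrite LE PsiE; apply/ffunP => V; rewrite ffunE -extE e; congr (fun_of_fin _ _).
    apply: eq_bigr => d _; apply: eq_bigr => k _; congr (_ *: iter _ _ _).
    rewrite /profile; have [->|nk] /= := eqVneq (k : nat) k0; last by rewrite g0.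
    by case: ifP => [/gs//|/negbT]; apply: (proj2 ga).
  apply/eigen_componentsP; exists (profile k0 sigma f); split.
  - exact: profile_adapted.
  - exact: extL.
  move=> k d kK rd; rewrite /mix /profile rd andbT; case: eqP rd => [->|_] rd /=; last first.
    by rewrite scaler0 !big1 ?addr0 // => e _; rewrite ?scaler0.
  rewrite scalerA sys // [LHS](scalerDl f) !scaler_suml; congr (_ + _); rewrite [LHS]big_mkcond; apply: eq_bigr => e _.
    by case: ifP.
  by case: ifP; rewrite ?scaler0 // scalerA.
(* Injectivity: the values in dimension d0 are a multiple of an iterate of up on f,
   which can be undone by dn. *)
apply: limg_dim_eq; apply/eqP; rewrite -subv0; apply/subvP => f /memv_capP[fp].
rewrite memv_ker memv0 => /eqP Lf; apply/eqP.
have := extL f fp; rewrite Lf => z.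
have ga := profile_adapted sigma fp.
have /and3P[d_gt0 d_ltn /andP[kd dk]] := rd0.
have z0 : iter (d0 - k0) up f = 0.
  have /primitiveP[gf _] := fp.
  have := iter_up_graded (d0 - k0) gf; rewrite subnKC // => /gradedP gf'.
  apply/ffunP => U; rewrite [RHS]ffunE; have [dU|/gf'//] := eqVneq (\dim U) d0.
  have : assemble (profile k0 sigma f) U = 0.
    by rewrite -z ffunE; case: insub => // V; rewrite ffunE.
  rewrite assembleE // /layer_sum dU sum_ffunE (bigD1 (Ordinal k0K)) //= big1 ?addr0 => [|k nk].
    rewrite /profile eqxx rd0 s1 scale1r ffunE => /eqP.
    by rewrite mulf_eq0 invr_eq0 pnatr_eq0 -[_ == 0%N]negbK -lt0n qfact_gt0 => /eqP.
  have nk' : (k : nat) != k0 by apply: contra nk => /eqP e'; apply/eqP/val_inj.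
  by rewrite /profile (negPf nk') /= -upnE linear0 scaler0 ffunE.
have := congr1 (dnn F n R (d0 - k0)) z0; rewrite linear0 dnnE (iter_dn_up fp) //; last by lia.
rewrite subnn /= => /eqP; rewrite scaler_eq0 => /orP[|/eqP//].
by rewrite (negPf (prod_dcoef_neq0 _ _ _ _)) //; lia.
Qed.

Lemma graded0_const (f : FV) e (U : T) : f \in prim 0 -> \dim U = e ->
  iter e up f U = (qfact q e)%:R * f 0%VS.
Proof.
move=> /primitiveP[/gradedP gf _] dU; rewrite iter_upE; congr (_ * _).
rewrite (big_pred1 0%VS) // => W /=; rewrite -dU -[X in _ == X]add0n eqn_add2r dimv_eq0.
by rewrite andb_idl // => /eqP->; exact: sub0v.
Qed.

Lemma step0 l : (l < n)%N -> step F n R 0 l = 1.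
Proof.
move=> ln; rewrite /step expn0 mul1n !subn0 divff // pnatr_eq0 -lt0n muln_gt0.
by rewrite !qnat_gt0 // subn_gt0.
Qed.

Lemma mix0E (g : nat -> nat -> FV) d (W : T) : (0 < d < n)%N -> adapted g ->
  mix g 0 d W = \sum_(1 <= e < n) g 0%N e W - g 0%N d W.
Proof.
move=> /andP[d0 dn_] [_ g0].
have gn e : (e == 0)%N || (n <= e)%N -> g 0%N e = 0.
  by move=> h; apply: g0; rewrite /in_range; lia.
rewrite /mix ffunE !sum_ffunE (big_ltn d0) gn // ffunE add0r.
rewrite [X in _ + X](eq_big_nat _ _ (F2 := fun e => g 0%N e W)); last first.
  move=> e /andP[de en]; have [ne|en'] := leqP n e; first by rewrite gn ?ne ?orbT // scaler0 !ffunE.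
  rewrite ffunE big_nat big1 ?scale1r // => l /andP[_ le]; apply: step0; lia.
rewrite [X in _ + X]big_nat_recr //= (gn n) ?leqnn ?orbT // ffunE addr0.
rewrite [in RHS](@big_cat_nat _ _ _ d) //=; last exact: ltnW.
by rewrite [X in _ + X - _]big_ltn // [g 0%N d W + _]addrC addrA addrK.
Qed.

Lemma step_ratio k i : (k + i < n)%N -> (2 * k <= n)%N -> step F n R k (k + i) = ratio R q k n i.
Proof.
move=> lt kn; rewrite /step /ratio.
have -> : ((k + i).+1 - k = i.+1)%N by lia.
have -> : (n - k - (k + i) = n - 2 * k - i)%N by lia.
by have -> : (n - (k + i) = n - k - i)%N by lia.
Qed.

Lemma big_nat_shift (A : Type) (idx : A) (op : A -> A -> A) (f : nat -> A) c a b :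
  \big[op/idx]_(c + a <= e < c + b) f e = \big[op/idx]_(a <= j < b) f (c + j)%N.
Proof.
by rewrite [(c + a)%N]addnC big_addn addKn; apply: eq_bigr => j _; rewrite addnC.
Qed.

(** The equation between functions is read at each subspace W separately. *)
Lemma mix_chain k (g : nat -> nat -> FV) mu : (0 < k < K)%N -> adapted g ->
  (forall d, in_range k d -> mu *: g k d = mix g k d) ->
  forall W : T, chain_solution (ratio R q k n) (n - 2 * k).+1 mu (fun i => g k (k + i)%N W).
Proof.
move=> /andP[k0 kK] [_ g0] h W i im.
have kn : (2 * k <= n)%N by lia.
have rd : in_range k (k + i) by rewrite /in_range; lia.
have := congr1 (fun f : FV => f W) (h _ rd); rewrite ffunE /mix ffunE !sum_ffunE => e.
rewrite -[mu * _]/(mu *: _) e; congr (_ + _).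
  rewrite (@big_cat_nat _ _ _ k) ?leq_addr //= big_nat big1 ?add0r => [|j /andP[_ jk]]; last first.
    by rewrite g0 ?ffunE // /in_range; lia.
  by rewrite -[X in \sum_(X <= _ < _) _]addn0 big_nat_shift.
rewrite (@big_cat_nat _ _ _ (n - k).+1) /=; try lia.
rewrite [X in _ + X]big_nat [X in _ + X]big1 ?addr0 => [|j /andP[jl _]]; last first.
  by rewrite (g0 k j) ?scaler0 ?ffunE // /in_range; lia.
rewrite -addnS (_ : (n - k).+1 = k + (n - 2 * k).+1)%N; last by lia.
rewrite big_nat_shift; apply: eq_big_nat => j /andP[ij jm]; rewrite ffunE -[LHS]/(_ * _); congr (_ * _).
rewrite big_nat_shift; apply: eq_big_nat => l /andP[_ lj].
by apply: step_ratio => //; lia.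
Qed.

End Eigen.

(** * Multiplicities *)

Section Multiplicities.
Variables (F : finFieldType) (n : nat) (R : realType).
Hypothesis n_gt2 : (2 < n)%N.
Local Notation T := {vspace 'rV[F]_n}.
Local Notation q := #|F|.
Local Notation FV := {ffun T -> R^o}.
Local Notation prim := (@primitive F n R).
Local Notation K := n./2.+1.
Local Notation eigsp lambda := (passmx.leigenspace (upper_laplacian F n R) lambda).
Local Notation in_range := (in_range n).
Local Notation mix := (@mix F n R).
Local Notation Phi k := (char_shoot (ratio R q k n) (n - 2 * k).+1).

Let scaleE a (f : FV) U : (a *: f) U = a * f U. Proof. by rewrite ffunE. Qed.

Let rb k i : (0 < k)%N -> (i < n - 2 * k)%N -> 0 < ratio R q k n i < 1.
Proof. by move=> k0; apply: ratio_bounds => //; exact: q_gt1. Qed.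

Let in_range_val k d : (0 < k)%N -> (2 * k <= n)%N -> in_range k d ->
  exists2 i, (i < (n - 2 * k).+1)%N & d = (k + i)%N.
Proof.
move=> k0 kn /and3P[d0 dn_ /andP[kd dk]]; exists (d - k)%N; first by lia.
by rewrite subnKC.
Qed.

Section Components.
Variables (g : nat -> nat -> FV) (mu : R).
Hypothesis ga : adapted g.
Hypothesis geq : forall k d, (k < K)%N -> in_range k d -> mu *: g k d = mix g k d.

(** The scalar system of degree k is solved by the values of the components at any
    given subspace. *)
Lemma component_eq0 k : (0 < k < K)%N ->
  (forall y, chain_solution (ratio R q k n) (n - 2 * k).+1 mu y ->
     forall i, (i < (n - 2 * k).+1)%N -> y i = 0) ->
  forall d, g k d = 0.
Proof.
move=> kK h d; have [rd|/(proj2 ga)//] := boolP (in_range k d).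
have [k0 kltK] := andP kK; have kn : (2 * k <= n)%N by lia.
have [i im ->] := in_range_val k0 kn rd; apply/ffunP => W; rewrite [RHS]ffunE.
apply: (h (fun i => g k (k + i)%N W)) => //.
by apply: mix_chain => // d' rd'; exact: geq.
Qed.

Lemma component_nonroot k : (0 < k < K)%N -> ~~ root (Phi k) mu -> forall d, g k d = 0.
Proof.
move=> kK nr; apply: component_eq0 => // y sol.
have [k0 _] := andP kK.
have [y0|rt] := chain_solution_root (fun i => rb k0) sol; last by rewrite rt in nr.
by move=> i im; apply: (chain_solution_eq0 (fun i => rb k0) sol) im; left.
Qed.

(** In degree 0 every [step] is 1, so the matrix of the system is the all-ones
    matrix minus the identity. *)
Lemma component0 d : (0 < d < n)%N ->
  (mu + 1) *: g 0%N d = \sum_(1 <= e < n) g 0%N e.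
Proof.
move=> dn_; have rd : in_range 0 d by rewrite /in_range; lia.
rewrite scalerDl scale1r geq //; apply/ffunP => W.
by rewrite ffunE mix0E // sum_ffunE subrK.
Qed.

Lemma component0_eq0 : mu != -1 -> mu != n%:R - 2 -> forall d, g 0%N d = 0.
Proof.
move=> mu1 mun d; have [rd|/(proj2 ga)//] := boolP (in_range 0 d).
have m1 : mu + 1 != 0 by rewrite addr_eq0.
set X := \sum_(1 <= e < n) g 0%N e.
have sX : (mu + 1) *: X = (n%:R - 1) *: X.
  rewrite {1}/X scaler_sumr (eq_big_nat _ _ (F2 := fun=> X)) => [|e en]; last first.
    by rewrite component0.
  by rewrite sumr_const_nat -scaler_nat natrB // ltnW // ltnW.
have X0 : X = 0.
  move/eqP: sX; rewrite -subr_eq0 -scalerBl scaler_eq0 => /orP[|/eqP//].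
  rewrite (_ : mu + 1 - (n%:R - 1) = mu - (n%:R - 2)); last by ring.
  by rewrite subr_eq0 (negPf mun).
have /and3P[d0 dn_ _] := rd.
have := @component0 d; rewrite d0 dn_ => /(_ isT); rewrite -/X X0 => /eqP.
by rewrite scaler_eq0 (negPf m1) => /eqP.
Qed.
End Components.

(** Otherwise the components of an eigenfunction vanish in every degree. *)
Lemma eigenvalue_root lambda :
  passmx.leigenvalue (upper_laplacian F n R) lambda ->
  [\/ lambda = 0, lambda = n%:R - 1 |
      exists2 k, (0 < k < K)%N & root (Phi k) (n%:R - 2 - lambda)].
Proof.
move=> ev; apply: contrapT => no.
have nr k : (0 < k < K)%N -> ~~ root (Phi k) (n%:R - 2 - lambda).
  by move=> kK; apply/negP => rt; apply: no; constructor 3; exists k.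
have mu1 : n%:R - 2 - lambda != -1.
  by apply/eqP => e; apply: no; constructor 2; lra.
have mun : n%:R - 2 - lambda != n%:R - 2.
  by apply/eqP => e; apply: no; constructor 1; lra.
case/negP: ev; rewrite -subv0; apply/subvP => phi /(eigen_componentsP n_gt2)[g [ga e geq]].
rewrite memv0; apply/eqP/ffunP => V; rewrite [RHS]ffunE -extE e assemble_range //.
rewrite big1 ?mulr0 // => k _; have -> : g k (\dim (val V)) = 0.
  have [k0|k0] := posnP k; first by rewrite k0 (component0_eq0 ga geq).
  by apply: (component_nonroot ga geq); rewrite ?k0 ?ltn_ord ?nr ?k0 ?ltn_ord.
by rewrite -upnE linear0 ffunE.
Qed.

Lemma eigenvalue_multE lambda m : (0 < m)%N ->
  \dim (eigsp lambda) = m -> eigenvalue_mult F n lambda m.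
Proof.
move=> m0 d; split=> //; rewrite /passmx.leigenvalue -dimv_eq0 d -lt0n //.
Qed.

Lemma range_sums k (h : nat -> R) i : (0 < k)%N -> (2 * k <= n)%N -> (i < (n - 2 * k).+1)%N ->
  \sum_(0 <= e < k + i | in_range k e) h e +
  \sum_((k + i).+1 <= e < n.+1 | in_range k e) (\prod_(k + i <= l < e) step F n R k l) * h e =
  \sum_(0 <= j < i) h (k + j)%N +
  \sum_(i.+1 <= j < (n - 2 * k).+1) (\prod_(i <= l < j) ratio R q k n l) * h (k + j)%N.
Proof.
move=> k0 kn im; congr (_ + _).
  rewrite (@big_cat_nat _ _ _ k) ?leq_addr //= big_nat_cond big1 ?add0r => [|j /andP[/andP[_ jk]]]; last first.
    by rewrite /in_range; lia.
  rewrite -[X in \sum_(X <= _ < _ | _) _]addn0.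
  rewrite big_mkcond big_nat_shift; apply: eq_big_nat => j /andP[_ ji].
  by rewrite ifT // /in_range; lia.
rewrite (@big_cat_nat _ _ _ (n - k).+1) /=; try lia.
rewrite [X in _ + X]big_nat_cond [X in _ + X]big1 ?addr0 => [|j /andP[/andP[jl _]]]; last first.
  by rewrite /in_range; lia.
rewrite -addnS (_ : (n - k).+1 = k + (n - 2 * k).+1)%N; last by lia.
rewrite big_mkcond big_nat_shift; apply: eq_big_nat => j /andP[ij jm].
rewrite ifT; last by rewrite /in_range; lia.
rewrite big_nat_shift; congr (_ * _); apply: eq_big_nat => l /andP[_ lj].
by apply: step_ratio => //; lia.
Qed.

Lemma mult_root lambda k0 : (0 < k0 < K)%N ->
  root (Phi k0) (n%:R - 2 - lambda) ->
  (forall k, (0 < k < K)%N -> k != k0 -> ~~ root (Phi k) (n%:R - 2 - lambda)) ->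
  lambda != 0 -> lambda != n%:R - 1 ->
  eigenvalue_mult F n lambda (qbinom F n k0 - qbinom F n k0.-1).
Proof.
move=> k0K rt nrt l0 l1; set mu := n%:R - 2 - lambda in rt nrt *.
have /andP[k0_gt0 k0_lt] := k0K.
have kn : (2 * k0 <= n)%N by lia.
have mu1 : mu != -1 by apply: contra l1 => /eqP; rewrite /mu => e; apply/eqP; lra.
have mun : mu != n%:R - 2 by apply: contra l0 => /eqP; rewrite /mu => e; apply/eqP; lra.
have [y sol y0] := root_chain_solution (fun i => rb k0_gt0) rt.
apply: eigenvalue_multE; first by rewrite subn_gt0 qbinom_lt.
rewrite -(dim_primitive F R k0_gt0 kn).
apply: (@dim_eigenspace F n R n_gt2 lambda k0 k0 (fun d => y (d - k0)%N)) => //.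
- by rewrite /in_range; lia.
- by rewrite subnn.
- move=> d rd; have [i im ->] := in_range_val k0_gt0 kn rd.
  rewrite range_sums // addKn -/mu sol //; congr (_ + _).
    by apply: eq_big_nat => j _; rewrite addKn.
  by apply: eq_big_nat => j _; rewrite addKn.
move=> g ga geq; split=> [k d kK nk|d rd].
  have [->|k_gt0] := posnP k; first exact: (component0_eq0 ga geq).
  by apply: (component_nonroot ga geq); rewrite ?nrt // k_gt0.
have [i im ->] := in_range_val k0_gt0 kn rd; rewrite addKn; apply/ffunP => W; rewrite scaleE.
have solg : chain_solution (ratio R q k0 n) (n - 2 * k0).+1 mu (fun i => g k0 (k0 + i)%N W).
  by apply: mix_chain => // d' rd'; exact: geq.
(* A solution that starts from 0, so it vanishes. *)
pose z j := g k0 (k0 + j)%N W - g k0 k0 W * y j.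
have solz : chain_solution (ratio R q k0 n) (n - 2 * k0).+1 mu z.
  move=> j jm; rewrite mulrBr solg // mulrCA sol // mulrDr opprD addrACA !mulr_sumr -!sumrB.
  by congr (_ + _); apply: eq_bigr => j' _; rewrite /z; ring.
have : z i = 0.
  apply: (chain_solution_eq0 (fun i => rb k0_gt0) solz) => //; left.
  by rewrite /z addn0 y0 mulr1 subrr.
by move=> /eqP; rewrite subr_eq0 mulrC => /eqP.
Qed.

(** Here mu = n - 2, which is at least n - 2k for all k > 0, so that
    [chain_solution_large] applies; in degree 0 only the constants remain. *)
Lemma mult_zero : eigenvalue_mult F n (0 : R) 1.
Proof.
apply: eigenvalue_multE => //; rewrite -(qbinom0 F n) -(dim_primitive0 F n R).
apply: (@dim_eigenspace F n R n_gt2 0 0 1 (fun=> 1)) => //.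
- by rewrite /in_range; lia.
- move=> d /and3P[d0 dn_ _]; rewrite mulr1 subr0.
  have -> : \sum_(0 <= e < d | in_range 0 e) (1 : R) = d%:R - 1.
    rewrite big_mkcond big_ltn // /in_range /= add0r.
    rewrite (eq_big_nat _ _ (F2 := fun=> 1)) => [|e /andP[e0 ed]]; last by rewrite ifT //; lia.
    by rewrite sumr_const_nat natrB.
  rewrite big_mkcond big_nat_recr //= {2}/in_range ltnn andbF addr0.
  rewrite (eq_big_nat _ _ (F2 := fun=> 1)) => [|e /andP[de en]].
    by rewrite sumr_const_nat natrB //; rewrite -natr1; ring.
  rewrite ifT; last by rewrite /in_range; lia.
  by rewrite mulr1 big_nat big1 // => l /andP[_ le]; apply: step0; lia.
move=> g ga geq; split=> [k d kK nk|d rd]; rewrite subr0 in geq.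
  apply: (component_eq0 ga geq); first by rewrite lt0n nk.
  move=> y; apply: chain_solution_large => [i im||].
  - by apply: rb; rewrite // lt0n.
  - by rewrite lerBrDr -natrD ler_nat; lia.
  - by rewrite subr_gt0 ltr_nat.
have /and3P[d0 dn_ _] := rd; rewrite scale1r.
have m1 : n%:R - 2 + 1 != 0 :> R.
  rewrite (_ : _ + 1 = n%:R - 1); last by ring.
  by rewrite subr_eq0 pnatr_eq1; lia.
have := component0 ga geq (d := d); rewrite d0 dn_ => /(_ isT) e1.
have := component0 ga geq (d := 1); rewrite (ltnW n_gt2) => /(_ isT) e2.
by apply: (scalerI m1); rewrite e1 e2.
Qed.

(** For k = n/2 the characteristic polynomial is X, and by [char_shoot0_neq0] no
    other degree has the root 0. *)
Lemma mult_half : ~~ odd n ->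
  eigenvalue_mult F n (n%:R - 2 : R) (qbinom F n n./2 - qbinom F n n./2.-1).
Proof.
move=> on; have nE : (2 * n./2 = n)%N by lia.
have e : n%:R - 2 - (n%:R - 2) = 0 :> R by ring.
apply: mult_root.
- by lia.
- by rewrite e nE subnn /root horner_char_shoot shoot0 horner0 mul0r mulr0 subrr.
- move=> k kK nk; rewrite e; apply: char_shoot0_neq0 => //; first exact: q_gt1.
  + by case/andP: kK.
  + by lia.
- by rewrite subr_eq0 eqr_nat; lia.
- by rewrite -subr_eq0 (_ : _ - _ = - 1) ?oppr_eq0 ?oner_eq0 //; ring.
Qed.

End Multiplicities.

(** * Functions of the dimension *)

Section Top.
Variables (F : finFieldType) (n : nat) (R : realType).
Hypothesis n_gt2 : (2 < n)%N.
Local Notation T := {vspace 'rV[F]_n}.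
Local Notation q := #|F|.
Local Notation FV := {ffun T -> R^o}.
Local Notation up := (@up F n R).
Local Notation prim := (@primitive F n R).
Local Notation K := n./2.+1.
Local Notation eigsp lambda := (passmx.leigenspace (upper_laplacian F n R) lambda).
Local Notation in_range := (in_range n).
Local Notation mix := (@mix F n R).
Local Notation X := 'rV[R]_(n.-2).+1.

Definition radial_fun (x : X) : C0 F n R := [ffun V => x 0 (inord (\dim (val V)).-1)].
Lemma radial_linear : linear radial_fun.
Proof. by move=> a x y; apply/ffunP => V; rewrite !ffunE !mxE. Qed.
HB.instance Definition _ := GRing.isLinear.Build R X (C0 F n R) _ radial_fun radial_linear.

Definition total_fun (x : X) : R^o := \sum_i x 0 i.
Lemma total_linear : linear total_fun.
Proof.
move=> a x y; rewrite /total_fun scaler_sumr -big_split; apply: eq_bigr => i _.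
by rewrite !mxE.
Qed.
HB.instance Definition _ := GRing.isLinear.Build R X R^o _ total_fun total_linear.

Let scaleE a (f : FV) U : (a *: f) U = a * f U. Proof. by rewrite ffunE. Qed.

Lemma total_range (x : X) (h : nat -> R) : (forall d, (0 < d < n)%N -> h d = x 0 (inord d.-1)) ->
  \sum_(1 <= e < n) h e = total_fun x.
Proof.
move=> hE; have nE : n = (n.-2).+2 by lia.
rewrite {1}nE big_add1 /= big_mkord; apply: eq_bigr => i _.
by rewrite hE /= ?inord_val //; have := ltn_ord i; lia.
Qed.

Lemma radial_assemble (g : nat -> nat -> FV) (x : X) : adapted g ->
  (forall k d, (0 < k < K)%N -> g k d = 0) ->
  (forall d, (0 < d < n)%N -> g 0%N d 0%VS = x 0 (inord d.-1)) ->
  assemble g = ext (radial_fun x).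
Proof.
move=> ga g0 gx; apply/ffunP => U; have [dU|nU] := boolP (0 < \dim U < n)%N; last first.
  by rewrite ext_outside // assemble_outside.
have [V UV] := proper_vertex dU; rewrite UV in dU *.
rewrite extE ffunE -gx // assemble_range //.
rewrite (bigD1 ord0) /=; last by rewrite subn0 dim_leqn.
rewrite big1 ?addr0 => [|k /andP[_ nk]]; last first.
  rewrite g0; first by rewrite -upnE linear0 ffunE.
  by rewrite ltn_ord andbT lt0n; apply: contra nk => /eqP k0; apply/eqP/val_inj.
rewrite subn0 (graded0_const (proj1 ga _ _) erefl) mulKf //.
by rewrite pnatr_eq0 -lt0n qfact_gt0.
Qed.

(** Here mu = -1, which is excluded in positive degrees by [chain_solution_eq0]; in
    degree 0 the system says that the sum over all dimensions vanishes. *)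
Lemma eigenspace_top : eigsp (n%:R - 1) = (linfun radial_fun @: lker (linfun total_fun))%VS.
Proof.
have muE : n%:R - 2 - (n%:R - 1) = -1 :> R by ring.
apply/vspaceP => phi; apply/idP/memv_imgP => [/(eigen_componentsP n_gt2)[g [ga e]]|[x]].
  rewrite muE => geq; pose x : X := \row_i g 0%N i.+1 0%VS.
  have gx d : (0 < d < n)%N -> g 0%N d 0%VS = x 0 (inord d.-1).
    by move=> dn_; rewrite mxE inordK ?prednK //; lia.
  have g0 k d : (0 < k < K)%N -> g k d = 0.
    move=> kK; apply: (component_eq0 n_gt2 ga geq) => // y sol i im.
    apply: (chain_solution_eq0 _ sol) im; last by right.
    by case/andP: kK => k0 _ j jm; apply: ratio_bounds => //; exact: q_gt1.
  exists x.
    rewrite memv_ker lfunE /= -(total_range gx).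
    have := component0 n_gt2 ga geq (d := 1); rewrite (ltnW n_gt2) addNr scale0r => /(_ isT) s0.
    by rewrite -(sum_ffunE _ _ (fun e => g 0%N e)) -s0 ffunE.
  rewrite lfunE; apply/ffunP => V; rewrite /= -(extE (radial_fun x)) -(radial_assemble ga g0 gx).
  by rewrite -e extE.
rewrite memv_ker lfunE => /eqP /= x0 ->; rewrite lfunE /=.
(* The primitive functions of degree 0 are the multiples of the indicator of the
   zero space. *)
pose origin : FV := [ffun U => (U == 0%VS)%:R].
have op : origin \in prim 0.
  have og : origin \in graded F n R 0.
    by apply/gradedP => U; rewrite dimv_eq0 ffunE => /negPf->.
  by apply/primitiveP; split=> //; exact: dn_graded0.
pose g k d : FV := if (k == 0)%N && in_range 0 d then x 0 (inord d.-1) *: origin else 0.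
have gE d : (0 < d < n)%N -> g 0%N d = x 0 (inord d.-1) *: origin.
  by move=> dn_; rewrite /g ifT // /in_range; lia.
have ga : adapted g.
  split=> k d; rewrite /g; last by case: eqP => //= -> /negPf->.
  by case: ifP => [/andP[/eqP-> _]|_]; [exact: memvZ | exact: mem0v].
have g0 k d : (0 < k < K)%N -> g k d = 0 by case: k.
apply/(eigen_componentsP n_gt2); exists g; split=> // [|k d kK rd].
  rewrite (radial_assemble (x := x) ga g0) // => d dn_.
  by rewrite gE // scaleE ffunE eqxx mulr1.
rewrite muE scaleN1r; have [k0|k0] := posnP k; last first.
  rewrite /mix !g0 ?k0 // oppr0 !big1 ?addr0 // => e _; rewrite g0 ?k0 ?scaler0 //.
rewrite k0 in rd *; have dn_ : (0 < d < n)%N by case/and3P: rd => -> ->.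
apply/ffunP => W; rewrite mix0E // (@total_range (origin W *: x)) => [|e en].
  by rewrite linearZ /= x0 scaler0 sub0r ffunE.
by rewrite gE // scaleE mxE mulrC.
Qed.

Lemma mult_top : eigenvalue_mult F n (n%:R - 1 : R) (n - 2).
Proof.
apply: eigenvalue_multE; first by lia.
rewrite eigenspace_top limg_dim_eq; last first.
  apply/eqP; rewrite -subv0; apply/subvP => x /memv_capP[_].
  rewrite memv_ker lfunE memv0 /= => /eqP x0; apply/eqP/rowP => i.
  have dn_ : (i.+1 < n)%N by have := ltn_ord i; lia.
  have : (0 < qbinom F n i.+1)%N by apply: qbinom_gt0; lia.
  case/card_gt0P => U; rewrite inE => /eqP dU.
  have [V UV] : exists V : vertex F n, U = val V by apply: proper_vertex; rewrite dU.
  have /ffunP/(_ V) := x0.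
  by rewrite !ffunE -UV dU inord_val mxE.
have := limg_ker_dim (linfun total_fun) fullv; rewrite capfv dimvf.
have -> : limg (linfun total_fun) = fullv.
  apply/eqP; rewrite eqEdim subvf dimvf /=.
  rewrite lt0n dimv_eq0; apply/eqP => l0.
  have : linfun total_fun (delta_mx 0 ord0) \in limg (linfun total_fun) by rewrite memv_img ?memvf.
  rewrite l0 memv0 lfunE /= /total_fun (bigD1 ord0) //= big1 => [|i ni].
    by rewrite mxE !eqxx addr0 oner_eq0.
  by rewrite mxE (negPf ni) andbF.
by rewrite dimvf /dim /=; lia.
Qed.

End Top.

Lemma horner_char_shoot1 (R : realFieldType) (r : nat -> R) mu : (char_shoot r 1).[mu] = mu.
Proof. by rewrite horner_char_shoot shoot0 shoot1 horner0 hornerC mulr0 subr0 mulr1. Qed.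

(** * Branches of roots and their separation *)

Section Separation.
Variable R : realType.

(** Finitely many asymptotic statements share their constants. *)
Lemma uniform_bounds (I : eqType) (P : I -> R -> R -> Prop) (l : seq I) :
  (forall i C C' e e', C <= C' -> e' <= e -> P i C e -> P i C' e') ->
  (forall i, i \in l -> exists C e, [/\ 0 < C, 0 < e & P i C e]) ->
  exists C e, [/\ 0 < C, 0 < e & forall i, i \in l -> P i C e].
Proof.
move=> mono; elim: l => [|i l IH] h; first by exists 1, 1.
have [|C [e [C0 e0 hl]]] := IH; first by move=> j jl; apply: h; rewrite inE jl orbT.
have [C' [e' [C0' e0' hi]]] := h i (mem_head _ _).
exists (Num.max C C'), (Num.min e e'); split; rewrite ?lt_max ?lt_min ?C0 ?e0 //.
move=> j; rewrite inE => /predU1P[->|jl].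
  by apply: mono hi; rewrite ?le_max ?ge_min lexx orbT.
by apply: mono (hl j jl); rewrite ?le_max ?ge_min lexx.
Qed.

Lemma separate_rates (a a' C : R) b b' : a != 0 -> 0 < C -> (b < b')%N ->
  exists2 e : R, 0 < e & forall s mu, 0 < s -> s <= e ->
    `|mu - a * s ^+ b| <= C * s ^+ b.+1 -> `|mu - a' * s ^+ b'| <= C * s ^+ b'.+1 -> False.
Proof.
move=> a0 C0 bb; have na : 0 < `|a| by rewrite normr_gt0.
pose D := `|a'| + 2 * C + 1; have D0 : 0 < D.
  by rewrite !ltr_wpDl ?addr_ge0 ?mulr_ge0 ?normr_ge0 ?ltW.
exists (Num.min 1 (`|a| / (2 * D))); first by rewrite lt_min ltr01 divr_gt0 ?mulr_gt0.
move=> s mu s0; rewrite le_min => /andP[s1 sD] h h'.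
have sb : 0 < s ^+ b by rewrite exprn_gt0.
have sb' : s ^+ b' <= s ^+ b.+1 by rewrite ler_wiXn2l // ltW.
have sb'' : s ^+ b'.+1 <= s ^+ b.+1 by rewrite ler_wiXn2l // ?ltW // leqW.
have : `|a * s ^+ b| <= (`|a'| + 2 * C) * s ^+ b.+1.
  rewrite (_ : a * s ^+ b = (mu - a' * s ^+ b') - (mu - a * s ^+ b) + a' * s ^+ b'); last by ring.
  rewrite (le_trans (ler_normD _ _)) // (le_trans (lerD (ler_normB _ _) (lexx _))) //.
  rewrite normrM (ger0_norm (exprn_ge0 _ (ltW s0))) mulrDl addrC.
  apply: lerD; first by rewrite ler_wpM2l.
  rewrite mulr2n mulrDl mulrDl mul1r lerD // (le_trans h') // ler_wpM2l // ltW //.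
rewrite normrM (gtr0_norm sb) exprS mulrA ler_pM2r // => le.
have : `|a| <= `|a| / 2.
  apply: (le_trans le); rewrite (@le_trans _ _ (D * s)) // ?ler_pM2r // ?lerDl //.
  by move: sD; rewrite invfM [_ * (_ * _)]mulrA ler_pdivlMr // mulrC.
by move: na; clear; lra.
Qed.

Lemma separate_equal_rate (a a' C : R) b : a != a' -> 0 < C ->
  exists2 e : R, 0 < e & forall s mu, 0 < s -> s <= e ->
    `|mu - a * s ^+ b| <= C * s ^+ b.+1 -> `|mu - a' * s ^+ b| <= C * s ^+ b.+1 -> False.
Proof.
move=> aa C0; have na : 0 < `|a - a'| by rewrite normr_gt0 subr_eq0.
exists (`|a - a'| / (4 * C)); first by rewrite divr_gt0 ?mulr_gt0.
move=> s mu s0 sD h h'; have sb : 0 < s ^+ b by rewrite exprn_gt0.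
have : `|(a - a') * s ^+ b| <= 2 * C * s ^+ b.+1.
  rewrite (_ : (a - a') * _ = (mu - a' * s ^+ b) - (mu - a * s ^+ b)); last by ring.
  rewrite (le_trans (ler_normB _ _)) // mulr2n mulrDl mulrDl mul1r lerD //.
rewrite normrM (gtr0_norm sb) exprS mulrA ler_pM2r // => le.
move: sD; rewrite ler_pdivlMr ?mulr_gt0 // => sD.
have : 4 * (s * C) <= 2 * (s * C).
  by rewrite mulrCA (le_trans sD) // (le_trans le) // mulrAC mulrA.
by have := mulr_gt0 s0 C0; clear; lra.
Qed.

End Separation.

Section Branches.
Variables (R : realType) (n : nat).

(** A branch (k, j) stands for the root of the k-th characteristic polynomial that is
    close to the j-th Chebyshev root. There are as many branches for a given k as
    the degree of this polynomial. *)
Definition branches : seq (nat * nat) :=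
  [seq (k, j) | k <- iota 1 n.-1./2, j <- iota 1 (n - 2 * k + 1)].

Lemma mem_branches k j :
  ((k, j) \in branches) = [&& (0 < k)%N, (2 * k < n)%N & (0 < j < n - 2 * k + 2)%N].
Proof.
have h : ((k \in iota 1 n.-1./2) && (j \in iota 1 (n - 2 * k + 1))) =
    [&& (0 < k)%N, (2 * k < n)%N & (0 < j < n - 2 * k + 2)%N].
  by rewrite !mem_iota; lia.
rewrite -h; apply/allpairsPdep/andP => [[k' [j' [k'i j'i [-> ->]]]]|[ki ji]]; first by [].
by exists k, j.
Qed.

(** The branches whose Chebyshev root is 0, described at the finer scale. *)
Definition middle (i : nat * nat) := (2 * i.2)%N == (n - 2 * i.1 + 2)%N.

(** The root on the branch is center * s^rate with an error of order s^(rate + gap),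
    where s is the inverse square root of q. *)
Definition center (i : nat * nat) : R :=
  if middle i then - (2 * (n - 2 * i.1)%:R / (n - 2 * i.1).+2%:R)
  else cheb_root R (n - 2 * i.1 + 2) i.2.

Definition rate (i : nat * nat) : nat := if middle i then (2 * i.1)%N else i.1.

Definition gap (i : nat * nat) : nat := if middle i then 2 else minn i.1 2.

Definition near (C s : R) (i : nat * nat) (mu : R) : Prop :=
  `|mu - center i * s ^+ rate i| <= C * s ^+ (rate i + gap i).

Lemma near_mono C C' s i mu : 0 < s -> C <= C' -> near C s i mu -> near C' s i mu.
Proof.
by move=> s0 CC h; apply: le_trans h _; rewrite ler_wpM2r // exprn_ge0 // ltW.
Qed.

Lemma near_weak C s i mu : i \in branches -> 0 < C -> 0 < s -> s <= 1 -> near C s i mu ->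
  `|mu - center i * s ^+ rate i| <= C * s ^+ (rate i).+1.
Proof.
case: i => k j; rewrite mem_branches => /andP[k0 _] C0 s0 s1 h; apply: le_trans h _.
apply: ler_wpM2l; first exact: ltW.
apply: ler_wiXn2l; rewrite ?s1 ?(ltW s0) //.
by rewrite -addn1 leq_add2l /gap; case: ifP => // _ /=; lia.
Qed.

Lemma center_neq0 i : i \in branches -> center i != 0.
Proof.
case: i => k j; rewrite mem_branches /center /middle /= => /and3P[k0 kn jN].
case: ifP => [_|/negbT nm]; last exact: cheb_root_neq0.
by rewrite oppr_eq0 !mulf_neq0 ?invr_eq0 ?pnatr_eq0 //; lia.
Qed.

Lemma center_le2 i : `|center i| <= 2.
Proof.
rewrite /center; case: ifP => _; last exact: cheb_root_le2.
rewrite normrN -mulrA normrM ger0_norm // -[leRHS]mulr1 ler_pM2l //.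
by rewrite ger0_norm ?divr_ge0 // ler_pdivrMr ?ltr0n // mul1r ler_nat leqW.
Qed.

Lemma rate_gt0 i : i \in branches -> (0 < rate i)%N.
Proof.
by case: i => k j; rewrite mem_branches /rate; case: ifP => _ /and3P[/= k0 _ _] //; lia.
Qed.

(** Branches with the same order of magnitude either belong to the same k, or are a
    middle branch of some k' and a branch of 2k'; the latter have different leading
    coefficients, only one of the two being an algebraic integer. *)
Lemma center_inj i i' : i \in branches -> i' \in branches -> i != i' ->
  rate i = rate i' -> center i != center i'.
Proof.
(* A regular branch against a middle one. *)
have mixed k j k' j' : (k, j) \in branches -> (k', j') \in branches ->
    ~~ middle (k, j) -> middle (k', j') -> rate (k, j) = rate (k', j') ->
    center (k, j) != center (k', j').
  rewrite !mem_branches /center /rate => /and3P[k0 kn jN] /and3P[k0' kn' jN'].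
  move=> /negPf -> m; rewrite m /= => kk; move: m; rewrite /middle /= => /eqP m.
  rewrite eq_sym eqr_oppLR -cheb_root_refl; [|lia..].
  by rewrite eq_sym cheb_root_neq_rat //; lia.
case: i => k j; case: i' => k' j' b b' ne oo.
have [m|m] := boolP (middle (k, j)); have [m'|m'] := boolP (middle (k', j')).
- move: ne oo; rewrite /rate m m' -pair_eqE /=; move: m m'; rewrite /middle /=; lia.
- by rewrite eq_sym mixed.
- exact: mixed.
move: oo; rewrite /rate /center (negPf m) (negPf m') /= => kk.
rewrite -kk in b' ne *.
move: b b'; rewrite !mem_branches => /and3P[_ _ jN] /and3P[_ _ jN'].
by apply: contra ne => /eqP /(cheb_root_inj jN jN') ->.
Qed.

Lemma branches_separated C : 0 < C ->
  exists2 e : R, 0 < e & forall s mu i i', 0 < s -> s <= e -> i \in branches -> i' \in branches ->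
    near C s i mu -> near C s i' mu -> i = i'.
Proof.
move=> C0.
have [|i|_ [e [_ e0 h]]] := @uniform_bounds R _ (fun ii (_ e : R) => forall s mu, 0 < s -> s <= e ->
    near C s ii.1 mu -> near C s ii.2 mu -> ii.1 = ii.2) [seq (i, i') | i <- branches, i' <- branches].
- by move=> i C1 C2 e e' _ ee h s mu s0 se; apply: h => //; exact: le_trans ee.
- case: i => i i' /allpairsP[[i1 i1'] /= [b b' [-> ->]]].
  suff [e e0 h] : exists2 e : R, 0 < e & forall s mu, 0 < s -> s <= e ->
      near C s i1 mu -> near C s i1' mu -> i1 = i1' by exists 1, e.
  have [->|ne] := eqVneq i1 i1'; first by exists 1.
  suff [e e0 h] : exists2 e : R, 0 < e & forall s mu, 0 < s -> s <= e ->
      `|mu - center i1 * s ^+ rate i1| <= C * s ^+ (rate i1).+1 ->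
      `|mu - center i1' * s ^+ rate i1'| <= C * s ^+ (rate i1').+1 -> False.
    exists (Num.min 1 e); rewrite ?lt_min ?ltr01 // => s mu s0.
    rewrite le_min => /andP[s1 se] /(near_weak b C0 s0 s1) w /(near_weak b' C0 s0 s1) w'.
    by case: (h s mu).
  have [lt|lt|same] := ltngtP (rate i1) (rate i1').
  + by apply: separate_rates => //; exact: center_neq0.
  + have [e e0 h] := separate_rates (center i1) (center_neq0 b') C0 lt.
    by exists e => // s mu s0 se w w'; exact: h w' w.
  by rewrite -same; apply: separate_equal_rate => //; exact: center_inj.
exists e => // s mu i i' s0 se b b' w w'.
by apply: (h (i, i')) w w' => //; apply/allpairsP; exists (i, i').
Qed.

(** This separates the branches from the values mu = 0, -1 and n - 2, which correspond
    to the explicit eigenvalues. *)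
Lemma near_small C : 0 < C ->
  exists2 e : R, 0 < e & forall s mu i, 0 < s -> s <= e -> i \in branches ->
    near C s i mu -> mu != 0 /\ `|mu| < 1.
Proof.
move=> C0.
have [|i b|_ [e [_ e0 h]]] := @uniform_bounds R _ (fun i (_ e : R) => forall s mu, 0 < s -> s <= e ->
    near C s i mu -> mu != 0 /\ `|mu| < 1) branches.
- by move=> i C1 C2 e e' _ ee h s mu s0 se; apply: h => //; exact: le_trans ee.
- have [e e0 h] := separate_rates 0 (center_neq0 b) C0 (ltnSn (rate i)).
  have C20 : 0 < 2 * (2 + C) by rewrite mulr_gt0 // addr_gt0.
  exists 1, (Num.min 1 (Num.min e (2 * (2 + C))^-1)); rewrite !lt_min ltr01 e0 invr_gt0 C20.
  split=> // s mu s0; rewrite !le_min => /and3P[s1 se sC] nr; have w := near_weak b C0 s0 s1 nr.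
  split.
    apply/eqP => mu0; apply: (h s mu s0 se w).
    by rewrite mu0 mul0r subr0 normr0 mulr_ge0 ?exprn_ge0 ?ltW.
  have sb : s ^+ rate i <= s.
    by rewrite -[leRHS]expr1; apply: ler_wiXn2l; rewrite ?s1 ?(ltW s0) // rate_gt0.
  have sb' : s ^+ (rate i).+1 <= s by rewrite -[leRHS]expr1; apply: ler_wiXn2l; rewrite ?s1 ?(ltW s0).
  have : `|mu| <= (2 + C) * s.
    rewrite -[mu](subrK (center i * s ^+ rate i)) (le_trans (ler_normD _ _)) // addrC mulrDl.
    apply: lerD; last by apply: le_trans w _; apply: ler_wpM2l; first exact: ltW.
    rewrite normrM [`|s ^+ _|]ger0_norm; last by apply: exprn_ge0; exact: ltW.
    by apply: ler_pM; rewrite ?center_le2 // exprn_ge0 // ltW.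
  move/le_lt_trans; apply; rewrite mulrC -ltr_pdivlMr ?addr_gt0 // mul1r.
  apply: le_lt_trans sC _; rewrite ltf_pV2 ?posrE ?addr_gt0 //.
  by move: C0; clear; lra.
by exists e => // s mu i s0 se b; exact: h.
Qed.

Lemma branch_roots : exists C e0 : R, [/\ 0 < C, 0 < e0 &
  forall i, i \in branches -> forall (q : nat) (s : R), (1 < q)%N -> 0 < s ->
    s ^+ 2 = q%:R^-1 -> s <= e0 ->
    exists2 mu, root (char_shoot (ratio R q i.1 n) (n - 2 * i.1).+1) mu & near C s i mu].
Proof.
apply: uniform_bounds => [i C C' e e' CC ee h q s q1 s0 sq se|[k j]].
  have [mu rt nr] := h q s q1 s0 sq (le_trans se ee); exists mu => //; exact: near_mono nr.
rewrite mem_branches /near /center /rate /gap /= => /and3P[k0 kn jN].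
case: ifP => [/eqP m|_]; last exact: root_near_cheb.
have on : ~~ odd n by move: m => /=; lia.
have [C [e [C0 e0 h]]] := root_near_tilde R k0 kn on; exists C, e; split=> //.
move=> q s q1 s0 sq se; have [mu rt nr] := h q s q1 s0 sq se; exists mu => //.
by rewrite mulNr opprK.
Qed.

End Branches.

(** * One eigenvalue on each branch *)

Section Counting.
Variables (F : finFieldType) (n : nat) (R : realType).
Hypothesis n_gt2 : (2 < n)%N.
Variables C s : R.
Local Notation q := #|F|.
Local Notation Phi k := (char_shoot (ratio R q k n) (n - 2 * k).+1).
Local Notation near := (near n C s).
Hypothesis separated : forall mu i i', i \in branches n -> i' \in branches n ->
  near i mu -> near i' mu -> i = i'.
Hypothesis small : forall mu i, i \in branches n -> near i mu -> mu != 0 /\ `|mu| < 1.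
Hypothesis inhabited : forall i, i \in branches n -> exists2 mu, root (Phi i.1) mu & near i mu.

(** The roots found on the branches of k are distinct because the branches are
    separated, and their number is the degree; so there are no others. *)
Lemma branch_root_exhaust : exists rt : nat * nat -> R,
  (forall i, i \in branches n -> root (Phi i.1) (rt i) /\ near i (rt i)) /\
  (forall k mu, (0 < k < n./2.+1)%N -> mu != 0 -> root (Phi k) mu ->
     exists j, (k, j) \in branches n /\ mu = rt (k, j)).
Proof.
have [|rt rtP] := @choice _ _ (fun i mu => i \in branches n -> root (Phi i.1) mu /\ near i mu).
  move=> i; have [b|] := boolP (i \in branches n); last by exists 0.
  by have [mu] := inhabited b; exists mu.
exists rt; split=> // k mu kK mu0 rmu; have /andP[k0 kltK] := kK.
have [n2k|kn] := eqVneq (2 * k)%N n.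
  by move: rmu; rewrite n2k subnn /root horner_char_shoot1 (negPf mu0).
have kn' : (2 * k < n)%N by lia.
have b j : j \in iota 1 (n - 2 * k + 1) -> (k, j) \in branches n.
  by rewrite mem_iota mem_branches => jb; rewrite k0 kn' /=; lia.
pose rs := [seq rt (k, j) | j <- iota 1 (n - 2 * k + 1)].
have [/mapP[j jb ->]|nmu] := boolP (mu \in rs); first by exists j; split=> //; exact: b.
have us : uniq rs.
  rewrite map_inj_in_uniq ?iota_uniq // => j j' /b bj /b bj' e.
  have [_ nj] := rtP _ bj; have [_ nj'] := rtP _ bj'.
  by rewrite e in nj; case: (separated bj bj' nj nj').
have rb i : (i < n - 2 * k)%N -> 0 < ratio R q k n i < 1 by apply: ratio_bounds => //; exact: q_gt1.
have all_r : all (root (Phi k)) (mu :: rs).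
  rewrite /= rmu; apply/allP => _ /mapP[j /b bj ->]; exact: (proj1 (rtP _ bj)).
have := max_poly_roots (char_shoot_neq0 rb) all_r; rewrite /= nmu us => /(_ isT).
by rewrite size_map size_iota ltnNge addn1 size_char_shoot.
Qed.

Lemma branch_eigenvalue i : i \in branches n -> exists lambda,
  [/\ near i (n%:R - 2 - lambda),
      eigenvalue_mult F n lambda (qbinom F n i.1 - qbinom F n i.1.-1) &
      forall lambda', near i (n%:R - 2 - lambda') ->
        passmx.leigenvalue (upper_laplacian F n R) lambda' -> lambda' = lambda].
Proof.
have [rt [rtP ex]] := branch_root_exhaust; move=> b.
have [rti nri] := rtP i b.
have excl lambda : near i (n%:R - 2 - lambda) -> lambda != 0 /\ lambda != n%:R - 1.
  move=> /(small b)[_ lt1]; split.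
    apply: contraTneq lt1 => ->; rewrite -leNgt subr0 ger0_norm.
      by rewrite lerBrDr -(natrD R 1 2) ler_nat.
    by rewrite subr_ge0 ler_nat ltnW.
  apply: contraTneq lt1 => ->; rewrite -leNgt (_ : _ - _ = -1); first by rewrite normrN1.
  by ring.
have muE : n%:R - 2 - (n%:R - 2 - rt i) = rt i by ring.
exists (n%:R - 2 - rt i); split.
- by rewrite muE.
- have [l0 l1] : n%:R - 2 - rt i != 0 /\ n%:R - 2 - rt i != n%:R - 1 by apply: excl; rewrite muE.
  have [mu0 _] := small b nri.
  apply: mult_root => //; rewrite ?muE //.
    by case: i b {rti nri excl muE l0 l1 mu0} => k j; rewrite mem_branches /= => /and3P[]; lia.
  move=> k kK nk; apply: contra nk => rk.
  have [j [bj e]] := ex k _ kK mu0 rk; have [_ nj] := rtP _ bj.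
  by rewrite -e in nj; rewrite (separated b bj nri nj).
move=> lambda' nr /(eigenvalue_root n_gt2).
have [l0 l1] := excl _ nr; have [mu0 _] := small b nr.
case=> [e|e|[k kK rk]]; [by rewrite e eqxx in l0 | by rewrite e eqxx in l1 |].
have [j [bj e]] := ex k _ kK mu0 rk; have [_ nj] := rtP _ bj.
rewrite -e in nj; have ij := separated b bj nr nj.
by rewrite ij -e; ring.
Qed.

End Counting.

(** * From branches to intervals *)

From mathcomp Require Import classical_sets.

Section IntervalsAsBranches.
Variables (R : realType) (n : nat).
Local Open Scope classical_set_scope.

(** All powers of q in the statement are powers of its inverse square root. *)
Lemma powR_half q m : (0 < q)%N ->
  q%:R `^ (- (m%:R / 2)) = (q%:R `^ (- 2^-1)) ^+ m :> R.
Proof.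
move=> q0; rewrite -powR_mulrn ?powR_ge0 // -powRrM; congr (_ `^ _).
by rewrite mulNr mulrC.
Qed.

Lemma powR_half_sqr q : (0 < q)%N -> (q%:R `^ (- 2^-1)) ^+ 2 = q%:R^-1 :> R.
Proof. by move=> q0; rewrite -powR_half // divff ?pnatr_eq0 // powR_inv1 // ler0n. Qed.

Lemma alpha_minn k : k%:R / 2 + alpha R k = (k + minn k 2)%:R / 2.
Proof.
rewrite natrD mulrDl; congr (_ + _); rewrite /alpha minEle.
have [k2|k2] := leqP k 2.
  by rewrite ifT // ler_pdivrMr // mul1r ler_nat.
rewrite ifF ?divff ?pnatr_eq0 //.
by apply/negbTE; rewrite -ltNge ltr_pdivlMr // mul1r ltr_nat.
Qed.

Lemma Dfam_near (C : R) q k (I : set R) : (0 < q)%N -> (0 < k)%N -> (2 * k < n)%N -> Dfam C n q k I ->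
  exists j, (k, j) \in branches n /\
    I = [set lambda | near n C (q%:R `^ (- 2^-1)) (k, j) (n%:R - 2 - lambda)].
Proof.
move=> q0 k0 kn; set s := q%:R `^ _.
have s2 m : s ^+ (2 * m) = q%:R ^- m by rewrite exprM powR_half_sqr // exprVn.
case=> [[zeta [j [jN zE]] ->]|[on ->]].
  have jN' : (0 < j < n - 2 * k + 2)%N by lia.
  have jleN : (j <= n - 2 * k + 2)%N by lia.
  pose j' := if zeta == cheb_root R (n - 2 * k + 2) j then (n - 2 * k + 2 - j)%N else j.
  have z' : cheb_root R (n - 2 * k + 2) j' = - zeta.
    rewrite /j'; case: eqP => [->|ne]; first by rewrite cheb_root_refl //; lia.
    by case: zE => // ->; rewrite opprK.
  have m' : middle n (k, j') = false by rewrite /middle /j' /=; case: ifP => _; lia.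
  exists j'; split.
    by rewrite mem_branches k0 kn /j'; case: ifP => _; lia.
  have e lambda : n%:R - 2 - lambda - - zeta * s ^+ k = - (lambda - (n%:R - 2 + zeta * s ^+ k)) by ring.
  by apply/seteqP; split=> lambda;
    rewrite /Dint /near /center /rate /gap m' /= z' alpha_minn !powR_half // -/s e normrN.
exists ((n - 2 * k + 2)./2); split; first by rewrite mem_branches k0 kn /=; lia.
have m : middle n (k, (n - 2 * k + 2)./2) by rewrite /middle /=; lia.
have nk : (n - 2 * k)%:R = n%:R - 2 * k%:R :> R by rewrite natrB 1?ltnW // natrM.
have nk2 : (n - 2 * k).+2%:R = n%:R - 2 * k%:R + 2 :> R by rewrite -addn2 natrD nk.
have k2 : (2 * k + 2 = 2 * k.+1)%N by lia.
have e lambda x : n%:R - 2 - lambda - - x = - (lambda - (n%:R - 2 + x)) :> R by ring.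
by apply/seteqP; split=> lambda;
  rewrite /Dtilde /near /center /rate /gap m /= nk nk2 k2 !s2 mulNr e normrN.
Qed.

End IntervalsAsBranches.

Local Open Scope classical_set_scope.
Local Open Scope ring_scope.

Theorem theorem1p5 (R : realType) (n : nat) (hn : (3 <= n)%N) :
  (forall F : finFieldType,
     [/\ eigenvalue_mult F n (0 : R) 1,
         eigenvalue_mult F n (n%:R - 1 : R) (n - 2) &
         ~~ odd n ->
         eigenvalue_mult F n (n%:R - 2 : R) (qbinom F n n./2 - qbinom F n n./2.-1)])
  /\
  exists q0 C : R,
    [/\ 0 < q0, 0 < C &
      forall F : finFieldType, q0 <= #|F|%:R ->
        trivIset (\bigcup_(k in [set k | (1 <= k <= n.-1./2)%N]) Dfam C n #|F| k) id
        /\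
        forall k : nat, (1 <= k <= n.-1./2)%N ->
        forall I : set R, Dfam C n #|F| k I ->
        exists lambda : R,
          [/\ I lambda,
              eigenvalue_mult F n lambda (qbinom F n k - qbinom F n k.-1) &
              forall mu : R, I mu -> passmx.leigenvalue (upper_laplacian F n R) mu ->
                mu = lambda]].
Proof.
split=> [F|]; first by split; [exact: mult_zero | exact: mult_top | exact: mult_half].
have kb k : (1 <= k <= n.-1./2)%N -> (0 < k)%N /\ (2 * k < n)%N by clear; lia.
have [C [e0 [C0 e0_gt0 roots]]] := branch_roots R n.
have [e1 e1_gt0 sep] := branches_separated n C0.
have [e2 e2_gt0 small] := near_small n C0.
pose e := Num.min e0 (Num.min e1 e2).
have e_gt0 : 0 < e by rewrite !lt_min e0_gt0 e1_gt0.
exists (e ^- 2), C; split=> //; first by rewrite invr_gt0 exprn_gt0.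
move=> F qle; set q := #|F| in qle *; pose s : R := q%:R `^ (- 2^-1).
have q1 : (1 < q)%N by exact: q_gt1.
have qR : 0 < q%:R :> R by rewrite ltr0n ltnW.
have s_gt0 : 0 < s by rewrite powR_gt0.
have s2 : s ^+ 2 = q%:R^-1 by apply: powR_half_sqr; exact: ltnW.
have se : s <= e.
  have : s ^+ 2 <= e ^+ 2 by rewrite s2 -[leRHS]invrK lef_pV2 // posrE invr_gt0 exprn_gt0.
  by rewrite ler_pXn2r // nnegrE ltW.
move: se; rewrite !le_min => /and3P[se0 se1 se2].
have sepF mu i i' : i \in branches n -> i' \in branches n -> near n C s i mu -> near n C s i' mu -> i = i'.
  exact: sep.
have smallF mu i : i \in branches n -> near n C s i mu -> mu != 0 /\ `|mu| < 1 by exact: small.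
have rootF i : i \in branches n ->
    exists2 mu, root (char_shoot (ratio R q i.1 n) (n - 2 * i.1).+1) mu & near n C s i mu.
  by move=> b; exact: roots.
have famE k I : (1 <= k <= n.-1./2)%N -> Dfam C n q k I ->
  exists j, (k, j) \in branches n /\ I = [set lambda | near n C s (k, j) (n%:R - 2 - lambda)].
  by move=> /kb[k0 kn]; apply: Dfam_near; rewrite // ltnW.
split=> [I I' [k kK DI] [k' kK' DI'] [lambda [/= Il I'l]]|k kK I DI].
  have [j [b IE]] := famE _ _ kK DI; have [j' [b' IE']] := famE _ _ kK' DI'.
  rewrite IE IE' in Il I'l *.
  by rewrite (sepF _ _ _ b b' Il I'l).
have [j [b ->]] := famE _ _ kK DI.
exact: (branch_eigenvalue hn sepF smallF rootF b).
Qed.
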